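(* Let $q\in\mathbb{N}^*$, $X=\{X_0,X_1,\dots,X_q\}$, $\mathcal{B}$ a Hall basis of $\mathcal{L}(X)$ and $(\xi_b)_{b\in\mathcal{B}}$ the associated coordinates of the second kind. Let $M\in\mathbb{N}$, $r,\delta>0$ and $f_0,\dots,f_q\in\mathcal{C}^{\omega,r}(B_{4\delta};\mathbb{K}^d)$. There exist $\eta,C_M>0$ such that, for every $u\in L^1((0,T);\mathbb{K}^q)$ with $T\le\eta$ and $\|u\|_{L^1(0,T)}\le\eta$, the ordered product of the $e^{\xi_b(t,1,u)f_b}$ over the infinite set $\mathcal{B}\cap S_M=\{b\in\mathcal{B};\ n(b)\le M\}$ converges uniformly on $B_\delta$ and, for each $t\in[0,T]$ and $p\in B_\delta$, $$\Big|x(t;f,u,p)-\overset{\rightarrow}{\prod_{b\in\mathcal{B}\cap S_M}}e^{\xi_b(t,1,u)f_b}\,p\Big|\le C_M\,\|u\|_{L^1(0,t)}^{M+1},$$ where $x(\cdot;f,u,p)$ is the solution of $\dot x(t)=f_0(x(t))+\sum_{i=1}^qu_i(t)f_i(x(t))$, $x(0)=p$.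
   Context: $\mathbb{K}=\mathbb{R}$ or $\mathbb{C}$, $d\ge1$, $\mathbb{N}=\{0,1,\dots\}$, $\mathbb{N}^*=\mathbb{N}\setminus\{0\}$. $B_\rho$ is the closed ball of centre $0$ and radius $\rho$ in $\mathbb{K}^d$. $\mathcal{C}^{\omega,r}(B_\rho;\mathbb{K}^d)$ is the space of (real-analytic) functions on an open neighbourhood of $B_\rho$, having continuous real derivatives of all orders, with finite norm $\sum_{j=1}^d\sum_{\alpha\in\mathbb{N}^d}\frac{r^{|\alpha|}}{\alpha!}\|\partial^\alpha f_j\|_{L^\infty(B_\rho)}$. $\|u\|_{L^1}=\sum_{i=1}^q\|u_i\|_{L^1}$. $e^gp$ is the value at time $1$ of the solution of $\dot x=g(x)$, $x(0)=p$; products are compositions (rightmost applied first). $\mathcal{L}(X)$ is the free Lie algebra over $\mathbb{K}$ on $X$. $\mathrm{Br}(X)$ is the free magma on $X$ (formal iterated brackets): it contains $X$ and all ordered pairs $(b_1,b_2)$ of its elements; for $b=(b_1,b_2)$, $\lambda(b)=b_1$, $\mu(b)=b_2$; $\mathrm{ad}_{b_1}(b_2)=(b_1,b_2)$; $n(b)$ is the total number of occurrences of $X_1,\dots,X_q$ in $b$. The evaluation map $\mathrm{Br}(X)\to\mathcal{L}(X)$ replaces formal brackets by Lie brackets. A Hall set is a totally ordered subset $B\subset\mathrm{Br}(X)$ such that: $X\subset B$; for $b=(b_1,b_2)\in\mathrm{Br}(X)$, $b\in B$ iff $b_1,b_2\in B$, $b_1<b_2$ and either $b_2\in X$ or $\lambda(b_2)\le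 b_1$; and $b_1<(b_1,b_2)$ whenever $b_1,b_2,(b_1,b_2)\in B$. The evaluation map is injective on $B$ and its image $\mathcal{B}$ is a basis of $\mathcal{L}(X)$, called a Hall basis; elements of $\mathcal{B}$ are identified with those of $B$. Coordinates of the second kind with controls $u_0\equiv1$ and $u=(u_1,\dots,u_q)$: $\xi_{X_0}(t,1,u)=t$, $\xi_{X_i}(t,1,u)=\int_0^tu_i$ for $i\ge1$; for $b\in\mathcal{B}\setminus X$ there are unique $b_1<b_2$ in $\mathcal{B}$ and a unique maximal $m\in\mathbb{N}^*$ with $b=\mathrm{ad}_{b_1}^m(b_2)$, and $\xi_b(t,1,u)=\frac1{m!}\int_0^t\xi_{b_1}^m\,\dot\xi_{b_2}\,\mathrm{d}\tau$. $f_b$ is the vector field obtained by replacing each $X_i$ by $f_i$ in $b$, with $[f,g]=(Dg)f-(Df)g$. Ordered products: for a totally ordered set $J$ and vector fields $(h_j)_{j\in J}$, for a finite subset $J_1=\{j_1<\dots<j_n\}$ put $\overset{\rightarrow}{\prod}_{j\in J_1}e^{h_j}=e^{h_{j_1}}\cdots e^{h_{j_n}}$. The ordered product over $J$ converges uniformly on $B_\delta$ to $g\in\mathcal{C}^0(B_\delta;\mathbb{K}^d)$ if for every $\varepsilon>0$ there is a finite $J_0\subset J$ such that for every finite $J_1$ with $J_0\subset J_1\subset J$ and every $p\in B_\delta$, $|g(p)-\overset{\rightarrow}{\prod}_{j\in J_1}e^{h_j}p|\le\varepsilon$; then $\overset{\rightarrow}{\prod}_{j\in J}e^{h_j}:=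g$.
   Formalization: For K = C the fields f_0,…,f_q are taken holomorphic (complex derivatives), not merely real-analytic: with d=q=M=1, f_0(x)=conj(x), f_1=1, X_0 minimal and u=iε the estimate fails, the error being of order ε; K = R is unchanged. *)

(* Defs.v *)
From HB Require Import structures.
From mathcomp Require Import all_boot all_order all_algebra complex.
From mathcomp Require Import all_classical all_reals all_analysis.

Set Implicit Arguments.
Unset Strict Implicit.
Unset Printing Implicit Defensive.

Import Order.TTheory GRing.Theory Num.Theory.
Import numFieldNormedType.Exports.

Local Open Scope classical_set_scope.
Local Open Scope ring_scope.

(** * Scalars: K is either R or C = R[i] *)

Variant scalars := RealScalars | ComplexScalars.

Definition K (R : realType) (k : scalars) : numFieldType :=
  match k with
  | RealScalars => R : numFieldType
  | ComplexScalars => R[i] : numFieldType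
  end.

Definition ofR (R : realType) (k : scalars) : R -> K R k :=
  match k return R -> K R k with
  | RealScalars => fun x => x
  | ComplexScalars => fun x => Complex x 0
  end.
Arguments ofR {R} k.

(* In MathComp the norm of [R[i]] is valued in [R[i]]; this is the real
   modulus. *)
Definition cabs (R : realType) (k : scalars) : K R k -> R :=
  match k return K R k -> R with
  | RealScalars => fun z => `|z|
  | ComplexScalars => fun z => complex.Re `|z|
  end.

Definition integrableK (R : realType) (k : scalars) (D : set R) :
    (R -> K R k) -> Prop :=
  match k return (R -> K R k) -> Prop with
  | RealScalars => fun h =>
      (@lebesgue_measure R).-integrable D (EFin \o h)
  | ComplexScalars => fun h =>
      (@lebesgue_measure R).-integrable D (EFin \o (fun s => complex.Re (h s)))
      /\ (@lebesgue_measure R).-integrable D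
           (EFin \o (fun s => complex.Im (h s)))
  end.

Definition integralK (R : realType) (k : scalars) (D : set R) :
    (R -> K R k) -> K R k :=
  match k return (R -> K R k) -> K R k with
  | RealScalars => fun h => \int[@lebesgue_measure R]_(s in D) h s
  | ComplexScalars => fun h =>
      Complex (\int[@lebesgue_measure R]_(s in D) complex.Re (h s))
              (\int[@lebesgue_measure R]_(s in D) complex.Im (h s))
  end.

(** * The free magma on X_0, ..., X_q and Hall sets *)

Inductive br (q : nat) : Type :=
  | Gen of 'I_q.+1
  | Pair of br q & br q.

HB.instance Definition _ (q : nat) := gen_eqMixin (br q).

(* Number of occurrences of X_1, ..., X_q; X_0 is not counted. *)
Fixpoint nocc (q : nat) (b : br q) : nat :=
  match b with
  | Gen i => (i != ord0)%N
  | Pair b1 b2 => (nocc b1 + nocc b2)%N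
  end.

Definition slt (q : nat) (le : rel (br q)) : rel (br q) :=
  fun b1 b2 => (b1 != b2) && le b1 b2.

(* Only the restriction of [le] to [B] is relevant. The associated Hall basis of
   the free Lie algebra is identified with [B]: evaluation of formal brackets is
   injective on [B]. *)
Record hall_set (q : nat) (B : set (br q)) (le : rel (br q)) : Prop := {
  hall_refl : forall a, B a -> le a a ;
  hall_anti : forall a b, B a -> B b -> le a b -> le b a -> a = b ;
  hall_trans : forall a b c, B a -> B b -> B c ->
    le a b -> le b c -> le a c ;
  hall_total : forall a b, B a -> B b -> le a b \/ le b a ;
  hall_gen : forall i, B (Gen i) ;
  hall_pair : forall b1 b2, B (Pair b1 b2) <->
    [/\ B b1, B b2, slt le b1 b2 &
        match b2 with
        | Gen _ => True
        | Pair l _ => le l b1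
        end] ;
  hall_lt : forall b1 b2, B b1 -> B b2 -> B (Pair b1 b2) ->
    slt le b1 (Pair b1 b2)
}.

(** * Coordinates of the second kind *)

(* Derivative of a K-valued function of a real variable; [lim] returns an
   unspecified value where the limit does not exist, which only happens on a
   Lebesgue-null set for the absolutely continuous functions below. *)
Definition time_deriv (R : realType) (k : scalars) (x : R -> K R k) (t : R) :
    K R k :=
  lim ((ofR k (s - t)^-1 * (x s - x t)) @[s --> t^']).

(* [xi u b t] is xi_b(t,1,u). For [b = Pair b1 c], [strip] removes from [c]
   every further leading [b1], so that it ends on the decomposition
   [b = ad_{b1}^m b2] with [m] maximal. For [b] in a Hall set, all the
   intermediate trees lie in the Hall set and b1 < b2. *)
Fixpoint xi (R : realType) (k : scalars) (q : nat) (u : 'I_q -> R -> K R k)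
    (b : br q) {struct b} : R -> K R k :=
  match b with
  | Gen i => fun t =>
      match unlift ord0 i with
      | None => ofR k t
      | Some j => integralK `]0, t[ (u j)
      end
  | Pair b1 c =>
      let fix strip (m : nat) (c : br q) {struct c} : R -> K R k :=
        let here := fun t =>
          (m`!%:R)^-1 *
          integralK `]0, t[ (fun s => xi u b1 s ^+ m * time_deriv (xi u c) s) in
        match c with
        | Gen _ => here
        | Pair c1 c2 => if c1 == b1 then strip m.+1 c2 else here
        end
      in strip 1%N c
  end.

(** * Vector fields on K^d *)

Definition enorm (R : realType) (k : scalars) (d : nat) (x : 'rV[K R k]_d) : R :=
  Num.sqrt (\sum_(j < d) cabs (x 0 j) ^+ 2).

Definition cball (R : realType) (k : scalars) (d : nat) (rho : R) :
    set 'rV[K R k]_d :=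
  [set x | enorm x <= rho].
Arguments cball {R} k d rho.

Definition pderiv (R : realType) (k : scalars) (d : nat) (j : 'I_d)
    (g : 'rV[K R k]_d -> K R k) : 'rV[K R k]_d -> K R k :=
  fun x => 'D_(delta_mx 0 j) (g : _ -> (K R k)^o) x.

Definition mderiv (R : realType) (k : scalars) (d : nat)
    (alpha : {ffun 'I_d -> nat}) (g : 'rV[K R k]_d -> K R k) :
    'rV[K R k]_d -> K R k :=
  foldr (fun j h => iter (alpha j) (pderiv j) h) g (enum 'I_d).

(* Every iterated partial derivative exists and is Frechet differentiable,
   hence continuous, on the open set U. Derivatives are over K: for K = C the
   functions are holomorphic, so that [(f, g) |-> (Dg) f - (Df) g] is C-bilinear
   and complex controls make sense. *)
Definition smooth_on (R : realType) (k : scalars) (d : nat)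
    (U : set 'rV[K R k]_d) (g : 'rV[K R k]_d -> K R k) : Prop :=
  forall (s : seq 'I_d) (x : 'rV[K R k]_d), U x ->
    differentiable (foldr (@pderiv R k d) g s : _ -> (K R k)^o) x.

(* The sup norm over the ball coincides with the L^infinity norm, the
   derivatives being continuous. *)
Definition sup_norm (R : realType) (k : scalars) (d : nat) (rho : R)
    (g : 'rV[K R k]_d -> K R k) : \bar R :=
  ereal_sup [set (cabs (g x))%:E | x in cball k d rho].

Definition omega_norm (R : realType) (k : scalars) (d : nat) (r rho : R)
    (f : 'rV[K R k]_d -> 'rV[K R k]_d) : \bar R :=
  (\sum_(j < d) \esum_(alpha in [set: {ffun 'I_d -> nat}])
     (r ^+ (\sum_(i < d) alpha i)%N / (\prod_(i < d) (alpha i)`!)%:R)%:E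
     * sup_norm rho (mderiv alpha (fun x => f x 0%R j)))%E.

(* f belongs to C^{omega,r}(B_rho; K^d), U being its domain. Values of f
   outside U are never used. *)
Definition in_Comega (R : realType) (k : scalars) (d : nat) (r rho : R)
    (U : set 'rV[K R k]_d) (f : 'rV[K R k]_d -> 'rV[K R k]_d) : Prop :=
  [/\ open U, cball k d rho `<=` U,
      forall j, smooth_on U (fun x => f x 0 j) &
      (omega_norm r rho f < +oo)%E].

Definition lie_bracket (R : realType) (k : scalars) (d : nat)
    (f g : 'rV[K R k]_d -> 'rV[K R k]_d) : 'rV[K R k]_d -> 'rV[K R k]_d :=
  fun x => 'd g x (f x) - 'd f x (g x).

Fixpoint vf (R : realType) (k : scalars) (d q : nat)
    (f : 'I_q.+1 -> 'rV[K R k]_d -> 'rV[K R k]_d) (b : br q) :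
    'rV[K R k]_d -> 'rV[K R k]_d :=
  match b with
  | Gen i => f i
  | Pair b1 b2 => lie_bracket (vf f b1) (vf f b2)
  end.

(** * Flows and ordered products *)

(* The limit is taken within [0,1], hence one-sided at the end points. *)
Definition flow (R : realType) (k : scalars) (d : nat) (U : set 'rV[K R k]_d)
    (h : 'rV[K R k]_d -> 'rV[K R k]_d) (p y : 'rV[K R k]_d) : Prop :=
  exists x : R -> 'rV[K R k]_d,
    [/\ x 0 = p, x 1 = y &
        forall t : R, 0 <= t <= 1 ->
          U (x t) /\
          (ofR k (s - t)^-1 *: (x s - x t))
            @[s --> within `[0, 1] t^'] --> h (x t)].

(* e^{h_{j_1}} ... e^{h_{j_n}} p is defined and equal to y; e^{h_{j_n}} is
   applied first. *)
Fixpoint oprod (R : realType) (k : scalars) (d : nat) (J : Type)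
    (U : set 'rV[K R k]_d) (h : J -> 'rV[K R k]_d -> 'rV[K R k]_d)
    (s : seq J) (p y : 'rV[K R k]_d) : Prop :=
  match s with
  | [::] => y = p
  | j :: s' => exists2 z, oprod U h s' p z & flow U (h j) z y
  end.

(* A finite subset of J is represented by its strictly increasing
   enumeration. *)
Definition oprod_cvg (R : realType) (k : scalars) (d q : nat)
    (U : set 'rV[K R k]_d) (le : rel (br q)) (J : set (br q))
    (h : br q -> 'rV[K R k]_d -> 'rV[K R k]_d) (delta : R)
    (g : 'rV[K R k]_d -> 'rV[K R k]_d) : Prop :=
  forall eps : R, 0 < eps ->
    exists2 J0 : seq (br q), (forall b, b \in J0 -> J b) &
      forall J1 : seq (br q),
        pairwise (slt le) J1 -> (forall b, b \in J1 -> J b) ->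
        {subset J0 <= J1} ->
        forall p, cball k d delta p ->
          exists2 y, oprod U h J1 p y & enorm (g p - y) <= eps.

(** * The controlled system *)

Definition L1norm (R : realType) (k : scalars) (q : nat) (D : set R)
    (u : 'I_q -> R -> K R k) : R :=
  \sum_(i < q) \int[@lebesgue_measure R]_(s in D) cabs (u i s).

(* Caratheodory solution, staying in the common domain U of the f_i. *)
Definition is_solution (R : realType) (k : scalars) (d q : nat)
    (U : set 'rV[K R k]_d) (f : 'I_q.+1 -> 'rV[K R k]_d -> 'rV[K R k]_d)
    (T : R) (u : 'I_q -> R -> K R k) (p : 'rV[K R k]_d)
    (x : R -> 'rV[K R k]_d) : Prop :=
  [/\ {within `[0, T], continuous x},
      forall t, 0 <= t <= T -> U (x t) &
      forall t, 0 <= t <= T -> forall j : 'I_d,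
        x t 0 j = p 0 j +
          integralK `]0, t[ (fun s => f ord0 (x s) 0 j +
            \sum_(i < q) u i s * f (lift ord0 i) (x s) 0 j)].

(* Main.v *)
From HB Require Import structures.
Require Import Defs.
From mathcomp Require Import all_boot all_order all_algebra complex.
From mathcomp Require Import all_classical all_reals all_analysis.
From mathcomp Require Import measurable_realfun.
From mathcomp Require Import ring lra zify.

Set Implicit Arguments.
Unset Strict Implicit.
Unset Printing Implicit Defensive.

Import Order.TTheory GRing.Theory Num.Theory.
Import numFieldNormedType.Exports.

(** Fix a test function phi, in the end a coordinate, and a point p. Both x(t) and a
    finite product of exponentials are compared with p through the same data: the
    word function c = chi f p phi, whose value on a word w is the iterated Lie
    derivative of phi along the f_i read off w, taken at p. A bracket b acts on word
    functions as the iterated commutator tau b, and it represents the Lie derivative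
    along f_b (chi_vf). The value phi(x(t)) is the sum of the Chen iterated integrals
    of c (chen_rem, itint), and phi of a product of exponentials of the xi_b f_b is
    the composition of the exponentials of the xi_b tau b, applied to c
    (oprod_expand, taylor_term, expprod).

    Algebra. Suppose that c vanishes on the words with more than L letters, or with
    more than M letters other than X_0. Then only finitely many Hall elements act on
    c, and both expansions agree exactly (expprod_itint). This is Lazard elimination:
    a product over a final segment s of the sorted Hall set solves a linear
    differential equation that only involves the free generators of the part of the
    Lie algebra spanned by s, and removing the least element b0 of s replaces these
    generators by their images under the powers of ad b0 (lazard_sum, expprod_AC).
    The coefficients match because the density of xi at ad_(b0)^m(b) is the divided
    power xi_(b0)^m / m! times the density of xi_b.

    Analysis. Cauchy estimates bound f_b by a geometric factor times |b|! (bd_vf). On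
    the other hand xi_b is at most geometric times t^n / n! times the power nocc b of
    the norm of u, where n is the number of occurrences of X_0 in b (xi_bound).
    Since nocc b <= M, the factorial n! compensates |b|! up to a geometric factor,
    and there are only exponentially many brackets of a given length (tree_sum). For
    small times and controls, all the expansions converge absolutely, uniformly in p.

    Truncation. Give a word with n letters, N of them other than X_0, the weight
    2^(-n) theta^N, where theta is proportional to the norm of u. All the bounds are
    multiplicative, so that they survive after division of every term by its weight
    (taylor_wcut_le, itint_wcut_le). Therefore the words with N > M contribute at
    most a constant times theta^(M+1), which is the announced error, and the words
    with n > L at most a constant times 2^(-L), which disappears as L grows. Truncating
    by the length alone shows that every finite product that contains the Hall
    elements of length at most L is within a constant times 2^(-L) of the explicit
    expression gtrunc L (near_gtrunc), a polynomial in finitely many Lie derivatives at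
    p. This gives the convergence of the ordered product and the continuity of its
    limit. *)

Local Open Scope classical_set_scope.
Local Open Scope ring_scope.
Local Notation mbl D := (measurable (D : set (measurableTypeR _))).

(** * Scalars: real part, imaginary part, modulus *)

Section Scalars.
Variables (R : realType) (k : scalars).
Local Notation K := (K R k).

Definition reK : K -> R :=
  match k return Defs.K R k -> R with
  | RealScalars => fun z => z
  | ComplexScalars => fun z => complex.Re z
  end.

Definition imK : K -> R :=
  match k return Defs.K R k -> R with
  | RealScalars => fun=> 0
  | ComplexScalars => fun z => complex.Im z
  end.

Lemma reKD x y : reK (x + y) = reK x + reK y.
Proof. by rewrite /reK; case: k x y => //= [[? ?] [? ?]]. Qed.

Lemma imKD x y : imK (x + y) = imK x + imK y.
Proof. by rewrite /imK; case: k x y => //= [x y|[? ?] [? ?]] //; rewrite addr0. Qed.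

Lemma reKN x : reK (- x) = - reK x.
Proof. by rewrite /reK; case: k x => //= [[? ?]]. Qed.

Lemma imKN x : imK (- x) = - imK x.
Proof. by rewrite /imK; case: k x => //= [x|[? ?]] //; rewrite oppr0. Qed.

Lemma reKM x y : reK (x * y) = reK x * reK y - imK x * imK y.
Proof.
by rewrite /reK /imK; case: k x y => //= [x y|[? ?] [? ?]] //; rewrite mulr0 subr0.
Qed.

Lemma imKM x y : imK (x * y) = reK x * imK y + imK x * reK y.
Proof.
rewrite /reK /imK; case: k x y => //= [x y|[? ?] [? ?]] //=.
by rewrite mulr0 mul0r addr0.
Qed.

Lemma reK_ofR (x : R) : reK (ofR k x) = x.
Proof. by rewrite /reK /ofR; case: k. Qed.

Lemma imK_ofR (x : R) : imK (ofR k x) = 0.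
Proof. by rewrite /imK /ofR; case: k. Qed.

Lemma eqK (x y : K) : reK x = reK y -> imK x = imK y -> x = y.
Proof. by rewrite /reK /imK; case: k x y => //= [[? ?] [? ?]] /= -> ->. Qed.

Lemma reK0 : reK 0 = 0. Proof. by rewrite /reK; case: k. Qed.
Lemma imK0 : imK 0 = 0. Proof. by rewrite /imK; case: k. Qed.

Lemma reKB x y : reK (x - y) = reK x - reK y.
Proof. by rewrite reKD reKN. Qed.
Lemma imKB x y : imK (x - y) = imK x - imK y.
Proof. by rewrite imKD imKN. Qed.

Fact ofR_additive : zmod_morphism (@ofR R k).
Proof.
by move=> x y; apply: eqK; rewrite ?(reKB, imKB, reK_ofR, imK_ofR) ?subr0.
Qed.
Fact ofR_multiplicative : monoid_morphism (@ofR R k).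
Proof.
split; first by rewrite /ofR; case: k.
move=> x y; apply: eqK;
by rewrite ?(reKM, imKM, reK_ofR, imK_ofR) ?mulr0 ?mul0r ?addr0 ?subr0.
Qed.
HB.instance Definition _ := GRing.isZmodMorphism.Build R K (@ofR R k) ofR_additive.
HB.instance Definition _ := GRing.isMonoidMorphism.Build R K (@ofR R k) ofR_multiplicative.

Lemma cabsE (z : K) : cabs z = Num.sqrt (reK z ^+ 2 + imK z ^+ 2).
Proof.
rewrite /cabs /reK /imK; case: k z => /= [z|[a b]].
  by rewrite expr0n /= addr0 sqrtr_sqr.
by [].
Qed.

Lemma normE (z : K) : `|z| = ofR k (cabs z).
Proof. by rewrite /cabs /ofR; case: k z => /= [z|[a b]]. Qed.

Lemma ler_ofR (x y : R) : (ofR k x <= ofR k y) = (x <= y).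
Proof.
rewrite /ofR; case: k => //=.
by rewrite lecE /= eqxx.
Qed.
Lemma ltr_ofR (x y : R) : (ofR k x < ofR k y) = (x < y).
Proof.
rewrite /ofR; case: k => //=.
by rewrite ltcE /= eqxx.
Qed.

Lemma cabs_ge0 (z : K) : 0 <= cabs z.
Proof. by rewrite cabsE sqrtr_ge0. Qed.
Hint Resolve cabs_ge0 : core.

Lemma ofR_inj : injective (@ofR R k).
Proof. by move=> x y /(congr1 reK); rewrite !reK_ofR. Qed.

Lemma cabsD (x y : K) : cabs (x + y) <= cabs x + cabs y.
Proof. by rewrite -ler_ofR rmorphD /= -!normE ler_normD. Qed.
Lemma cabsM (x y : K) : cabs (x * y) = cabs x * cabs y.
Proof. by apply: ofR_inj; rewrite rmorphM /= -!normE normrM. Qed.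
Lemma cabsN (x : K) : cabs (- x) = cabs x.
Proof. by apply: ofR_inj; rewrite -!normE normrN. Qed.
Lemma cabs0 : cabs (0 : K) = 0.
Proof. by apply: ofR_inj; rewrite -!normE normr0 rmorph0. Qed.
Lemma cabs1 : cabs (1 : K) = 1.
Proof. by apply: ofR_inj; rewrite -!normE normr1 rmorph1. Qed.
Lemma cabs_eq0 (x : K) : cabs x = 0 -> x = 0.
Proof. by move=> h; apply/normr0_eq0; rewrite normE h rmorph0. Qed.
Lemma cabs_ofR (x : R) : cabs (ofR k x) = `|x|.
Proof. by rewrite cabsE reK_ofR imK_ofR expr0n addr0 sqrtr_sqr. Qed.
Lemma cabsX (x : K) n : cabs (x ^+ n) = cabs x ^+ n.
Proof. by elim: n => [|n ih]; rewrite ?cabs1 // !exprS cabsM ih. Qed.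
Lemma cabsB (x y : K) : cabs (x - y) = cabs (y - x).
Proof. by rewrite -cabsN opprB. Qed.
Lemma cabs_nat n : cabs (n%:R : K) = n%:R.
Proof. by rewrite -(rmorph_nat (@ofR R k)) cabs_ofR ger0_norm. Qed.
Lemma cabsV (x : K) : cabs (x^-1) = (cabs x)^-1.
Proof. by apply: ofR_inj; rewrite fmorphV /= -!normE normfV. Qed.
Lemma cabs_natV n : cabs (n%:R^-1 : K) = n%:R^-1.
Proof. by rewrite cabsV cabs_nat. Qed.
Lemma cabs_tri (x y : K) : cabs x <= cabs (x - y) + cabs y.
Proof. by have := cabsD (x - y) y; rewrite subrK. Qed.
Lemma cabs_sum (I : Type) (s : seq I) (P : pred I) (F : I -> K) :
  cabs (\sum_(i <- s | P i) F i) <= \sum_(i <- s | P i) cabs (F i).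
Proof.
elim/big_ind2: _ => [|x x' y y' h h'|//]; first by rewrite cabs0.
by apply: (le_trans (cabsD _ _)); apply: lerD.
Qed.

Lemma re_le (z : K) : `|reK z| <= cabs z.
Proof.
rewrite cabsE -(@sqrtr_sqr _ (reK z)) ler_wsqrtr // lerDl sqr_ge0 //.
Qed.
Lemma im_le (z : K) : `|imK z| <= cabs z.
Proof.
rewrite cabsE -(@sqrtr_sqr _ (imK z)) ler_wsqrtr // lerDr sqr_ge0 //.
Qed.
Lemma cabs_le (z : K) : cabs z <= `|reK z| + `|imK z|.
Proof.
rewrite cabsE -[leRHS]ger0_norm ?addr_ge0 // -sqrtr_sqr ler_wsqrtr //.
rewrite sqrrD !real_normK ?num_real // lerD2r lerDl mulrn_wge0 // mulr_ge0 //.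
Qed.
Lemma cabs_sqr (z : K) : cabs z ^+ 2 = reK z ^+ 2 + imK z ^+ 2.
Proof. by rewrite cabsE sqr_sqrtr // addr_ge0 // sqr_ge0. Qed.

Definition dotK (z w : K) : R := reK z * reK w + imK z * imK w.

Lemma dotKD z x y : dotK z (x + y) = dotK z x + dotK z y.
Proof. by rewrite /dotK reKD imKD; ring. Qed.
Lemma dotKN z x : dotK z (- x) = - dotK z x.
Proof. by rewrite /dotK reKN imKN; ring. Qed.
Lemma dotKZ z (a : R) x : dotK z (ofR k a * x) = a * dotK z x.
Proof. by rewrite /dotK reKM imKM reK_ofR imK_ofR; ring. Qed.
Lemma dotKK z : dotK z z = cabs z ^+ 2.
Proof. by rewrite /dotK cabs_sqr !expr2. Qed.
Lemma dotK_le z w : `|dotK z w| <= cabs z * cabs w.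
Proof.
rewrite -(@ler_pXn2r _ 2) ?nnegrE ?mulr_ge0 //.
rewrite real_normK ?num_real // exprMn !cabs_sqr /dotK -subr_ge0.
have -> : (reK z ^+ 2 + imK z ^+ 2) * (reK w ^+ 2 + imK w ^+ 2) -
  (reK z * reK w + imK z * imK w) ^+ 2 = (reK z * imK w - imK z * reK w) ^+ 2.
  ring.
exact: sqr_ge0.
Qed.
(** Replaces the choice of a phase for z when a modulus is to be bounded by a
    real quantity. *)
Lemma cabs_dot_le (z : K) (c : R) : 0 <= c -> dotK z z <= cabs z * c -> cabs z <= c.
Proof.
move=> c0; rewrite dotKK expr2.
have [->|z0] := eqVneq (cabs z) 0; first by [].
by rewrite ler_pM2l // lt_def z0 /=.
Qed.

End Scalars.
Arguments reK {R k} z.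
Arguments imK {R k} z.
#[export] Hint Extern 0 (is_true (0 <= cabs _)) => exact: cabs_ge0 : core.

(** * Integrals of scalar functions *)

Section RealIntegral.
Variable R : realType.
Local Notation mu := (@lebesgue_measure R).

Lemma Rint_split (f : R -> R) (s t : R) : 0 <= s -> s <= t ->
  mu.-integrable `]0, t[ (EFin \o f) ->
  \int[mu]_(x in `]0, t[) f x =
  \int[mu]_(x in `]0, s[) f x + \int[mu]_(x in `]s, t[) f x.
Proof.
move=> s0; rewrite le_eqVlt => /orP[/eqP <- _|st ift].
  rewrite [in X in _ + X](_ : `]s, s[%classic = set0) ?Rintegral_set0 ?addr0 //.
  by apply: set_itv_ge; rewrite bnd_simp ltxx.
have := @Rintegral_itvB R f (BRight 0) (BLeft t) s ift.
rewrite !bnd_simp => /(_ s0 st) <-.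
rewrite (Rintegral_itv_bndo_bndc (r := s)); first by rewrite addrC subrK.
apply: integrableS ift => //; apply: subset_itvl; rewrite bnd_simp; exact: ltW.
Qed.

Lemma integrable_sub0 (f : R -> \bar R) (s t T : R) : 0 <= s -> t <= T ->
  mu.-integrable `]0, T[ f -> mu.-integrable `]s, t[ f.
Proof.
by move=> s0 tT; apply: integrableS => //; apply: subset_itv; rewrite bnd_simp.
Qed.

Lemma Rint_continuous (f : R -> R) (T : R) : 0 <= T ->
  mu.-integrable `]0, T[ (EFin \o f) ->
  {within `[0, T], continuous (fun t => \int[mu]_(x in `]0, t[) f x)}.
Proof.
move=> T0 fi.
pose g := f \_ `]0, T[.
have gi : mu.-integrable setT (EFin \o g).
  by rewrite -restrict_EFin; apply/integrable_restrict => //=; rewrite setTI.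
have giT : mu.-integrable `[0, T] (EFin \o g) by exact: integrableS gi.
have := @parameterized_integral_continuous R 0 T g T0 giT.
apply: subspace_eq_continuous => t; rewrite inE /= in_itv /= => /andP[t0 tT].
rewrite /parameterized_integral /from_subspace /= -Rintegral_itv_obnd_cbnd; last exact: integrableS gi.
rewrite -Rintegral_itv_bndo_bndc; last exact: integrableS gi.
apply: eq_Rintegral => x; rewrite inE /= in_itv /= => /andP[x0 xt].
by rewrite /g patchE mem_set //= in_itv /= x0 (lt_le_trans xt).
Qed.

End RealIntegral.

Section KIntegral.
Variables (R : realType) (k : scalars).
Local Notation K := (K R k).
Local Notation mu := (@lebesgue_measure R).
Implicit Types (D : set R) (h : R -> K).

Lemma integrableKP D h : integrableK D h <->
  mu.-integrable D (EFin \o (fun s => reK (h s))) /\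
  mu.-integrable D (EFin \o (fun s => imK (h s))).
Proof.
rewrite /integrableK /reK /imK; case: k h => //= h; split => [hi|[]//].
split => //; exact: integrable0.
Qed.

Lemma reK_int D h : reK (integralK D h) = \int[mu]_(s in D) reK (h s).
Proof. by rewrite /integralK /reK; case: k h. Qed.

Lemma imK_int D h : imK (integralK D h) = \int[mu]_(s in D) imK (h s).
Proof.
rewrite /integralK /imK; case: k h => // h.
by rewrite /Rintegral integral0.
Qed.

Lemma integrableKS D E h : mbl D -> mbl E -> E `<=` D ->
  integrableK D h -> integrableK E h.
Proof.
move=> mD mE ED /integrableKP[hr hi]; apply/integrableKP.
by split; [exact: (integrableS mD mE ED hr)|exact: (integrableS mD mE ED hi)].
Qed.

Lemma eq_integrableK D h h' : mbl D -> (forall x, D x -> h x = h' x) ->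
  integrableK D h -> integrableK D h'.
Proof.
move=> mD e /integrableKP[hr hi]; apply/integrableKP.
by split; [apply: eq_integrable hr|apply: eq_integrable hi] => // x;
  rewrite inE => /e /= ->.
Qed.

Lemma eq_integralK D h h' : (forall x, D x -> h x = h' x) ->
  integralK D h = integralK D h'.
Proof.
move=> e; apply: eqK; rewrite ?reK_int ?imK_int; apply: eq_Rintegral => x;
  by rewrite inE => /e ->.
Qed.

Lemma integrableKD D h1 h2 : mbl D -> integrableK D h1 ->
  integrableK D h2 -> integrableK D (fun s => h1 s + h2 s).
Proof.
move=> mD /integrableKP[r1 i1] /integrableKP[r2 i2]; apply/integrableKP; split.
  by apply: eq_integrable (integrableD mD r1 r2) => // x _ /=; rewrite reKD.
by apply: eq_integrable (integrableD mD i1 i2) => // x _ /=; rewrite imKD.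
Qed.

Lemma integralKD D h1 h2 : mbl D -> integrableK D h1 ->
  integrableK D h2 -> integralK D (fun s => h1 s + h2 s) =
  integralK D h1 + integralK D h2.
Proof.
move=> mD /integrableKP[r1 i1] /integrableKP[r2 i2].
apply: eqK; rewrite ?reKD ?imKD ?reK_int ?imK_int -RintegralD //;
  by apply: eq_Rintegral => x _; rewrite ?reKD ?imKD.
Qed.

(** K carries no sigma-algebra here, so measurability is asked of both real
    components. *)
Definition measK (D : set (measurableTypeR R)) h := measurable_fun D (fun s => reK (h s)) /\
  measurable_fun D (fun s => imK (h s)).

Lemma integrableKM D h g (C : R) : mbl D -> integrableK D h -> measK D g ->
  (forall x, D x -> cabs (g x) <= C) -> integrableK D (fun s => h s * g s).
Proof.
move=> mD /integrableKP[r1 i1] [r2 i2] gC; apply/integrableKP.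
have br : [bounded (fun s => reK (g s)) x | x in D].
  exists C; split; [exact: num_real|move=> y Cy x /= Dx].
  by apply: (le_trans (re_le _)); apply: (le_trans (gC _ Dx)); exact: ltW.
have bi : [bounded (fun s => imK (g s)) x | x in D].
  exists C; split; [exact: num_real|move=> y Cy x /= Dx].
  by apply: (le_trans (im_le _)); apply: (le_trans (gC _ Dx)); exact: ltW.
split.
  apply: eq_integrable (integrableB mD (integrableMl mD r1 r2 br) (integrableMl mD i1 i2 bi)) => //.
  by move=> x _ /=; rewrite reKM EFinB !EFinM.
apply: eq_integrable (integrableD mD (integrableMl mD r1 i2 bi) (integrableMl mD i1 r2 br)) => //.
by move=> x _ /=; rewrite imKM EFinD !EFinM.
Qed.

Lemma measK_cst D (c : K) : measK D (fun=> c).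
Proof. by split; exact: measurable_cst. Qed.

Lemma integrableKZ D h (c : K) : mbl D -> integrableK D h ->
  integrableK D (fun s => c * h s).
Proof.
move=> mD hi; apply: (@eq_integrableK _ (fun s => h s * c)) => //.
  by move=> x _; rewrite mulrC.
by apply: (integrableKM (C := cabs c)) => //; exact: measK_cst.
Qed.

Lemma integralKZ D h (c : K) : mbl D -> integrableK D h ->
  integralK D (fun s => c * h s) = c * integralK D h.
Proof.
move=> mD /integrableKP[r1 i1].
have zr a : mu.-integrable D (EFin \o (fun s => a * reK (h s))).
  by apply: eq_integrable (integrableZl mD a r1) => // x _ /=; rewrite EFinM.
have zi a : mu.-integrable D (EFin \o (fun s => a * imK (h s))).
  by apply: eq_integrable (integrableZl mD a i1) => // x _ /=; rewrite EFinM.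
apply: eqK; rewrite ?reKM ?imKM ?reK_int ?imK_int.
  rewrite -!RintegralZl // -RintegralB //.
  by apply: eq_Rintegral => x _; rewrite reKM.
rewrite -!RintegralZl // -RintegralD //.
by apply: eq_Rintegral => x _; rewrite imKM.
Qed.

Lemma integrableK0 D : mbl D -> integrableK D (fun=> 0 : K).
Proof.
move=> mD; apply/integrableKP; rewrite reK0 imK0.
by split; exact: integrable0.
Qed.

Lemma integralK0 D : integralK D (fun=> 0 : K) = 0.
Proof.
by apply: eqK; rewrite ?reK_int ?imK_int ?reK0 ?imK0 /Rintegral integral0.
Qed.

Lemma integrableK_sum D (I : Type) (s : seq I) (P : pred I) (F : I -> R -> K) :
  mbl D -> (forall i, P i -> integrableK D (F i)) ->
  integrableK D (fun x => \sum_(i <- s | P i) F i x).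
Proof.
move=> mD Fi; elim: s => [|i s ih].
  by apply: (@eq_integrableK _ (fun=> 0)) (integrableK0 mD) => // x _; rewrite big_nil.
apply: (@eq_integrableK _ (fun x => (if P i then F i x else 0) + \sum_(j <- s | P j) F j x)) => //.
  by move=> x _; rewrite big_cons; case: ifP => //; rewrite add0r.
apply: integrableKD => //; move: (Fi i); case: (P i) => [/(_ isT) //|_].
exact: integrableK0.
Qed.

Lemma integralK_sum D (I : Type) (s : seq I) (P : pred I) (F : I -> R -> K) :
  mbl D -> (forall i, P i -> integrableK D (F i)) ->
  integralK D (fun x => \sum_(i <- s | P i) F i x) =
  \sum_(i <- s | P i) integralK D (F i).
Proof.
move=> mD Fi; elim: s => [|i s ih].
  by rewrite big_nil -[RHS](integralK0 D); apply: eq_integralK => x _; rewrite big_nil.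
rewrite big_cons; transitivity (integralK D (fun x => (if P i then F i x else 0) + \sum_(j <- s | P j) F j x)).
  by apply: eq_integralK => x _; rewrite big_cons; case: ifP => //; rewrite add0r.
rewrite integralKD //; last exact: integrableK_sum.
  by rewrite ih; case: (P i) => //; rewrite integralK0 add0r.
by move: (Fi i); case: (P i) => [/(_ isT) //|_]; exact: integrableK0.
Qed.

Lemma integrable_cabs D h : mbl D -> integrableK D h ->
  mu.-integrable D (EFin \o (fun s => cabs (h s))).
Proof.
move=> mD /integrableKP[hr hi].
have := integrableD mD (integrable_norm hr) (integrable_norm hi).
apply: le_integrable => //.
  apply/measurable_EFinP.
  have -> : (fun s => cabs (h s)) =
    Num.sqrt \o (fun s => reK (h s) ^+ 2 + imK (h s) ^+ 2).
    by apply/funext => s /=; rewrite cabsE.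
  apply: (@measurableT_comp _ _ _ (measurableTypeR R)) => //.
    exact: (continuous_measurable_fun (@sqrt_continuous R)).
  have mr := (measurable_EFinP _ _).1 (measurable_int _ hr).
  have mi := (measurable_EFinP _ _).1 (measurable_int _ hi).
  exact: (measurable_funD (measurable_funX 2 mr) (measurable_funX 2 mi)).
move=> x Dx /=; rewrite lee_fin; apply: le_trans (ler_norm _).
rewrite (ger0_norm (cabs_ge0 _)). exact: cabs_le.
Qed.

Lemma dotK_int D h z : mbl D -> integrableK D h ->
  dotK z (integralK D h) = \int[mu]_(s in D) dotK z (h s).
Proof.
move=> mD /integrableKP[r1 i1]; rewrite /dotK reK_int imK_int.
have zr a : mu.-integrable D (EFin \o (fun s => a * reK (h s))).
  by apply: eq_integrable (integrableZl mD a r1) => // x _ /=; rewrite EFinM.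
have zi a : mu.-integrable D (EFin \o (fun s => a * imK (h s))).
  by apply: eq_integrable (integrableZl mD a i1) => // x _ /=; rewrite EFinM.
by rewrite RintegralD // !RintegralZl.
Qed.

(** Pairing the integral with its own value reduces the inequality to real
    integrals, by cabs_dot_le. *)
Lemma le_integralK D h (psi : R -> R) : mbl D -> integrableK D h ->
  mu.-integrable D (EFin \o psi) -> (forall x, D x -> cabs (h x) <= psi x) ->
  cabs (integralK D h) <= \int[mu]_(s in D) psi s.
Proof.
move=> mD ih ip hp; apply: cabs_dot_le.
  by apply: Rintegral_ge0 => x Dx; exact: le_trans (cabs_ge0 _) (hp _ Dx).
set z := integralK D h; rewrite {2}/z dotK_int //.
rewrite -RintegralZl //; have /integrableKP[r1 i1] := ih.
have zp : mu.-integrable D (EFin \o (fun s => cabs z * psi s)).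
  by apply: eq_integrable (integrableZl mD (cabs z) ip) => // x _ /=; rewrite EFinM.
apply: le_Rintegral => //.
  rewrite /dotK.
  have zr a : mu.-integrable D (EFin \o (fun s => a * reK (h s))).
    by apply: eq_integrable (integrableZl mD a r1) => // x _ /=; rewrite EFinM.
  have zi a : mu.-integrable D (EFin \o (fun s => a * imK (h s))).
    by apply: eq_integrable (integrableZl mD a i1) => // x _ /=; rewrite EFinM.
  by apply: eq_integrable (integrableD mD (zr (reK z)) (zi (imK z))) => // x _ /=; rewrite EFinD.
move=> x Dx; apply: (le_trans (ler_norm _)); apply: (le_trans (dotK_le _ _)).
by rewrite ler_wpM2l ?cabs_ge0 ?hp.
Qed.

Lemma intK_split h (s t : R) : 0 <= s -> s <= t ->
  integrableK `]0, t[ h ->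
  integralK `]0, t[ h = integralK `]0, s[ h + integralK `]s, t[ h.
Proof.
move=> s0 st /integrableKP[hr hi].
by apply: eqK; rewrite ?reKD ?imKD ?reK_int ?imK_int (Rint_split s0 st).
Qed.

Lemma intK_diff_le h (psi : R -> R) (s t T : R) : 0 <= s -> s <= t -> t <= T ->
  integrableK `]0, T[ h -> mu.-integrable `]0, T[ (EFin \o psi) ->
  (forall x, s < x -> x < t -> cabs (h x) <= psi x) ->
  cabs (integralK `]0, t[ h - integralK `]0, s[ h) <=
  \int[mu]_(x in `]0, t[) psi x - \int[mu]_(x in `]0, s[) psi x.
Proof.
move=> s0 st tT ih ip hp.
have ih1 : integrableK `]0, t[ h.
  by apply: integrableKS ih => //; apply: subset_itvl; rewrite bnd_simp.
have ip1 : mu.-integrable `]0, t[ (EFin \o psi) by exact: integrable_sub0 ip.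
rewrite (intK_split s0 st) // (Rint_split s0 st) //.
rewrite [X in cabs (X - _)]addrC addrK [X in _ <= X - _]addrC addrK.
apply: le_integralK => //.
- by apply: integrableKS ih => //; apply: subset_itv; rewrite bnd_simp.
- exact: integrable_sub0 ip.
- by move=> x /=; rewrite in_itv /= => /andP[? ?]; exact: hp.
Qed.

End KIntegral.

(** * Absolutely continuous functions *)

Lemma le_geo (R : realType) (x y A : R) :
  (forall n, x <= y + A / 2 ^+ n) -> x <= y.
Proof.
move=> h; rewrite leNgt; apply/negP => yx.
have A0 : 0 < A.
  have := h 0%N; rewrite expr0 divr1 => h0; lra.
have d0 : 0 < x - y by lra.
have [n nA] : exists n : nat, A / (x - y) < n%:R.
  exists (Num.truncn (A / (x - y))).+1.
  exact: truncnS_gt.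
have n2 : n%:R < 2 ^+ n :> R by rewrite -natrX ltr_nat ltn_expl.
have := h n; rewrite -lerBlDl.
rewrite ler_pdivlMr ?exprn_gt0 // leNgt => /negP; apply.
rewrite -ltr_pdivrMl // mulrC.
exact: lt_trans n2.
Qed.

Section AbsCont.
Variables (R : realType) (k : scalars).
Local Notation K := (K R k).
Local Notation mu := (@lebesgue_measure R).

(** Absolute continuity in integral form, with an explicit density:
    identities are proved between densities, and pointwise derivatives are
    avoided. *)
Definition AC (k : scalars) (T : R) (F phi : R -> Defs.K R k) :=
  integrableK `]0, T[ phi /\
  forall t, 0 <= t <= T -> F t = F 0 + integralK `]0, t[ phi.

Implicit Types (F G phi psi : R -> K) (V v : R -> R).

Lemma itv00 : `]0, 0[%classic = set0 :> set R.
Proof. by apply: set_itv_ge; rewrite bnd_simp ltxx. Qed.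

Lemma intK00 phi : integralK `]0, 0[ phi = 0.
Proof.
by apply: eqK; rewrite ?reK_int ?imK_int ?reK0 ?imK0 itv00 Rintegral_set0.
Qed.

Lemma AC_int (T : R) phi : integrableK `]0, T[ phi ->
  AC T (fun t => integralK `]0, t[ phi) phi.
Proof. by move=> h; split => // t _; rewrite intK00 add0r. Qed.

Lemma AC_le (T s t : R) F phi V v : AC T F phi -> AC (k := RealScalars) T V v ->
  0 <= s -> s <= t -> t <= T ->
  (forall x, s < x -> x < t -> cabs (phi x) <= v x) ->
  cabs (F t - F s) <= V t - V s.
Proof.
move=> [ip hF] [iv hV] s0 st tT h.
rewrite (hF t) ?(le_trans s0 st) // (hF s) ?s0 ?(le_trans st tT) //.
rewrite (hV t) ?(le_trans s0 st) // (hV s) ?s0 ?(le_trans st tT) //.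
have e (A : zmodType) (x a b : A) : x + a - (x + b) = a - b.
  by rewrite opprD addrACA subrr add0r.
rewrite !e; exact: (intK_diff_le s0 st tT ip iv h).
Qed.

Lemma AC_cabs (T : R) phi : integrableK `]0, T[ phi ->
  AC (k := RealScalars) T (fun t => \int[mu]_(s in `]0, t[) cabs (phi s))
    (fun s => cabs (phi s)).
Proof.
move=> ip; split; first exact: integrable_cabs.
by move=> t _ /=; rewrite itv00 Rintegral_set0 add0r.
Qed.

Lemma ACR_cont (T : R) V v : 0 <= T -> AC (k := RealScalars) T V v ->
  {within `[0, T], continuous V}.
Proof.
move=> T0 [iv hV].
have c1 := Rint_continuous T0 iv.
have c2 : {within `[0, T], continuous (fun t => V 0 + \int[mu]_(x in `]0, t[) v x)}.
  by move=> t; apply: cvgD; [exact: cvg_cst|exact: c1].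
move: c2; apply: subspace_eq_continuous => t.
by rewrite inE /= in_itv /= => tT; rewrite /from_subspace (hV t tT).
Qed.

(** V takes the value midway between V a and V b, so that cutting there
    halves the bound on the increment of G; this can be repeated. *)
Lemma quad_const (T C : R) G V : {within `[0, T], continuous V} ->
  (forall s t, 0 <= s -> s <= t -> t <= T -> V s <= V t) ->
  (forall s t, 0 <= s -> s <= t -> t <= T ->
     cabs (G t - G s) <= C * (V t - V s) ^+ 2) ->
  forall t, 0 <= t <= T -> G t = G 0.
Proof.
move=> cV mV h t /andP[t0 tT].
have key n : forall s t, 0 <= s -> s <= t -> t <= T ->
    cabs (G t - G s) <= C * (V t - V s) ^+ 2 / 2 ^+ n.
  elim: n => [|n ih] a b a0 ab bT; first by rewrite expr0 divr1; exact: h.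
  have [m] : exists2 m, m \in `[a, b] & V m = (V a + V b) / 2.
    apply: IVT => //.
      apply: continuous_subspaceW cV.
      by apply: subset_itv; rewrite bnd_simp.
    have ab' := mV _ _ a0 ab bT.
    rewrite (min_idPl ab') (max_idPr ab'); apply/andP; split; lra.
  rewrite in_itv /= => /andP[am mb] Vm.
  have e : G b - G a = (G b - G m) + (G m - G a) by rewrite addrA subrK.
  rewrite e; apply: (le_trans (cabsD _ _)).
  have := lerD (ih m b (le_trans a0 am) mb bT) (ih a m a0 am (le_trans mb bT)).
  move/le_trans; apply; rewrite Vm (exprS 2 n) invfM.
  set w := (2 ^+ n)^-1.
  by rewrite le_eqVlt; apply/orP; left; apply/eqP; field.
apply: subr0_eq; apply: cabs_eq0; apply/le_anti.
rewrite cabs_ge0 andbT.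
apply: (@le_geo _ _ _ (C * (V t - V 0) ^+ 2)) => n.
by rewrite add0r; exact: key.
Qed.

Lemma AC_mono (T : R) V v : AC (k := RealScalars) T V v ->
  (forall x, 0 < x -> x < T -> 0 <= v x) ->
  forall s t, 0 <= s -> s <= t -> t <= T -> V s <= V t.
Proof.
move=> [iv hV] v0 s t s0 st tT.
rewrite (hV t) ?(le_trans s0 st) // (hV s) ?s0 ?(le_trans st tT) // lerD2l.
rewrite /integralK (Rint_split s0 st); last exact: integrable_sub0 iv.
rewrite lerDl; apply: Rintegral_ge0 => x; rewrite /= in_itv /= => /andP[sx xt].
by apply: v0; [exact: le_lt_trans sx|exact: lt_le_trans xt _].
Qed.

(** The principle behind the product and chain rules: it is enough to know
    the increments of F up to the square of the increments of a dominating
    primitive V. *)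
Lemma AC_quad (T C : R) F phi V v : 0 <= T ->
  AC (k := RealScalars) T V v -> (forall x, 0 < x -> x < T -> 0 <= v x) ->
  integrableK `]0, T[ phi ->
  (forall s t, 0 <= s -> s <= t -> t <= T ->
     cabs (F t - F s - (integralK `]0, t[ phi - integralK `]0, s[ phi))
       <= C * (V t - V s) ^+ 2) ->
  AC T F phi.
Proof.
move=> T0 aV v0 ip h; split => // t tT.
have := @quad_const T C (fun t => F t - integralK `]0, t[ phi) V
  (ACR_cont T0 aV) (AC_mono aV v0) _ t tT.
rewrite intK00 subr0 => <-; first by rewrite subrK.
move=> a b a0 ab bT.
rewrite [X in cabs X](_ : _ = F b - F a - (integralK `]0, b[ phi - integralK `]0, a[ phi)).
  exact: h.
by ring.
Qed.

Lemma AC_cst T (c : K) : AC T (fun=> c) (fun=> 0).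
Proof. by split => [|t _]; [exact: integrableK0|rewrite integralK0 addr0]. Qed.

Lemma mblo (t : R) : mbl `]0, t[. Proof. by []. Qed.

Lemma intK_sub0 (T t : R) phi : t <= T -> integrableK `]0, T[ phi ->
  integrableK `]0, t[ phi.
Proof.
by move=> tT; apply: integrableKS => //; apply: subset_itvl; rewrite bnd_simp.
Qed.

Lemma AC_D T F G phi psi : AC T F phi -> AC T G psi ->
  AC T (fun t => F t + G t) (fun t => phi t + psi t).
Proof.
move=> [ip hF] [iq hG]; split; first exact: integrableKD.
move=> t tT; have /andP[_ tT'] := tT.
rewrite integralKD //; [|exact: intK_sub0 ip|exact: intK_sub0 iq].
by rewrite (hF t tT) (hG t tT) addrACA.
Qed.

Lemma AC_Z T F phi (c : K) : AC T F phi ->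
  AC T (fun t => c * F t) (fun t => c * phi t).
Proof.
move=> [ip hF]; split; first exact: integrableKZ.
move=> t tT; have /andP[_ tT'] := tT.
rewrite integralKZ //; last exact: intK_sub0 ip.
by rewrite (hF t tT) mulrDr.
Qed.

Lemma AC_sum T (I : Type) (s : seq I) (P : pred I) (F phi : I -> R -> K) :
  (forall i, P i -> AC T (F i) (phi i)) ->
  AC T (fun t => \sum_(i <- s | P i) F i t) (fun t => \sum_(i <- s | P i) phi i t).
Proof.
move=> h; split; first by apply: integrableK_sum => // i /h[].
move=> t tT; have /andP[_ tT'] := tT.
rewrite integralK_sum // => [|i /h[hi _]]; last exact: intK_sub0 hi.
by rewrite -big_split /=; apply: eq_bigr => i /h[_ ->].
Qed.

Lemma AC_eq T F G phi psi : (forall t, 0 <= t <= T -> F t = G t) ->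
  0 <= T -> (forall t, 0 < t -> t < T -> phi t = psi t) ->
  AC T F phi -> AC T G psi.
Proof.
move=> e T0 e' [ip hF]; split.
  by apply: eq_integrableK ip => // x; rewrite /= in_itv /= => /andP[? ?]; exact: e'.
move=> t tT; rewrite -!e ?lexx // hF //; congr (_ + _); apply: eq_integralK => x.
rewrite /= in_itv /= => /andP[x0 xt]; apply: e' => //.
by case/andP: tT => _; exact: lt_le_trans.
Qed.

Lemma AC_bounded T F phi : AC T F phi ->
  forall t, 0 <= t <= T -> cabs (F t) <= cabs (F 0) + \int[mu]_(s in `]0, T[) cabs (phi s).
Proof.
move=> aF t /andP[t0 tT].
rewrite -lerBlDl; apply: (@le_trans _ _ (cabs (F t - F 0))).
  by rewrite lerBlDr cabs_tri.
have aV := AC_cabs aF.1.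
apply: (le_trans (AC_le aF aV (lexx 0) t0 tT _)) => //.
rewrite itv00 Rintegral_set0 subr0.
exact: (AC_mono aV (fun x _ _ => cabs_ge0 _) t0 tT (lexx _)).
Qed.

Lemma AC_meas T F phi : 0 <= T -> AC T F phi -> measK `]0, T[ F.
Proof.
move=> T0 [/[dup] ip /integrableKP[r1 i1] hF].
have sub : `]0, T[ `<=` `[0, T] by apply: subset_itv; rewrite bnd_simp.
split.
  apply: (@measurable_funS _ _ (measurableTypeR R) R `[0, T]) => //.
  apply: subspace_continuous_measurable_fun => //.
  apply: (@ACR_cont _ _ (fun s => reK (phi s))) => //; split => // t tT.
  by rewrite hF // reKD reK_int.
apply: (@measurable_funS _ _ (measurableTypeR R) R `[0, T]) => //.
apply: subspace_continuous_measurable_fun => //.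
apply: (@ACR_cont _ _ (fun s => imK (phi s))) => //; split => // t tT.
by rewrite hF // imKD imK_int.
Qed.

Lemma AC_mulint T F phi psi : 0 <= T -> AC T F phi -> integrableK `]0, T[ psi ->
  integrableK `]0, T[ (fun t => psi t * F t).
Proof.
move=> T0 aF ip; apply: integrableKM ip (AC_meas T0 aF) _ => // x.
rewrite /= in_itv /= => /andP[/ltW x0 /ltW xT].
by apply: (AC_bounded aF); rewrite x0.
Qed.

(** The increment of F G differs from that of the integral of the expected
    density by products of two increments, as AC_quad allows. *)
Lemma AC_M T F G phi psi : 0 <= T -> AC T F phi -> AC T G psi ->
  AC T (fun t => F t * G t) (fun t => phi t * G t + psi t * F t).
Proof.
move=> T0 aF aG.
have ipG := AC_mulint T0 aG aF.1; have iqF := AC_mulint T0 aF aG.1.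
have aV := AC_cabs aF.1; have aW := AC_cabs aG.1.
set V := fun t => _ in aV; set W := fun t => _ in aW.
pose v t := cabs (phi t) + cabs (psi t).
have aVW : AC (k := RealScalars) T (fun t => V t + W t) v.
  have [iV hV] := aV; have [iW hW] := aW; split.
    by apply: eq_integrable (integrableD (mblo T) iV iW) => // x _ /=; rewrite EFinD.
  move=> t tT; have /andP[_ tT'] := tT.
  rewrite /= RintegralD //; [|exact: integrable_sub0 iV|exact: integrable_sub0 iW].
  by rewrite addrACA -(hV t tT) -(hW t tT).
apply: (@AC_quad T 3 _ _ _ _ T0 aVW).
- by move=> x _ _; apply: addr_ge0; exact: cabs_ge0.
- exact: (integrableKD (mblo T) ipG iqF).
move=> s t s0 st tT.
have sT := le_trans st tT; have t0 := le_trans s0 st.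
have mV := AC_mono aV (fun x _ _ => cabs_ge0 _).
have mW := AC_mono aW (fun x _ _ => cabs_ge0 _).
have Vst := mV _ _ s0 st tT; have Wst := mW _ _ s0 st tT.
rewrite (integralKD (mblo t)); [|exact: intK_sub0 ipG|exact: intK_sub0 iqF].
rewrite (integralKD (mblo s)); [|exact: intK_sub0 ipG|exact: intK_sub0 iqF].
have eF : F t - F s = integralK `]0, t[ phi - integralK `]0, s[ phi.
  by rewrite (aF.2 t) ?t0 // (aF.2 s) ?s0 // opprD addrACA subrr add0r.
have eG : G t - G s = integralK `]0, t[ psi - integralK `]0, s[ psi.
  by rewrite (aG.2 t) ?t0 // (aG.2 s) ?s0 // opprD addrACA subrr add0r.
have bd (H h0 : R -> K) (W' : R -> R) :
    (forall x, s < x -> x < t -> cabs (H x - H s) <= W' t - W' s) ->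
    integrableK `]0, T[ h0 -> integrableK `]0, T[ (fun x => h0 x * H x) ->
    cabs (integralK `]0, t[ (fun x => h0 x * H x) -
          integralK `]0, s[ (fun x => h0 x * H x) -
          H s * (integralK `]0, t[ h0 - integralK `]0, s[ h0)) <=
    (W' t - W' s) * (\int[mu]_(x in `]0, t[) cabs (h0 x) - \int[mu]_(x in `]0, s[) cabs (h0 x)).
  move=> hW' i0 i0H.
  have i0Hs : integrableK `]0, T[ (fun x => - H s * h0 x) by exact: integrableKZ.
  have ii : integrableK `]0, T[ (fun x => h0 x * H x + - H s * h0 x) by exact: (integrableKD (mblo T)). 
  have ic : mu.-integrable `]0, T[ (EFin \o (fun x => (W' t - W' s) * cabs (h0 x))).
    by apply: eq_integrable (integrableZl (mblo T) (W' t - W' s) (integrable_cabs (mblo T) i0)) => // x _ /=; rewrite EFinM.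
  have ca x' : x' <= T -> mu.-integrable `]0, x'[ (EFin \o (fun x => cabs (h0 x))).
    move=> x'T; apply: (integrable_sub0 (lexx 0) x'T); exact: integrable_cabs.
  rewrite [leRHS]mulrBr -!RintegralZl //; [|exact: ca|exact: ca].
  rewrite [X in cabs X](_ : _ = integralK `]0, t[ (fun x => h0 x * H x + - H s * h0 x)
     - integralK `]0, s[ (fun x => h0 x * H x + - H s * h0 x)).
    apply: (intK_diff_le s0 st tT ii ic) => x sx xt.
    by rewrite mulNr (mulrC (H s)) -mulrBr cabsM [leRHS]mulrC ler_wpM2l ?cabs_ge0 ?hW'.
  rewrite !integralKD ?integralKZ //; try exact: intK_sub0 i0; try exact: intK_sub0 i0H; try exact: intK_sub0 i0Hs.
  by ring.
have b1 := bd G phi W _ aF.1 ipG.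
have b2 := bd F psi V _ aG.1 iqF.
rewrite [X in cabs X](_ : _ = (F t - F s) * (G t - G s) -
  (integralK `]0, t[ (fun x => phi x * G x) -
          integralK `]0, s[ (fun x => phi x * G x) -
          G s * (integralK `]0, t[ phi - integralK `]0, s[ phi)) -
  (integralK `]0, t[ (fun x => psi x * F x) -
          integralK `]0, s[ (fun x => psi x * F x) -
          F s * (integralK `]0, t[ psi - integralK `]0, s[ psi))); last first.
  by rewrite -eF -eG; ring.
apply: (@le_trans _ _ ((V t - V s) * (W t - W s) + (W t - W s) * (V t - V s) + (V t - V s) * (W t - W s))).
  apply: (le_trans (cabsD _ _)); apply: lerD.
    apply: (le_trans (cabsD _ _)); apply: lerD.
      rewrite cabsM; apply: ler_pM; [exact: cabs_ge0|exact: cabs_ge0| | ].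
        by apply: (AC_le aF aV) => //.
      by apply: (AC_le aG aW) => //.
    rewrite cabsN; apply: b1 => x sx xt.
    apply: (le_trans (AC_le aG aW s0 (ltW sx) (le_trans (ltW xt) tT) _)) => //.
    by rewrite lerD2r; apply: mW => //; [exact: le_trans s0 (ltW sx)|exact: ltW].
  rewrite cabsN; apply: b2 => x sx xt.
  apply: (le_trans (AC_le aF aV s0 (ltW sx) (le_trans (ltW xt) tT) _)) => //.
  by rewrite lerD2r; apply: mV => //; [exact: le_trans s0 (ltW sx)|exact: ltW].
have := sqr_ge0 (V t - V s); have := sqr_ge0 (W t - W s).
have := mulr_ge0 (_ : 0 <= V t - V s) (_ : 0 <= W t - W s).
rewrite !subr_ge0 => /(_ Vst Wst); nra.
Qed.

Lemma AC_X T F phi n : 0 <= T -> AC T F phi ->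
  AC T (fun t => F t ^+ n.+1) (fun t => n.+1%:R * F t ^+ n * phi t).
Proof.
move=> T0 aF; elim: n => [|n ih].
  by apply: AC_eq aF => // t *; rewrite ?expr1 // expr0 !mul1r.
apply: AC_eq (AC_M T0 aF ih) => // t *.
rewrite [_.+2%:R]mulrS [F t ^+ n.+1]exprS; ring.
Qed.

Lemma AC_dpow T F phi n : 0 <= T -> AC T F phi ->
  AC T (fun t => F t ^+ n.+1 / n.+1`!%:R) (fun t => F t ^+ n / n`!%:R * phi t).
Proof.
move=> T0 aF; apply: AC_eq (AC_Z (n.+1`!%:R^-1) (AC_X n T0 aF)) => // t *.
  by rewrite mulrC.
have n1 : n.+1%:R != 0 :> K by rewrite pnatr_eq0.
have n2 : n`!%:R != 0 :> K by rewrite pnatr_eq0 -lt0n fact_gt0.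
rewrite factS natrM; move: n1 n2; move: (n.+1%:R) (n`!%:R) => a b a0 b0.
move: (F t ^+ n) (phi t) => x y.
by rewrite invfM -(mulrA a x y) mulrACA mulVf // mul1r mulrA (mulrC _ x).
Qed.

End AbsCont.

(** * Row vectors: the l1 norm, limits, gradients *)

Section Norms.
Variables (R : realType) (k : scalars) (d : nat).
Local Notation K := (K R k).
Local Notation V := 'rV[K]_d.
Implicit Types (x h : V).

Definition nrm1 (x : V) : R := \sum_(j < d) cabs (x 0 j).

Lemma nrm1_ge0 x : 0 <= nrm1 x.
Proof. by apply: sumr_ge0 => j _; exact: cabs_ge0. Qed.
Hint Resolve nrm1_ge0 : core.

Lemma nrm1D x y : nrm1 (x + y) <= nrm1 x + nrm1 y.
Proof.
rewrite /nrm1 -big_split /=; apply: ler_sum => j _; rewrite mxE; exact: cabsD.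
Qed.
Lemma nrm1N x : nrm1 (- x) = nrm1 x.
Proof. by apply: eq_bigr => j _; rewrite mxE cabsN. Qed.
Lemma nrm1B x y : nrm1 (x - y) = nrm1 (y - x).
Proof. by rewrite -nrm1N opprB. Qed.
Lemma nrm1_0 : nrm1 0 = 0.
Proof. by rewrite /nrm1 big1 // => j _; rewrite mxE cabs0. Qed.
Lemma nrm1Z (c : K) x : nrm1 (c *: x) = cabs c * nrm1 x.
Proof. by rewrite /nrm1 mulr_sumr; apply: eq_bigr => j _; rewrite mxE cabsM. Qed.
Lemma nrm1_coord x j : cabs (x 0 j) <= nrm1 x.
Proof.
by rewrite /nrm1 (bigD1 j) //= lerDl; apply: sumr_ge0 => i _; exact: cabs_ge0.
Qed.
Lemma nrm1_tri x y z : nrm1 (x - z) <= nrm1 (x - y) + nrm1 (y - z).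
Proof. by have := nrm1D (x - y) (y - z); rewrite addrA subrK. Qed.

Lemma enorm_nrm1 x : enorm x <= nrm1 x.
Proof.
rewrite /enorm -[leRHS]ger0_norm // -sqrtr_sqr ler_wsqrtr //.
rewrite expr2 /nrm1 mulr_suml; apply: ler_sum => j _.
rewrite expr2 ler_wpM2l //. exact: nrm1_coord.
Qed.

Lemma enorm_coord x j : cabs (x 0 j) <= enorm x.
Proof.
rewrite /enorm -[leLHS]ger0_norm // -sqrtr_sqr ler_wsqrtr //.
by rewrite (bigD1 j) //= lerDl; apply: sumr_ge0 => i _; exact: sqr_ge0.
Qed.

Lemma enorm_ge0 x : 0 <= enorm x.
Proof. exact: sqrtr_ge0. Qed.

(** Follows from (a + b)^2 <= 2 a^2 + 2 b^2 in each coordinate. *)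
Lemma cball_near (p x : V) (e : R) : 0 <= e -> enorm p <= e -> nrm1 (x - p) <= e ->
  enorm x <= 2 * e.
Proof.
move=> e0 pe xe; rewrite -(@ler_pXn2r _ 2) ?nnegrE ?enorm_ge0 ?mulr_ge0 //.
have sq y : enorm y ^+ 2 = \sum_(j < d) cabs (y 0 j) ^+ 2.
  by rewrite sqr_sqrtr // sumr_ge0 // => j _; exact: sqr_ge0.
have hp : enorm p ^+ 2 <= e ^+ 2 by rewrite ler_pXn2r ?nnegrE ?enorm_ge0.
have hx : enorm (x - p) ^+ 2 <= e ^+ 2.
  by rewrite ler_pXn2r ?nnegrE ?enorm_ge0 //; exact: le_trans (enorm_nrm1 _) xe.
have : enorm x ^+ 2 <= 2 * (enorm p ^+ 2 + enorm (x - p) ^+ 2).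
  rewrite !sq -big_split /= mulr_sumr; apply: ler_sum => j _.
  have := cabsD (x 0 j - p 0 j) (p 0 j); rewrite subrK => h.
  have -> : (x - p) 0 j = x 0 j - p 0 j by rewrite !mxE.
  set a := cabs (x 0 j) in h *; set b := cabs _ in h *; set c := cabs (p 0 j) in h *.
  have a0 : 0 <= a by exact: cabs_ge0.
  have : a ^+ 2 <= (b + c) ^+ 2.
    by rewrite ler_pXn2r ?nnegrE ?addr_ge0 //; exact: cabs_ge0.
  have := sqr_ge0 (b - c); nra.
lra.
Qed.

Lemma mxn_coord x j : `|x 0 j| <= `|x|.
Proof.
rewrite [leRHS]/Num.Def.normr /= mx_normE -[leLHS]nngE num_le.
exact: (le_bigmax _ (fun i : 'I_1 * 'I_d => `|x i.1 i.2|%:nng) (0, j)).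
Qed.

Lemma mxn_nrm1 x : `|x| <= ofR k (nrm1 x).
Proof.
have n0 : 0 <= ofR k (nrm1 x) by rewrite -(rmorph0 (@ofR R k)) ler_ofR.
rewrite [leLHS]/Num.Def.normr /= mx_normE.
have -> : ofR k (nrm1 x) = (NngNum n0)%:num by [].
rewrite num_le; apply/bigmax_leP; split; first by rewrite -num_le /=.
move=> [i j] _; rewrite -num_le /= ord1 normE ler_ofR; exact: nrm1_coord.
Qed.

Lemma pos_ofR (e : K) : 0 < e -> exists2 e' : R, 0 < e' & e = ofR k e'.
Proof.
move=> e0; exists (cabs e); last by rewrite -normE gtr0_norm.
by rewrite -(ltr_ofR k) -normE rmorph0 gtr0_norm.
Qed.

Lemma near0_rV (P : V -> Prop) : (\forall h \near (0 : V), P h) <->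
  exists2 e : R, 0 < e & forall h, nrm1 h < e -> P h.
Proof.
split=> [/nbhs_ballP[e /= /pos_ofR[e' e'0 ->] eP]|[e e0 eP]].
  exists e' => // h he; apply: eP.
  rewrite -ball_normE /= sub0r normrN; apply: (le_lt_trans (mxn_nrm1 h)).
  by rewrite ltr_ofR.
have e1 : 0 < e / d.+1%:R by rewrite divr_gt0.
apply/nbhs_ballP; exists (ofR k (e / d.+1%:R)).
  by rewrite /= -(rmorph0 (@ofR R k)) ltr_ofR.
move=> h; rewrite -ball_normE /= sub0r normrN => hh; apply: eP.
apply: (@le_lt_trans _ _ (\sum_(j < d) e / d.+1%:R)).
  apply: ler_sum => j _; rewrite -(ler_ofR k) -normE.
  exact: le_trans (mxn_coord h j) (ltW hh).
rewrite sumr_const card_ord -[_ *+ d]mulr_natr -mulrA gtr_pMr //.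
by rewrite mulrC ltr_pdivrMr // mul1r ltr_nat.
Qed.

Lemma nbhs_rV (x : V) (U : set V) : nbhs x U <->
  exists2 e : R, 0 < e & forall h, nrm1 h < e -> U (x + h).
Proof.
have e : nbhs x U = (\forall h \near (0 : V), U (h + x)).
  by have := @near_shift K V 0 x U; rewrite /= subr0.
by rewrite e -near0_rV; split; apply: filterS => h; rewrite addrC.
Qed.

Lemma cvgK_P (T : Type) (F : set_system T) {FF : Filter F} (f : T -> K) (l : K) :
  (f x @[x --> F] --> l) <-> forall e : R, 0 < e -> \forall x \near F, cabs (f x - l) < e.
Proof.
split => [/cvgrPdist_lt h e e0|h].
  have /h : 0 < ofR k e by rewrite -(rmorph0 (@ofR R k)) ltr_ofR.
  by apply: filterS => x; rewrite normE ltr_ofR cabsB.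
apply/cvgrPdist_lt => e /pos_ofR[e' e'0 ->]; have := h _ e'0.
by apply: filterS => x; rewrite normE ltr_ofR cabsB.
Qed.

Lemma cvgV_P (T : Type) (F : set_system T) {FF : Filter F} (f : T -> V) (l : V) :
  (f x @[x --> F] --> l) <-> forall e : R, 0 < e -> \forall x \near F, nrm1 (f x - l) < e.
Proof.
split => [h e e0|h].
  have : nbhs l [set y | nrm1 (y - l) < e].
    by apply/nbhs_rV; exists e => // h' hh /=; rewrite addrC addKr.
  by move/h.
move=> A /nbhs_rV[e e0 eA]; apply: filterS (h _ e0) => x fx.
by rewrite /= -(subrK l (f x)) addrC; exact: eA.
Qed.

(** Differentiability in epsilon-delta form for the l1 norm, with an explicit
    gradient D. *)
Definition has_grad (g : V -> K) (x : V) (D : 'I_d -> K) :=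
  forall e : R, 0 < e -> exists2 dl : R, 0 < dl & forall h, nrm1 h < dl ->
    cabs (g (x + h) - g x - \sum_(j < d) h 0 j * D j) <= e * nrm1 h.

Lemma diff_sum (g : V -> K) x h :
  'd (g : V -> K^o) x h = \sum_j h 0 j * ('d (g : V -> K^o) x (delta_mx 0 j)).
Proof.
rewrite {1}(row_sum_delta h) linear_sum; apply: eq_bigr => j _; exact: linearZ.
Qed.

Lemma diff_has_grad (g : V -> K) x : differentiable (g : V -> K^o) x ->
  has_grad g x (fun j => pderiv j g x).
Proof.
move=> gx; have /diff_locallyxC dg := gx.
move=> e e0; have e0' : 0 < ofR k e by rewrite -(rmorph0 (@ofR R k)) ltr_ofR.
set o := (X in forall h, _ = _ + _ + X h) in dg.
have /(_ _ e0') := littleoP [littleo of o].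
move/near0_rV => [dl dl0 hdl]; exists dl => // h hh.
have E : g (x + h) - g x - \sum_(j < d) h 0 j * pderiv j g x = o h.
  rewrite dg diff_sum (eq_bigr (fun j => h 0 j * pderiv j g x)); last first.
    by move=> j _; rewrite /pderiv deriveE.
  by move: (g x) (\sum_(_ < _) _) (o h) => a b c; rewrite -!addrA addrC !addrA addrC; ring.
rewrite E -(ler_ofR k) rmorphM /= -normE.
apply: (le_trans (hdl _ hh)); rewrite ler_pM2l //; exact: mxn_nrm1.
Qed.

End Norms.
#[export] Hint Extern 0 (is_true (0 <= nrm1 _)) => exact: nrm1_ge0 : core.

(** * Mean value inequality and symmetry of second derivatives *)

Section Hasd.
Variables (R : realType) (k : scalars) (d : nat).
Local Notation K := (K R k).
Local Notation V := 'rV[K]_d.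
Implicit Types (x h v : V) (g : V -> K) (D : 'I_d -> K).

Lemma has_grad_diff g x D : has_grad g x D ->
  differentiable (g : V -> K^o) x /\ forall j, pderiv j g x = D j.
Proof.
move=> gD.
pose L : V -> K^o := fun h => \sum_(j < d) h 0 j * D j.
have Ll : linear L.
  move=> a u v; rewrite /L scaler_sumr -big_split /=; apply: eq_bigr => j _.
  by rewrite !mxE mulrDl -mulrA.
pose LL : {linear V -> K^o} := HB.pack L (GRing.isLinear.Build _ _ _ _ L Ll).
have cL : continuous (LL : V -> K^o).
  move=> y; apply: differentiable_continuous.
  have -> : (LL : V -> K^o) = \sum_(j < d) (fun h : V => (h 0 j * D j : K^o)).
    by apply/funext => h; rewrite /= /L fct_sumE.
  apply: differentiable_sum => j.
  by apply: differentiableM => //; exact: differentiable_coord.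
have oL : (g : V -> K^o) \o shift x = cst (g x : K^o) + (LL : V -> K^o) +o_ (0 : V) id.
  apply/eqaddoP => e /pos_ofR[e' e'0 ->].
  have [dl dl0 h] := gD _ (divr_gt0 e'0 (ltr0Sn R d)).
  apply/near0_rV; exists dl => // w wdl.
  rewrite /= [X in `|X| <= _](_ : _ = g (x + w) - g x - \sum_(j < d) w 0 j * D j); last first.
    by rewrite !fctE /= /cst opprD addrA (addrC w).
  rewrite normE.
  apply: (@le_trans _ _ (ofR k (e' / d.+1%:R * nrm1 w))).
    by rewrite ler_ofR; exact: h.
  have nw : ofR k (nrm1 w) <= d%:R * `|w|.
    rewrite /nrm1 rmorph_sum /= -[d in d%:R]card_ord mulr_natl -sumr_const.
    by apply: ler_sum => j _; rewrite -normE; exact: mxn_coord.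
  rewrite rmorphM /=.
  have e1 : 0 < ofR k (e' / d.+1%:R).
    by rewrite -(rmorph0 (@ofR R k)) ltr_ofR divr_gt0.
  apply: (@le_trans _ _ (ofR k (e' / d.+1%:R) * (d%:R * `|w|))).
    by rewrite ler_pM2l.
  rewrite mulrA ler_wpM2r // rmorphM fmorphV rmorph_nat /= -mulrA.
  have e2 : 0 < ofR k e' by rewrite -(rmorph0 (@ofR R k)) ltr_ofR.
  by rewrite ger_pMr // mulrC ler_pdivrMr ?ltr0Sn // mul1r ler_nat.
have dE : 'd (g : V -> K^o) x = LL :> (V -> K^o) := diff_unique cL oL.
have gx : differentiable (g : V -> K^o) x.
  by apply/diff_locallyP; rewrite dE.
split => // j; rewrite /pderiv deriveE // dE /= /L (bigD1 j) //= big1 => [|i ij].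
  by rewrite mxE !eqxx mul1r addr0.
by rewrite mxE eqxx /= (negbTE ij) mul0r.
Qed.

Lemma has_grad_eq g g' x D (U : set V) : open U -> U x ->
  (forall y, U y -> g y = g' y) -> has_grad g x D -> has_grad g' x D.
Proof.
move=> oU Ux e gD ep ep0; have [dl dl0 h] := gD _ ep0.
have /nbhs_rV[e1 e10 h1] : nbhs x U by apply: open_nbhs_nbhs.
exists (Num.min dl e1); first by rewrite lt_min dl0.
move=> w; rewrite lt_min => /andP[wd we]; rewrite -!e //; first exact: h.
exact: h1.
Qed.

Lemma has_grad_cont g x D : has_grad g x D -> forall e : R, 0 < e ->
  exists2 dl : R, 0 < dl & forall h, nrm1 h < dl -> cabs (g (x + h) - g x) <= e.
Proof.
move=> gD e e0; have [dl dl0 h] := gD _ ltr01.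
pose C := \sum_(j < d) cabs (D j) + 1.
have C1 : 1 <= C by rewrite lerDr sumr_ge0.
have C0 : 0 < C + 1 by lra.
exists (Num.min dl (e / (C + 1))); first by rewrite lt_min dl0 divr_gt0.
move=> w; rewrite lt_min => /andP[wd we].
have {}h := h _ wd.
apply: (@le_trans _ _ ((C + 1) * nrm1 w)); last first.
  by rewrite mulrC -ler_pdivlMr // ltW.
apply: (le_trans (cabs_tri _ (\sum_(j < d) w 0 j * D j))).
rewrite mulrDl addrC; apply: lerD => //.
apply: (le_trans (cabs_sum _ _ _)).
apply: (@le_trans _ _ (\sum_(j < d) cabs (D j) * nrm1 w)).
  by apply: ler_sum => j _; rewrite cabsM mulrC ler_wpM2l // nrm1_coord.
by rewrite -mulr_suml ler_wpM2r // lerDl.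
Qed.

Lemma sum_delta (t : K) i (F : 'I_d -> K) :
  \sum_(l < d) (t *: delta_mx 0 i : V) 0 l * F l = t * F i.
Proof.
rewrite (bigD1 i) //= big1 => [|l li]; first by rewrite !mxE !eqxx mulr1 addr0.
by rewrite !mxE eqxx /= (negbTE li) mulr0 mul0r.
Qed.

Lemma nrm1_delta (t : K) i : nrm1 (t *: delta_mx 0 i : V) = cabs t.
Proof.
rewrite nrm1Z /nrm1 (bigD1 i) //= big1 => [|l li].
  by rewrite mxE !eqxx cabs1 addr0 mulr1.
by rewrite mxE eqxx /= (negbTE li) cabs0.
Qed.

(** The real mean value theorem is applied to the pairing of y with the
    vector y 1 - y 0. *)
Lemma mvt_K (y y' : R -> K) (C : R) : 0 <= C ->
  (forall s : R, 0 <= s <= 1 -> forall e : R, 0 < e -> exists2 dl : R, 0 < dl &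
    forall s', `|s' - s| < dl -> cabs (y s' - y s - ofR k (s' - s) * y' s) <= e * `|s' - s|) ->
  (forall s : R, 0 <= s <= 1 -> cabs (y' s) <= C) ->
  cabs (y 1 - y 0) <= C.
Proof.
move=> C0 dy hC; apply: cabs_dot_le => //.
set z := y 1 - y 0.
pose psi s := dotK z (y s).
have dpsi (s : R) : 0 <= s <= 1 -> is_derive s 1 psi (dotK z (y' s)).
  move=> s01.
  have cv : (fun h : R => h^-1 *: (psi (h *: (1 : R) + s) - psi s)) x @[x --> 0^'] --> dotK z (y' s).
    apply/cvgrPdist_le => e e0.
    have z1 : 0 < cabs z + 1 by apply: ltr_wpDl.
    have [dl dl0 h] := dy s s01 _ (divr_gt0 e0 z1).
    rewrite near_withinE; apply/nbhs_ballP; exists dl => //= w.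
    rewrite /ball /= sub0r normrN => wdl w0.
    have := h (w + s); rewrite addrK => /(_ wdl) h1.
    rewrite [w *: 1]mulr1 -[dotK z (y' s)](mulKf w0) -[_ *: (psi _ - _)]/(w^-1 * (psi (w + s) - psi s)).
    rewrite -mulrBr normrM normfV ler_pdivrMl ?normr_gt0 // distrC.
    have -> : psi (w + s) - psi s - w * dotK z (y' s) =
       dotK z (y (w + s) - y s - ofR k w * y' s).
      by rewrite /psi -dotKZ !dotKD !dotKN.
    apply: (le_trans (dotK_le _ _)).
    apply: (@le_trans _ _ ((cabs z + 1) * (e / (cabs z + 1) * `|w|))).
      by apply: ler_pM => //; rewrite lerDl.
    by rewrite mulrA (mulrC _ (e / _)) divfK ?gt_eqF // mulrC.
  apply: DeriveDef; first by apply/cvg_ex; exists (dotK z (y' s)).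
  exact: cvg_lim cv.
have [c] : exists2 c, c \in `]0, 1[ & psi 1 - psi 0 = dotK z (y' c) * (1 - 0).
  apply: MVT => //.
    move=> x; rewrite in_itv /= => /andP[/ltW x0 /ltW x1].
    by apply: dpsi; rewrite x0.
  apply: derivable_within_continuous => x; rewrite in_itv /= => x01.
  by case: (dpsi x x01).
rewrite in_itv /= => /andP[/ltW c0 /ltW c1]; rewrite subr0 mulr1.
have -> : psi 1 - psi 0 = dotK z z by rewrite /psi /z -dotKN -dotKD.
move=> ->; apply: (le_trans (ler_norm _)); apply: (le_trans (dotK_le _ _)).
by rewrite ler_wpM2l // hC // c0.
Qed.

Lemma lip_seg g x v (D : R -> 'I_d -> K) (c : 'I_d -> K) (C : R) : 0 <= C ->
  (forall s : R, 0 <= s <= 1 -> has_grad g (x + ofR k s *: v) (D s)) ->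
  (forall s : R, 0 <= s <= 1 -> cabs (\sum_(j < d) v 0 j * (D s j - c j)) <= C) ->
  cabs (g (x + v) - g x - \sum_(j < d) v 0 j * c j) <= C.
Proof.
move=> C0 hD hC.
pose w := \sum_(j < d) v 0 j * c j.
have := @mvt_K (fun s => g (x + ofR k s *: v) - ofR k s * w)
  (fun s => \sum_(j < d) v 0 j * (D s j - c j)) C C0 _ hC.
rewrite rmorph1 rmorph0 scale1r scale0r addr0 mul1r mul0r subr0.
rewrite [X in cabs X](_ : _ = g (x + v) - g x - w); last by ring.
apply => s s01 e e0.
have v1 : 0 < nrm1 v + 1 by apply: ltr_wpDl.
have [dl dl0 h] := hD s s01 _ (divr_gt0 e0 v1).
exists (dl / (nrm1 v + 1)); first by rewrite divr_gt0.
move=> s' ss; have nE : nrm1 (ofR k (s' - s) *: v) = `|s' - s| * nrm1 v.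
  by rewrite nrm1Z cabs_ofR.
have := h (ofR k (s' - s) *: v); rewrite nE => h1.
have : `|s' - s| * nrm1 v < dl.
  rewrite ltr_pdivlMr // in ss; apply: le_lt_trans ss.
  by rewrite ler_wpM2l // lerDl.
move=> /h1 {}h1.
have eX : x + ofR k s *: v + ofR k (s' - s) *: v = x + ofR k s' *: v.
  by rewrite -addrA -scalerDl -rmorphD /= subrKC.
rewrite eX in h1.
have -> : g (x + ofR k s' *: v) - ofR k s' * w - (g (x + ofR k s *: v) - ofR k s * w) -
   ofR k (s' - s) * (\sum_(j < d) v 0 j * (D s j - c j)) =
   g (x + ofR k s' *: v) - g (x + ofR k s *: v) -
   \sum_(j < d) (ofR k (s' - s) *: v) 0 j * D s j.
  rewrite (eq_bigr (fun j => v 0 j * D s j - v 0 j * c j)); last first.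
    by move=> j _; rewrite mulrBr.
  have eS : \sum_(j < d) (ofR k (s' - s) *: v) 0 j * D s j =
      ofR k (s' - s) * \sum_(j < d) v 0 j * D s j.
    by rewrite mulr_sumr; apply: eq_bigr => j _; rewrite mxE mulrA.
  by rewrite sumrB -/w eS rmorphB /=; ring.
apply: (le_trans h1); rewrite mulrA mulrAC ler_wpM2r //.
by rewrite mulrAC ler_pdivrMr // ler_pM2l // lerDl.
Qed.

Lemma has_grad_shift g x w D : has_grad g (x + w) D -> has_grad (fun y => g (y + w)) x D.
Proof.
move=> h e e0; have [dl dl0 h1] := h e e0; exists dl => // v vd.
by rewrite (addrAC x v w); exact: h1.
Qed.

Lemma has_grad_B g g' x D D' : has_grad g x D -> has_grad g' x D' ->
  has_grad (fun y => g y - g' y) x (fun j => D j - D' j).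
Proof.
move=> h h' e e0; have e2 : 0 < e / 2 by lra.
have [dl dl0 h1] := h _ e2; have [dl' dl0' h1'] := h' _ e2.
exists (Num.min dl dl'); first by rewrite lt_min dl0.
move=> w; rewrite lt_min => /andP[wd wd'].
rewrite [X in cabs X](_ : _ = (g (x + w) - g x - \sum_(j < d) w 0 j * D j) -
   (g' (x + w) - g' x - \sum_(j < d) w 0 j * D' j)); last first.
  rewrite (eq_bigr (fun j => w 0 j * D j - w 0 j * D' j)) ?sumrB; first by ring.
  by move=> j _; rewrite mulrBr.
apply: (le_trans (cabsD _ _)); rewrite cabsN [leRHS](_ : _ = e / 2 * nrm1 w + e / 2 * nrm1 w).
  by apply: lerD; [exact: h1|exact: h1'].
by field.
Qed.

(** The second difference of g in the directions i and j is close to t^2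
    times the mixed derivative. *)
Lemma young_half g x (U : set V) i j (c : K) (t e : R) : 0 < t -> 0 <= e ->
  (forall h, nrm1 h <= 2 * t -> U (x + h)) ->
  (forall y, U y -> has_grad g y (fun l => pderiv l g y)) ->
  (forall y, U y -> has_grad (pderiv i g) y (fun l => pderiv l (pderiv i g) y)) ->
  (forall h, nrm1 h <= 2 * t -> cabs (pderiv j (pderiv i g) (x + h) - c) <= e) ->
  cabs (g (x + ofR k t *: delta_mx 0 i + ofR k t *: delta_mx 0 j)
     - g (x + ofR k t *: delta_mx 0 i) - g (x + ofR k t *: delta_mx 0 j) + g x
     - ofR k t ^+ 2 * c) <= e * t ^+ 2.
Proof.
move=> t0 e0 xU dg dgi hc.
set ei := ofR k t *: delta_mx 0 i; set ej := ofR k t *: delta_mx 0 j.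
have nt : cabs (ofR k t) = t by rewrite cabs_ofR gtr0_norm.
have nei (s : R) : 0 <= s <= 1 -> nrm1 (ofR k s *: ei) <= t.
  move=> /andP[s0 s1]; rewrite nrm1Z nrm1_delta nt cabs_ofR ger0_norm //.
  by rewrite ger_pMl.
have nej (s : R) : 0 <= s <= 1 -> nrm1 (ofR k s *: ej) <= t.
  move=> /andP[s0 s1]; rewrite nrm1Z nrm1_delta nt cabs_ofR ger0_norm //.
  by rewrite ger_pMl.
have nej1 : nrm1 ej <= t by rewrite nrm1_delta nt.
have U1 (s : R) : 0 <= s <= 1 -> U (x + ofR k s *: ei).
  by move=> s01; apply: xU; have := nei s s01; lra.
have U2 (s s' : R) : 0 <= s <= 1 -> 0 <= s' <= 1 -> nrm1 (ofR k s *: ei + ofR k s' *: ej) <= 2 * t.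
  by move=> h h'; apply: (le_trans (nrm1D _ _)); have := nei s h; have := nej s' h'; lra.
have U3 (s : R) : 0 <= s <= 1 -> nrm1 (ofR k s *: ei + ej) <= 2 * t.
  by move=> h; apply: (le_trans (nrm1D _ _)); have := nei s h; have := nej1; lra.
pose G y := g (y + ej) - g y.
rewrite [X in cabs X](_ : _ = G (x + ei) - G x -
    \sum_(l < d) ei 0 l * (ofR k t * c)); last first.
  by rewrite (sum_delta (ofR k t) i (fun=> ofR k t * c)) /G; ring.
apply: (@lip_seg G x ei
  (fun s l => pderiv l g (x + ofR k s *: ei + ej) - pderiv l g (x + ofR k s *: ei))
  (fun=> ofR k t * c) (e * t ^+ 2) (mulr_ge0 e0 (sqr_ge0 _))) => s s01.
  apply: has_grad_B; last exact/dg/U1.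
  apply/has_grad_shift/dg; rewrite -addrA; exact/xU/U3.
rewrite (sum_delta (ofR k t) i (fun l => pderiv l g (x + ofR k s *: ei + ej) -
  pderiv l g (x + ofR k s *: ei) - ofR k t * c)).
rewrite cabsM nt expr2 mulrCA ler_wpM2l ?(ltW t0) //.
have := @lip_seg (pderiv i g) (x + ofR k s *: ei) ej
  (fun s' l => pderiv l (pderiv i g) (x + ofR k s *: ei + ofR k s' *: ej)) (fun=> c)
  (e * t) (mulr_ge0 e0 (ltW t0)).
rewrite (sum_delta (ofR k t) j (fun=> c)); apply => s' s01'.
  by apply: dgi; rewrite -addrA; exact/xU/U2.
rewrite (sum_delta (ofR k t) j (fun l => pderiv l (pderiv i g) (x + ofR k s *: ei + ofR k s' *: ej) - c)).
rewrite cabsM nt mulrC ler_wpM2r ?(ltW t0) // -addrA; exact/hc/U2.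
Qed.

(** The second difference is symmetric in the two directions, so both mixed
    derivatives are its limit. *)
Lemma clairaut g x (U : set V) i j : open U -> U x -> smooth_on U g ->
  pderiv j (pderiv i g) x = pderiv i (pderiv j g) x.
Proof.
move=> oU Ux sg.
have dg y : U y -> has_grad g y (fun l => pderiv l g y).
  by move=> Uy; apply: diff_has_grad; exact: (sg [::]).
have dg1 l y : U y -> has_grad (pderiv l g) y (fun l' => pderiv l' (pderiv l g) y).
  by move=> Uy; apply: diff_has_grad; exact: (sg [:: l]).
have c1 := has_grad_cont (diff_has_grad (sg [:: j; i] x Ux)).
have c2 := has_grad_cont (diff_has_grad (sg [:: i; j] x Ux)).
have /nbhs_rV[e1 e10 hU] : nbhs x U by apply: open_nbhs_nbhs.
apply: subr0_eq; apply: cabs_eq0; apply/le_anti; rewrite cabs_ge0 andbT.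
apply/ler_addgt0Pr => e e0.
have e2 : 0 < e / 2 by lra.
have [d1 d10 h1] := c1 _ e2; have [d2 d20 h2] := c2 _ e2.
pose t := Num.min e1 (Num.min d1 d2) / 3.
have m0 : 0 < Num.min e1 (Num.min d1 d2) by rewrite !lt_min e10 d10.
have t0 : 0 < t by rewrite divr_gt0.
have tE h : nrm1 h <= 2 * t -> nrm1 h < Num.min e1 (Num.min d1 d2).
  by move=> hh; have := m0; rewrite /t in hh; lra.
have hU' h : nrm1 h <= 2 * t -> U (x + h).
  by move=> /tE; rewrite !lt_min => /andP[? _]; exact: hU.
have H1 h : nrm1 h <= 2 * t -> cabs (pderiv j (pderiv i g) (x + h) - pderiv j (pderiv i g) x) <= e / 2.
  by move=> /tE; rewrite !lt_min => /and3P[_ ? _]; exact: h1.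
have H2 h : nrm1 h <= 2 * t -> cabs (pderiv i (pderiv j g) (x + h) - pderiv i (pderiv j g) x) <= e / 2.
  by move=> /tE; rewrite !lt_min => /and3P[_ _ ?]; exact: h2.
have y1 := young_half t0 (ltW e2) hU' dg (dg1 i) H1.
have y2 := young_half t0 (ltW e2) hU' dg (dg1 j) H2.
have t2 : 0 < t ^+ 2 by exact: exprn_gt0.
rewrite add0r -(ler_pM2r t2).
have -> : cabs (pderiv j (pderiv i g) x - pderiv i (pderiv j g) x) * t ^+ 2 =
   cabs (ofR k t ^+ 2 * (pderiv j (pderiv i g) x - pderiv i (pderiv j g) x)).
  by rewrite cabsM cabsX cabs_ofR gtr0_norm // mulrC.
move: y1 y2; rewrite (addrAC x).
set g3 := g (x + _ + _); set g1 := g (x + _ *: delta_mx 0 i); set g2 := g (x + _ *: delta_mx 0 j).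
set a := pderiv j (pderiv i g) x; set b := pderiv i (pderiv j g) x => y1 y2.
rewrite (_ : ofR k t ^+ 2 * (a - b) = (g3 - g2 - g1 + g x - ofR k t ^+ 2 * b) -
  (g3 - g1 - g2 + g x - ofR k t ^+ 2 * a)); last by ring.
apply: (le_trans (cabsD _ _)); rewrite cabsN.
by apply: (le_trans (lerD y2 y1)); rewrite -mulrDl -splitr.
Qed.

End Hasd.

(** * Smooth functions, Lie derivatives and word functions *)

Section Smooth.
Variables (R : realType) (k : scalars) (d : nat).
Local Notation K := (K R k).
Local Notation V := 'rV[K]_d.
Variables (U : set V) (oU : open U).
Implicit Types (x h v : V) (g : V -> K).

Notation dS := (foldr (@pderiv R k d)).

Lemma pderiv_eq j g g' x : (forall y, U y -> g y = g' y) -> U x ->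
  pderiv j g x = pderiv j g' x.
Proof.
move=> e Ux; apply: near_eq_derive.
have : nbhs x U by apply: open_nbhs_nbhs.
by apply: filterS => y; exact: e.
Qed.

Lemma dS_eq g g' : (forall y, U y -> g y = g' y) ->
  forall s x, U x -> dS g s x = dS g' s x.
Proof.
by move=> e; elim=> [|j s ih] x Ux /=; [exact: e|exact: pderiv_eq].
Qed.

Lemma differentiable_eq g g' x : (forall y, U y -> g y = g' y) -> U x ->
  differentiable (g : V -> K^o) x -> differentiable (g' : V -> K^o) x.
Proof.
by move=> e Ux /diff_has_grad/(has_grad_eq oU Ux e)/has_grad_diff[].
Qed.

Lemma pderivD j g g' x : differentiable (g : V -> K^o) x ->
  differentiable (g' : V -> K^o) x ->
  pderiv j (fun y => g y + g' y) x = pderiv j g x + pderiv j g' x.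
Proof.
by move=> dg dg'; apply: (@deriveD K V K^o g g'); exact: diff_derivable.
Qed.

Lemma pderivB j g g' x : differentiable (g : V -> K^o) x ->
  differentiable (g' : V -> K^o) x ->
  pderiv j (fun y => g y - g' y) x = pderiv j g x - pderiv j g' x.
Proof.
by move=> dg dg'; apply: (@deriveB K V K^o g g'); exact: diff_derivable.
Qed.

Lemma pderivM j g g' x : differentiable (g : V -> K^o) x ->
  differentiable (g' : V -> K^o) x ->
  pderiv j (fun y => g y * g' y) x = pderiv j g x * g' x + g x * pderiv j g' x.
Proof.
move=> dg dg'.
have d1 : derivable (g : V -> K^o) x (delta_mx 0 j) by exact: diff_derivable.
have d2 : derivable (g' : V -> K^o) x (delta_mx 0 j) by exact: diff_derivable.
apply: (etrans (@deriveM K V g g' x _ d1 d2)).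
by rewrite addrC; congr (_ + _); exact: mulrC.
Qed.

Lemma pderiv_sum (I : finType) j (F : I -> V -> K) x :
  (forall i, differentiable (F i : V -> K^o) x) ->
  differentiable ((fun y => \sum_i F i y) : V -> K^o) x /\
  pderiv j (fun y => \sum_i F i y) x = \sum_i pderiv j (F i) x.
Proof.
move=> dF; suff [h1 h2] : has_grad (fun y => \sum_i F i y) x (fun l => \sum_i pderiv l (F i) x) /\ True.
  by have [? e] := has_grad_diff h1; split.
split=> //; elim: (index_enum I) => [|i s ih].
  move=> e e0; exists 1 => // h _; rewrite !big_nil.
  rewrite big1 => [|l _]; last by rewrite big_nil mulr0.
  by rewrite !subr0 cabs0 mulr_ge0 // ltW.
have [d1 e1] := has_grad_diff ih.
have := differentiableD (dF i) d1 => d2.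
have := diff_has_grad d2.
have -> : ((F i : V -> K^o) + (fun y => \sum_(j <- s) F j y : K^o)) = (fun y => \sum_(j <- i :: s) F j y).
  by apply/funext => y; rewrite big_cons.
congr has_grad; apply/funext => l; rewrite big_cons.
have -> : (fun y => \sum_(j <- i :: s) F j y) = (fun y => F i y + \sum_(j <- s) F j y).
  by apply/funext => y; rewrite big_cons.
by rewrite pderivD // e1.
Qed.

(** Smoothness up to order n, the form in which closure under products is
    proved by induction. *)
Definition smn n g := forall s x, (size s <= n)%N -> U x ->
  differentiable (dS g s : V -> K^o) x.

Lemma smooth_smn g : smooth_on U g <-> forall n, smn n g.
Proof.
by split => [h n s x _|h s x]; [exact: h|apply: (h (size s) s x)].
Qed.

Lemma smooth_diff g x : smooth_on U g -> U x -> differentiable (g : V -> K^o) x.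
Proof. by move=> h; exact: (h [::]). Qed.
Hint Resolve smooth_diff : core.

Lemma smooth_pd j g : smooth_on U g -> smooth_on U (pderiv j g).
Proof. by move=> h s x Ux; rewrite -foldr_rcons; exact: h. Qed.

Lemma smn_eq n g g' : (forall y, U y -> g y = g' y) -> smn n g -> smn n g'.
Proof.
move=> e h s x sn Ux; apply: differentiable_eq (h s x sn Ux) => // y.
exact: dS_eq.
Qed.

Lemma smooth_eq g g' : (forall y, U y -> g y = g' y) -> smooth_on U g -> smooth_on U g'.
Proof. by move=> e /smooth_smn h; apply/smooth_smn => n; exact: smn_eq (h n). Qed.

Lemma dS_D n g g' : smn n g -> smn n g' -> forall s x, (size s <= n.+1)%N -> U x ->
  dS (fun y => g y + g' y) s x = dS g s x + dS g' s x.
Proof.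
move=> hg hg'; elim=> [//|j s ih] x /= sn Ux.
rewrite (@pderiv_eq j _ (fun y => dS g s y + dS g' s y)) //.
  by rewrite pderivD //; [exact: hg|exact: hg'].
by move=> y; apply: ih; exact: ltnW.
Qed.

Lemma smnD n g g' : smn n g -> smn n g' -> smn n (fun y => g y + g' y).
Proof.
move=> hg hg' s x sn Ux.
apply: (@differentiable_eq (fun y => dS g s y + dS g' s y)) => //.
  by move=> y Uy; rewrite (dS_D hg hg') // leqW.
exact: differentiableD (hg _ _ sn Ux) (hg' _ _ sn Ux).
Qed.

Lemma smoothD g g' : smooth_on U g -> smooth_on U g' ->
  smooth_on U (fun y => g y + g' y).
Proof. by move=> /smooth_smn h /smooth_smn h'; apply/smooth_smn => n; exact: smnD. Qed.

Lemma smnM n g g' : smooth_on U g -> smooth_on U g' -> smn n (fun y => g y * g' y).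
Proof.
elim: n g g' => [|n ih] g g' hg hg' s x.
  rewrite leqn0 => /nilP -> Ux /=.
  exact: differentiableM (hg [::] x Ux) (hg' [::] x Ux).
case/lastP: s => [_ Ux|s j]; first exact: differentiableM (hg [::] x Ux) (hg' [::] x Ux).
rewrite size_rcons ltnS foldr_rcons => sn Ux.
have : smn n (pderiv j (fun y => g y * g' y)).
  apply: (@smn_eq _ (fun y => pderiv j g y * g' y + g y * pderiv j g' y)).
    by move=> y Uy; rewrite pderivM //; [exact: (hg [::])|exact: (hg' [::])].
  by apply: smnD; apply: ih => //; exact: smooth_pd.
exact.
Qed.

Lemma smoothM g g' : smooth_on U g -> smooth_on U g' ->
  smooth_on U (fun y => g y * g' y).
Proof. by move=> h h'; apply/smooth_smn => n; exact: smnM. Qed.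

Lemma dS_cst (c : K) j s x : dS (fun=> c) (j :: s) x = 0.
Proof.
suff -> : dS (fun=> c) (j :: s) = (fun=> 0) by [].
have p0 (a : K) i : pderiv i (fun=> a : K) = (fun=> 0) :> (V -> K).
  by apply/funext => y; exact: (@derive_cst K V K^o a).
by elim: s j => [|i s ih] j; rewrite /= ?p0 //; have /= -> := ih i.
Qed.

Lemma smooth_cst (c : K) : smooth_on U (fun=> c).
Proof.
move=> s x Ux; case: s => [|j s]; first exact: differentiable_cst.
have -> : dS (fun=> c) (j :: s) = (fun=> 0) by apply/funext => y; exact: dS_cst.
exact: differentiable_cst.
Qed.

Lemma smoothB g g' : smooth_on U g -> smooth_on U g' ->
  smooth_on U (fun y => g y - g' y).
Proof.
move=> h h'; apply: (@smooth_eq (fun y => g y + (-1) * g' y)).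
  by move=> y _; rewrite mulN1r.
by apply: smoothD => //; apply: smoothM => //; exact: smooth_cst.
Qed.

Lemma smooth_sum (I : Type) (s : seq I) (F : I -> V -> K) :
  (forall i, smooth_on U (F i)) -> smooth_on U (fun y => \sum_(i <- s) F i y).
Proof.
move=> h; elim: s => [|i s ih].
  by apply: (@smooth_eq (fun=> 0)); [move=> y _; rewrite big_nil|exact: smooth_cst].
apply: (@smooth_eq (fun y => F i y + \sum_(j <- s) F j y)).
  by move=> y _; rewrite big_cons.
exact: smoothD.
Qed.

Lemma dS_perm g s s' x : smooth_on U g -> perm_eq s s' -> U x -> dS g s x = dS g s' x.
Proof.
move=> hg.
have front j t1 t2 y : U y -> dS g (t1 ++ j :: t2) y = dS g (j :: t1 ++ t2) y.
  elim: t1 y => [//|i t1 ih] y Uy.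
  rewrite [LHS](@pderiv_eq i (dS g (t1 ++ j :: t2)) (dS g (j :: t1 ++ t2)) y ih Uy).
  apply: (@clairaut _ _ _ (dS g (t1 ++ t2)) y U j i) => // t z Uz.
  by rewrite -foldr_cat; exact: hg.
elim: s s' x => [|j s ih] s' x ps Ux.
  by move: ps; rewrite perm_sym => /perm_nilP ->.
have js' : j \in s' by rewrite -(perm_mem ps) mem_head.
case/splitPr: js' ps => t1 t2 ps.
rewrite front //=; apply: pderiv_eq => // y Uy; apply: ih => //.
by move: ps; rewrite -cat1s -[j :: t2]cat1s perm_sym perm_catCA perm_sym perm_cons.
Qed.

(** Smoothness of vector fields is asked of the coordinates, as in the
    definition of the analytic classes. *)
Definition vsm (f : V -> V) := forall j, smooth_on U (fun x => f x 0 j).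

(** The Lie derivative of g along f. *)
Definition Lop (f : V -> V) (g : V -> K) : V -> K :=
  fun x => \sum_(j < d) f x 0 j * pderiv j g x.

Lemma smooth_Lop f g : vsm f -> smooth_on U g -> smooth_on U (Lop f g).
Proof.
move=> hf hg; apply: smooth_sum => j; apply: smoothM; first exact: hf.
exact: smooth_pd.
Qed.

Lemma Lop_eq f g g' x : (forall y, U y -> g y = g' y) -> U x -> Lop f g x = Lop f g' x.
Proof. by move=> e Ux; apply: eq_bigr => j _; rewrite (@pderiv_eq j g g'). Qed.

Lemma LopB f g g' x : smooth_on U g -> smooth_on U g' -> U x ->
  Lop f (fun y => g y - g' y) x = Lop f g x - Lop f g' x.
Proof.
move=> hg hg' Ux; rewrite /Lop -sumrB; apply: eq_bigr => j _.
by rewrite pderivB ?mulrBr //; [exact: (hg [::])|exact: (hg' [::])].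
Qed.

Lemma diff_vec (f : V -> V) x v j :
  (forall j, differentiable ((fun y => f y 0 j) : V -> K^o) x) ->
  ('d f x v) 0 j = \sum_(i < d) v 0 i * pderiv i (fun y => f y 0 j) x.
Proof.
move=> df.
have dfx : differentiable f x.
  have -> : f = \sum_(j < d) (fun y => (f y 0 j) *: (delta_mx 0 j : V)).
    by apply/funext => y; rewrite fct_sumE {1}(row_sum_delta (f y)).
  by apply: differentiable_sum => i; apply: differentiableZl; exact: df.
pose c : V -> K^o := fun N => N 0 j.
have cl : linear c by move=> a u w; rewrite /c !mxE.
pose cc : {linear V -> K^o} := HB.pack c (GRing.isLinear.Build _ _ _ _ c cl).
have cont : continuous (cc : V -> K^o) by exact: coord_continuous.
have dc : differentiable (cc : V -> K^o) (f x) by exact: linear_differentiable.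
have e1 := diff_lin (f x) cont.
have e2 := diff_comp dfx dc.
have e3 : 'd ((cc : V -> K^o) \o f) x v = cc ('d f x v).
  have /= -> := congr1 (fun F : V -> K^o => F v) e2.
  exact: (congr1 (fun F : V -> K^o => F ('d f x v)) e1).
transitivity ('d ((cc : V -> K^o) \o f) x v); first by rewrite e3.
rewrite [LHS]diff_sum; apply: eq_bigr => i _; congr (_ * _).
by rewrite /pderiv deriveE //; exact: df.
Qed.

Lemma lie_coord (f g : V -> V) x j : vsm f -> vsm g -> U x ->
  lie_bracket f g x 0 j = Lop f (fun y => g y 0 j) x - Lop g (fun y => f y 0 j) x.
Proof.
move=> hf hg Ux; rewrite /lie_bracket !mxE.
by rewrite !diff_vec // => i; [exact: (hf i [::])|exact: (hg i [::])].
Qed.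

Lemma vsm_lie (f g : V -> V) : vsm f -> vsm g -> vsm (lie_bracket f g).
Proof.
move=> hf hg j.
apply: (@smooth_eq (fun x => Lop f (fun y => g y 0 j) x - Lop g (fun y => f y 0 j) x)).
  by move=> y Uy; rewrite lie_coord.
by apply: smoothB; apply: smooth_Lop.
Qed.

Lemma Lop_Lop (f g : V -> V) (phi : V -> K) x : vsm g -> smooth_on U phi -> U x ->
  Lop f (Lop g phi) x = \sum_(j < d) Lop f (fun y => g y 0 j) x * pderiv j phi x +
    \sum_(i < d) \sum_(j < d) f x 0 i * (g x 0 j * pderiv i (pderiv j phi) x).
Proof.
move=> hg hp Ux; rewrite /Lop.
under [X in X + _]eq_bigr do rewrite mulr_suml.
rewrite exchange_big /= -big_split /=; apply: eq_bigr => i _.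
have [|_ ->] := @pderiv_sum _ i (fun j y => g y 0 j * pderiv j phi y) x.
  by move=> j; apply: differentiableM; [exact: (hg j [::])|exact: (hp [:: j])].
rewrite mulr_sumr -big_split /=; apply: eq_bigr => j _.
rewrite pderivM; [|exact: (hg j [::])|exact: (hp [:: j])].
by rewrite mulrDr mulrA.
Qed.

(** The second order terms cancel by symmetry of second derivatives. *)
Lemma Lop_lie (f g : V -> V) (phi : V -> K) x : vsm f -> vsm g -> smooth_on U phi -> U x ->
  Lop (lie_bracket f g) phi x = Lop f (Lop g phi) x - Lop g (Lop f phi) x.
Proof.
move=> hf hg hp Ux; rewrite !Lop_Lop //.
have aux (a b c1 c2 : K) : c1 = c2 -> a + c1 - (b + c2) = a - b.
  by move=> ->; rewrite opprD addrACA subrr addr0.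
rewrite aux; last first.
  rewrite exchange_big /=; apply: eq_bigr => i _; apply: eq_bigr => j _.
  by rewrite (clairaut i j oU Ux hp) mulrCA.
rewrite -sumrB; apply: eq_bigr => j _.
by rewrite lie_coord // mulrBl.
Qed.

End Smooth.

Section Words.
Variables (R : realType) (k : scalars) (d q : nat).
Local Notation K := (K R k).
Local Notation V := 'rV[K]_d.
Variables (U : set V) (oU : open U).
Variable f : 'I_q.+1 -> V -> V.
Hypothesis hf : forall i, vsm U (f i).

Lemma vsm_vf b : vsm U (vf f b).
Proof. by elim: b => [i|b1 h1 b2 h2] /=; [exact: hf|exact: vsm_lie]. Qed.

(** The letters are read from left to right as L_(w_1) L_(w_2) ... , so the
    last letter acts first. *)
Definition Lw (w : seq 'I_q.+1) (phi : V -> K) : V -> K :=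
  foldr (fun i psi => Lop (f i) psi) phi w.

(** The word function of phi at x. Every expansion below is a linear form in
    it. *)
Definition chi (x : V) (phi : V -> K) : seq 'I_q.+1 -> K := fun w => Lw w phi x.

Lemma smooth_Lw w phi : smooth_on U phi -> smooth_on U (Lw w phi).
Proof. by move=> h; elim: w => [//|i w ih] /=; exact: smooth_Lop. Qed.

Lemma Lw_eq phi psi : (forall y, U y -> phi y = psi y) ->
  forall w x, U x -> Lw w phi x = Lw w psi x.
Proof. by move=> e; elim=> [|i w ih] x Ux /=; [exact: e|exact: Lop_eq Ux]. Qed.

Lemma Lw_B phi psi w x : smooth_on U phi -> smooth_on U psi -> U x ->
  Lw w (fun y => phi y - psi y) x = Lw w phi x - Lw w psi x.
Proof.
move=> h h'; elim: w x => [//|i w ih] x Ux /=.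
rewrite (@Lop_eq _ _ _ U oU _ _ (fun y => Lw w phi y - Lw w psi y)) //.
by rewrite (@LopB _ _ _ U) //; exact: smooth_Lw.
Qed.

End Words.

(** The Lie derivative along f_b as seen on word functions. A letter is
    appended on the right, because the last letter of a word acts first; a
    bracket becomes a commutator. *)
Fixpoint tau (A : zmodType) (q : nat) (b : br q) (c : seq 'I_q.+1 -> A) : seq 'I_q.+1 -> A :=
  match b with
  | Gen i => fun w => c (rcons w i)
  | Pair b1 b2 => fun w => tau b1 (tau b2 c) w - tau b2 (tau b1 c) w
  end.

(** Turns brackets of vector fields into the combinatorial operators tau b;
    from here on the vector fields only enter through bounds. *)
Lemma chi_vf (R : realType) (k : scalars) (d q : nat) (U : set 'rV[K R k]_d)
  (f : 'I_q.+1 -> 'rV[K R k]_d -> 'rV[K R k]_d) (b : br q) phi x :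
  open U -> (forall i, vsm U (f i)) -> smooth_on U phi -> U x ->
  chi f x (Lop (vf f b) phi) = tau b (chi f x phi).
Proof.
move=> oU hf; elim: b phi => [i|b1 h1 b2 h2] phi hp Ux /=.
  by apply/funext => w; rewrite /chi /Lw foldr_rcons.
apply/funext => w; rewrite /chi.
have s1 := vsm_vf oU hf b1; have s2 := vsm_vf oU hf b2.
have p1 := smooth_Lop oU s1 hp; have p2 := smooth_Lop oU s2 hp.
rewrite (@Lw_eq _ _ _ _ U oU f _ (fun y => Lop (vf f b1) (Lop (vf f b2) phi) y -
  Lop (vf f b2) (Lop (vf f b1) phi) y)) //; last first.
  by move=> y Uy; exact: (Lop_lie oU s1 s2 hp Uy).
rewrite (@Lw_B _ _ _ _ U) //; [|exact: smooth_Lop..].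
rewrite -[X in X - _]/(chi f x _ w) -[X in _ - X]/(chi f x _ w).
by rewrite h1 // (h2 _ p1) // -(h2 _ hp) // -(h1 _ hp).
Qed.

(** * Cauchy estimates for vector fields and brackets *)

(** The rising factorial a (a + 1) ... (a + n - 1). *)
Fixpoint rise (a n : nat) : nat :=
  if n is n'.+1 then (a * rise a.+1 n')%N else 1%N.

Lemma rise_fact a n : (rise a.+1 n * a`! = (a + n)`!)%N.
Proof.
elim: n a => [|n ih] a; first by rewrite mul1n addn0.
by rewrite /= mulnAC -factS -addSnnS -ih mulnC.
Qed.

Lemma rise1 n : rise 1 n = n`!.
Proof. by have := rise_fact 0 n; rewrite muln1. Qed.

Lemma rise0 n : rise 0 n.+1 = 0%N.
Proof. by []. Qed.

Lemma bin_le2 n m : ('C(n, m) <= 2 ^ n)%N.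
Proof.
elim: n m => [|n ih] [|m] //; first by rewrite bin0 expn_gt0.
by rewrite binS expnS mul2n -addnn leq_add.
Qed.

Lemma rise_le a n : (rise a.+1 n <= 2 ^ (a + n) * n`!)%N.
Proof.
rewrite -(leq_pmul2r (fact_gt0 a)) rise_fact.
by rewrite -[X in (X <= _)%N](bin_fact (leq_addl a n)) addnK -mulnA leq_mul2r bin_le2 orbT.
Qed.

Section Bd.
Variables (R : realType) (k : scalars) (d : nat).
Local Notation K := (K R k).
Local Notation V := 'rV[K]_d.
Variables (U : set V) (oU : open U) (Bs : set V) (BU : Bs `<=` U).
Notation dS := (foldr (@pderiv R k d)).

(** Cauchy estimates with an exponent a: the derivatives are dominated by
    those of A (1 - s / rho)^(-a) at s = 0. A derivative raises the exponent by
    one and a product adds exponents, so that no radius is lost in iterated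
    brackets. *)
Definition bd (rho : R) (phi : V -> K) (A : R) (a : nat) :=
  forall s x, Bs x ->
    cabs (dS phi s x) <= A * (rise a (size s))%:R / rho ^+ size s.

Lemma bd0 rho phi A a x : bd rho phi A a -> Bs x -> cabs (phi x) <= A.
Proof. by move=> h Bx; have := h [::] x Bx; rewrite /= mulr1 divr1. Qed.

Section FixRho.
Variable rho : R.
Hypothesis rho0 : 0 < rho.
Local Notation bd := (bd rho).

Lemma bd_le phi A A' a : A <= A' -> bd phi A a -> bd phi A' a.
Proof.
move=> AA h s x Bx; apply: (le_trans (h s x Bx)).
by rewrite ler_wpM2r ?invr_ge0 ?exprn_ge0 ?(ltW rho0) // ler_wpM2r.
Qed.

Lemma bd_pd j phi A a : bd phi A a -> bd (pderiv j phi) (A * a%:R / rho) a.+1.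
Proof.
move=> h s x Bx; have := h (rcons s j) x Bx; rewrite foldr_rcons => /le_trans; apply.
rewrite size_rcons /= natrM exprS invfM le_eqVlt; apply/orP; left; apply/eqP.
by move: (rho^-1) (_^-1) => u v; ring.
Qed.

Lemma bd_eq phi psi A a : (forall y, U y -> phi y = psi y) -> bd phi A a -> bd psi A a.
Proof. by move=> e h s x Bx; rewrite -(dS_eq oU e) ?h //; exact: BU. Qed.

Lemma bd_D phi psi A B a : smooth_on U phi -> smooth_on U psi ->
  bd phi A a -> bd psi B a -> bd (fun y => phi y + psi y) (A + B) a.
Proof.
move=> /smooth_smn sp /smooth_smn sq hp hq s x Bx.
rewrite (dS_D oU (sp (size s)) (sq (size s))) ?leqnSn //; last exact: BU.
apply: (le_trans (cabsD _ _)); rewrite -mulrA mulrDl !mulrA.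
by apply: lerD; [exact: hp|exact: hq].
Qed.

Lemma bd_cst (c : K) : bd (fun=> c) (cabs c) 0.
Proof.
move=> s x Bx; case: s => [|j s]; first by rewrite /= mulr1 divr1.
by rewrite dS_cst cabs0 rise0 mulr0 mul0r.
Qed.

Lemma bd_sum (s : seq 'I_d) (F : 'I_d -> V -> K) A a : 0 <= A ->
  (forall i, smooth_on U (F i)) -> (forall i, bd (F i) A a) ->
  bd (fun y => \sum_(i <- s) F i y) ((size s)%:R * A) a.
Proof.
move=> A0 sF hF; elim: s => [|i s ih].
  move=> t x Bx; rewrite mul0r !mul0r.
  have -> : (fun y => \sum_(i <- [::]) F i y) = (fun=> 0) by apply/funext => y; rewrite big_nil.
  by case: t => [|j t]; rewrite ?dS_cst ?cabs0.
apply: (@bd_eq (fun y => F i y + \sum_(j <- s) F j y)).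
  by move=> y _; rewrite big_cons.
have -> : (size (i :: s))%:R * A = A + (size s)%:R * A by rewrite /= -natr1; ring.
by apply: bd_D => //; exact: (smooth_sum oU).
Qed.

(** One derivative is distributed by Leibniz' rule; both contributions have
    exponent a + b + 1, and their constants add up to A B (a + b) / rho. *)
Lemma bd_M phi psi A B a b : smooth_on U phi -> smooth_on U psi -> 0 <= A -> 0 <= B ->
  bd phi A a -> bd psi B b -> bd (fun y => phi y * psi y) (A * B) (a + b).
Proof.
move=> sp sq A0 B0 hp hq s; move en : (size s) => n.
elim: n s phi psi A B a b sp sq A0 B0 hp hq en => [|n ih] s phi psi A B a b sp sq A0 B0 hp hq.
  move=> /eqP/nilP -> x Bx; rewrite /= mulr1 divr1 cabsM.
  by apply: ler_pM => //; [exact: bd0 hp Bx|exact: bd0 hq Bx].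
case/lastP: s => [//|s j]; rewrite size_rcons => -[sn] x Bx; rewrite foldr_rcons.
have Ux := BU Bx.
rewrite (@dS_eq _ _ _ _ oU _ (fun y => pderiv j phi y * psi y + phi y * pderiv j psi y)) //; last first.
  by move=> y Uy; apply: pderivM; [exact: (sp [::])|exact: (sq [::])].
have sp1 := smooth_pd j sp; have sq1 := smooth_pd j sq.
have m1 : smooth_on U (fun y => pderiv j phi y * psi y) by exact: smoothM.
have m2 : smooth_on U (fun y => phi y * pderiv j psi y) by exact: smoothM.
have /smooth_smn n1 := m1; have /smooth_smn n2 := m2.
rewrite (dS_D oU (n1 n) (n2 n)) ?sn ?leqnSn //.
have pA : 0 <= A * a%:R / rho by rewrite divr_ge0 ?mulr_ge0 // ltW.
have pB : 0 <= B * b%:R / rho by rewrite divr_ge0 ?mulr_ge0 // ltW.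
have h1 := ih s _ _ _ _ _ _ sp1 sq pA B0 (bd_pd j hp) hq sn x Bx.
have h2 := ih s _ _ _ _ _ _ sp sq1 A0 pB hp (bd_pd j hq) sn x Bx.
apply: (le_trans (cabsD _ _)); apply: (le_trans (lerD h1 h2)).
rewrite addSn addnS /= natrM exprS invfM natrD le_eqVlt; apply/orP; left; apply/eqP.
by move: (rho^-1) ((rho ^+ n)^-1) ((rise _ _)%:R) => u v w; ring.
Qed.

Lemma bd_Lop (f : V -> V) phi A B a b : vsm U f -> smooth_on U phi -> 0 <= A -> 0 <= B ->
  (forall j, bd (fun x => f x 0 j) A a) -> bd phi B b ->
  bd (Lop f phi) (d%:R * (A * (B * b%:R / rho))) (a + b).+1.
Proof.
move=> sf sp A0 B0 hf hp.
have B1 : 0 <= B * b%:R / rho by rewrite divr_ge0 ?mulr_ge0 // ltW.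
have := @bd_sum (index_enum 'I_d) (fun j x => f x 0 j * pderiv j phi x)
  (A * (B * b%:R / rho)) (a + b).+1 (mulr_ge0 A0 B1).
have -> : size (index_enum 'I_d) = d by rewrite -sum1_size -[RHS]card_ord -sum1_card; exact: eq_bigl.
apply=> j; first by apply: smoothM => //; exact: smooth_pd.
by rewrite -addnS; apply: bd_M => //; [exact: smooth_pd|exact: bd_pd].
Qed.

Lemma bd_lie (f g : V -> V) A B a b : vsm U f -> vsm U g -> 0 <= A -> 0 <= B ->
  (forall j, bd (fun x => f x 0 j) A a) -> (forall j, bd (fun x => g x 0 j) B b) ->
  forall j, bd (fun x => lie_bracket f g x 0 j) (d%:R * (A * B * (a + b)%:R / rho)) (a + b).+1.
Proof.
move=> sf sg A0 B0 hf hg j.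
apply: (@bd_eq (fun x => Lop f (fun y => g y 0 j) x + (-1) * Lop g (fun y => f y 0 j) x)).
  by move=> y Uy; rewrite (lie_coord j sf sg Uy) mulN1r.
have s1 := smooth_Lop oU sf (sg j); have s2 := smooth_Lop oU sg (sf j).
have h1 := bd_Lop sf (sg j) A0 B0 hf (hg j).
have h2 := bd_Lop sg (sf j) B0 A0 hg (hf j).
have -> : d%:R * (A * B * (a + b)%:R / rho) =
  d%:R * (A * (B * b%:R / rho)) + cabs (-1 : K) * (d%:R * (B * (A * a%:R / rho))).
  by rewrite cabsN cabs1 natrD; move: (rho^-1) => u; ring.
apply: bd_D => //; first by apply: smoothM => //; exact: smooth_cst.
rewrite -[(a + b).+1]add0n (addnC a b); apply: bd_M => //.
- exact: smooth_cst.
- by rewrite mulr_ge0 // mulr_ge0 // divr_ge0 ?mulr_ge0 // ltW.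
- exact: bd_cst.
Qed.

End FixRho.

(** Halving the radius brings the exponent back to 1, at the price of a
    geometric factor. *)
Lemma bd_half rho phi A a : 0 < rho -> 0 <= A -> bd rho phi A a.+1 ->
  bd (rho / 2) phi (A * 2 ^+ a) 1.
Proof.
move=> r0 A0 h s x Bx; apply: (le_trans (h s x Bx)).
rewrite rise1 expr_div_n invf_div; move: (size s) => n.
have -> : A * 2 ^+ a * n`!%:R * (2 ^+ n / rho ^+ n) = A * (2 ^ (a + n) * n`!)%N%:R / rho ^+ n.
  by rewrite natrM natrX exprD; move: (_^-1) => u; ring.
rewrite ler_wpM2r ?invr_ge0 ?exprn_ge0 ?(ltW r0) // ler_wpM2l // ler_nat.
exact: rise_le.
Qed.

End Bd.

Fixpoint len (q : nat) (b : br q) : nat :=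
  match b with Gen _ => 1 | Pair b1 b2 => len b1 + len b2 end.

Lemma len_gt0 q (b : br q) : (0 < len b)%N.
Proof. by elim: b => //= b1 h1 b2 h2; rewrite addn_gt0 h1. Qed.

Lemma nocc_len q (b : br q) : (nocc b <= len b)%N.
Proof. by elim: b => [i|b1 h1 b2 h2] /=; [case: (_ != _)|exact: leq_add]. Qed.

Section BdVf.
Variables (R : realType) (k : scalars) (d q : nat).
Local Notation K := (K R k).
Local Notation V := 'rV[K]_d.
Variables (U : set V) (oU : open U) (Bs : set V) (BU : Bs `<=` U).
Variables (rho A0 : R) (f : 'I_q.+1 -> V -> V).
Hypotheses (hd : (0 < d)%N) (rho0 : 0 < rho) (A00 : 0 < A0).
Hypothesis hf : forall i, vsm U (f i).
Hypothesis hbd : forall i j, bd Bs rho (fun x => f i x 0 j) A0 1.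

Lemma bd_vf1 b j : bd Bs rho (fun x => vf f b x 0 j)
  (rho / (2 * d%:R) * (2 * d%:R * A0 / rho) ^+ len b * ((len b).-1)`!%:R) (2 * len b).-1.
Proof.
have d0 : 0 < d%:R :> R by rewrite ltr0n.
set H := 2 * d%:R * A0 / rho; set c := rho / (2 * d%:R).
have c0 : 0 < c by rewrite divr_gt0 // mulr_gt0.
have H0 : 0 < H by rewrite divr_gt0 // !mulr_gt0.
elim: b j => [i|b1 h1 b2 h2] j /=.
  rewrite expr1 mulr1; have -> : c * H = A0 by rewrite /c /H; field; rewrite !gt_eqF.
  exact: hbd.
have p (b : br q) : 0 <= c * H ^+ len b * ((len b).-1)`!%:R.
  by rewrite !mulr_ge0 // ?exprn_ge0 // ltW.
have := bd_lie oU BU rho0 (vsm_vf oU hf b1) (vsm_vf oU hf b2) (p b1) (p b2) h1 h2 j.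
have := len_gt0 b1; have := len_gt0 b2.
move: (len b1) (len b2) => [//|m] [//|n] _ _.
have -> : ((2 * m.+1).-1 + (2 * n.+1).-1).+1 = (2 * (m.+1 + n.+1)).-1 by lia.
have -> : ((2 * m.+1).-1 + (2 * n.+1).-1)%N = (2 * (m + n).+1)%N by lia.
apply: bd_le => //=.
have -> : d%:R * (c * H ^+ m.+1 * m`!%:R * (c * H ^+ n.+1 * n`!%:R) * (2 * (m + n).+1)%:R / rho) =
  c * H ^+ (m.+1 + n.+1) * ((m`! * n`!) * (m + n).+1)%:R.
  rewrite exprD !natrM /c; move: (H ^+ _) (H ^+ _) (m`!%:R) (n`!%:R) ((m + n).+1%:R) => *.
  by field; rewrite !gt_eqF.
apply: ler_wpM2l.
  by apply: mulr_ge0; [exact: ltW|apply: exprn_ge0; exact: ltW].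
rewrite ler_nat addnS factS mulnC.
rewrite leq_mul2l /= -(bin_fact (leq_addr n m)) addKn leq_pmull //.
by rewrite bin_gt0 leq_addr.
Qed.

Definition vf_rate : R := 8 * d%:R * A0 / rho.
Definition vf_bound (b : br q) : R := rho / (2 * d%:R) * vf_rate ^+ len b * (len b)`!%:R.

Lemma vf_rate_gt0 : 0 < vf_rate.
Proof. by rewrite divr_gt0 // !mulr_gt0 // ltr0n. Qed.

Lemma vf_bound_ge0 b : 0 <= vf_bound b.
Proof.
rewrite /vf_bound; apply: mulr_ge0; last exact: ler0n.
apply: mulr_ge0; first by apply: divr_ge0; [exact: ltW|exact: mulr_ge0].
by apply: exprn_ge0; exact: ltW vf_rate_gt0.
Qed.

(** The factorial of len b is compensated later by the smallness of xi_b,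
    since b has few letters other than X_0. *)
Lemma bd_vf b j : bd Bs (rho / 2) (fun x => vf f b x 0 j) (vf_bound b) 1.
Proof.
have d0 : 0 < d%:R :> R by rewrite ltr0n.
have := bd_vf1 b j; have := len_gt0 b; rewrite /vf_bound; move: (len b) => [//|n] _.
rewrite (_ : (2 * n.+1).-1 = (2 * n).+1); last by lia.
set A := _ * _ * _ => h.
have A1 : 0 <= A.
  apply: mulr_ge0; last exact: ler0n.
  apply: mulr_ge0; first by apply: divr_ge0; [exact: ltW|exact: mulr_ge0].
  by apply: exprn_ge0; apply: ltW; rewrite divr_gt0 // !mulr_gt0.
apply: bd_le (bd_half rho0 A1 h); first by rewrite divr_gt0.
rewrite /A /= -/(vf_rate) (_ : vf_rate = 4 * (2 * d%:R * A0 / rho)); last by rewrite /vf_rate; field; rewrite gt_eqF.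
set H := 2 * d%:R * A0 / rho.
have H0 : 0 < H by rewrite divr_gt0 // !mulr_gt0.
rewrite (exprMn _ 4 H) (exprM 2 2 n) (_ : (2 : R) ^+ 2 = 4); last by rewrite expr2 -natrM.
rewrite (_ : _ * 4 ^+ n = rho / (2 * d%:R) * (4 ^+ n * H ^+ n.+1) * n`!%:R); last by ring.
apply: ler_pM => //.
- apply: mulr_ge0; first by apply: divr_ge0; [exact: ltW|exact: mulr_ge0].
  by apply: mulr_ge0; apply: exprn_ge0 => //; exact: ltW.
- apply: ler_wpM2l; first by apply: divr_ge0; [exact: ltW|exact: mulr_ge0].
  apply: ler_wpM2r; first by apply: exprn_ge0; exact: ltW.
  by rewrite exprS ler_peMl ?exprn_ge0 // ler1n.
- by rewrite ler_nat factS leq_pmull.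
Qed.

End BdVf.

Section Coord.
Variables (R : realType) (k : scalars) (d : nat).
Local Notation K := (K R k).
Local Notation V := 'rV[K]_d.
Variables (U : set V) (oU : open U) (Bs : set V) (BU : Bs `<=` U).

Lemma pderiv_coord i j : pderiv i (fun x : V => x 0 j) = fun=> (delta_mx 0 i : V) 0 j.
Proof.
apply/funext => x.
have : has_grad (fun x : V => x 0 j) x (fun l => (delta_mx 0 l : V) 0 j).
  move=> e e0; exists 1 => // h _.
  rewrite mxE (_ : x 0 j + h 0 j - x 0 j = h 0 j); last by rewrite addrAC subrr add0r.
  rewrite (bigD1 j) //= big1 => [|l lj]; last first.
    by rewrite mxE eqxx /= eq_sym (negbTE lj) mulr0.
  by rewrite mxE !eqxx mulr1 addr0 subrr cabs0 mulr_ge0 // ltW.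
by case/has_grad_diff.
Qed.

Lemma smooth_coord j : smooth_on U (fun x : V => x 0 j).
Proof.
move=> s x Ux; case/lastP: s => [|s i]; first exact: differentiable_coord.
by rewrite foldr_rcons pderiv_coord; exact: (@smooth_cst _ _ _ U).
Qed.

Lemma bd_coord rho A j : 0 < rho -> rho <= A -> (forall x, Bs x -> cabs (x 0 j) <= A) ->
  bd Bs rho (fun x => x 0 j) A 1.
Proof.
move=> r0 rA hA s x Bx; have A0 : 0 <= A by apply: le_trans rA; exact: ltW.
case/lastP: s => [|s i]; first by rewrite /= mulr1 divr1 hA.
rewrite foldr_rcons pderiv_coord; case: s => [|l s]; last first.
  by rewrite dS_cst cabs0 mulr_ge0 ?invr_ge0 ?exprn_ge0 ?(ltW r0) // mulr_ge0.
rewrite /= !muln1 mulr1 expr1 mxE eqxx /=.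
apply: (@le_trans _ _ 1); last by rewrite ler_pdivlMr // mul1r.
by rewrite cabs_nat; case: (_ == _).
Qed.

End Coord.

Section Omega.
Variables (R : realType) (k : scalars) (d : nat).
Local Notation K := (K R k).
Local Notation V := 'rV[K]_d.
Notation dS := (foldr (@pderiv R k d)).

Lemma mderiv_dS (al : {ffun 'I_d -> nat}) (g : V -> K) :
  mderiv al g = dS g (flatten [seq nseq (al j) j | j <- enum 'I_d]).
Proof.
rewrite /mderiv; elim: (enum 'I_d) => [//|j s ih] /=.
by rewrite foldr_cat -ih; elim: (al j) => [//|n /= ->].
Qed.

Lemma content_perm (s : seq 'I_d) :
  perm_eq s (flatten [seq nseq ([ffun j => count_mem j s] j) j | j <- enum 'I_d]).
Proof.
apply/allP => x _; apply/eqP; rewrite count_flatten -map_comp.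
rewrite sumnE big_map (bigD1_seq x) ?mem_enum ?enum_uniq //= big1 => [|j jx].
  by rewrite count_nseq /= eqxx mul1n ffunE addn0.
by rewrite count_nseq /= (negbTE jx).
Qed.

Lemma fact_prod_le (al : {ffun 'I_d -> nat}) :
  (\prod_(i < d) (al i)`! <= (\sum_(i < d) al i)`!)%N.
Proof.
elim: (index_enum _) => [|i s ih]; first by rewrite !big_nil.
rewrite !big_cons; apply: (leq_trans (leq_mul (leqnn _) ih)).
move: (\sum_(_ <- s) _)%N => n.
rewrite -[X in (_ <= X)%N](bin_fact (leq_addr n (al i))) addKn leq_pmull //.
by rewrite bin_gt0 leq_addr.
Qed.

(** A convergent sum bounds each of its terms, and the factorial of a
    multi-index is at most the factorial of its length. *)
Lemma omega_bd (r rho : R) (U : set V) (f : V -> V) : 0 < r -> 0 <= rho ->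
  in_Comega r rho U f -> exists2 A : R, 0 < A &
  forall j, bd (cball k d rho) r (fun x => f x 0 j) A 1.
Proof.
move=> r0 rho0 [oU BU sm om].
have sup0 g : (0 <= sup_norm rho g :> \bar R)%E.
  apply: (@le_trans _ _ (cabs (g 0))%:E); first by rewrite lee_fin.
  apply: ereal_sup_ubound; exists 0 => //=.
  by apply: (le_trans (enorm_nrm1 _)); rewrite nrm1_0.
have t0 (al : {ffun 'I_d -> nat}) j : (0 <= (r ^+ (\sum_(i < d) al i)%N / (\prod_(i < d) (al i)`!)%:R)%:E
     * sup_norm rho (mderiv al (fun x => f x 0%R j)))%E.
  by rewrite mule_ge0 // lee_fin divr_ge0 ?exprn_ge0 // ltW.
have om0 : (0 <= omega_norm r rho f)%E.
  by apply: sume_ge0 => j _; apply: esum_ge0 => al _; exact: t0.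
have omf : omega_norm r rho f \is a fin_num by rewrite ge0_fin_numE.
exists (fine (omega_norm r rho f) + 1); first by rewrite ltr_wpDl ?fine_ge0.
move=> j s x Bx; have Ux := BU _ Bx.
rewrite (dS_perm oU (sm j) (content_perm s) Ux) -mderiv_dS.
set al : {ffun 'I_d -> nat} := [ffun j => count_mem j s].
have sz : (\sum_(i < d) al i)%N = size s.
  rewrite (perm_size (content_perm s)) size_flatten /shape -map_comp sumnE big_map.
  rewrite big_enum /=; apply: eq_bigr => i _; by rewrite /= size_nseq.
have term : ((r ^+ (\sum_(i < d) al i)%N / (\prod_(i < d) (al i)`!)%:R)%:E
     * (cabs (mderiv al (fun x => f x 0%R j) x))%:E <= omega_norm r rho f)%E.
  apply: (@le_trans _ _ ((r ^+ (\sum_(i < d) al i)%N / (\prod_(i < d) (al i)`!)%:R)%:E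
     * sup_norm rho (mderiv al (fun x => f x 0%R j)))%E).
    apply: lee_wpmul2l; first by rewrite lee_fin divr_ge0 ?exprn_ge0 // ltW.
    by apply: ereal_sup_ubound; exists x.
  rewrite /omega_norm [leRHS](bigD1 j) //=; apply: (@le_trans _ _ (\esum_(al in [set: {ffun 'I_d -> nat}])
     ((r ^+ (\sum_(i < d) al i)%N / (\prod_(i < d) (al i)`!)%:R)%:E
     * sup_norm rho (mderiv al (fun x => f x 0%R j))))%E).
    apply: esum_ge; exists [set al]; first by split.
    by rewrite fsbig_set1.
  by rewrite leeDl //; apply: sume_ge0 => l _; apply: esum_ge0 => be _; exact: t0.
move: term; rewrite -(fineK omf) -EFinM lee_fin sz => term.
rewrite rise1; set c := cabs _ in term *.
set p := (\prod_(i < d) (al i)`!)%N in term *.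
have p0 : 0 < p%:R :> R.
  by rewrite ltr0n; apply: prodn_gt0 => i; exact: fact_gt0.
have rs : 0 < r ^+ size s by rewrite exprn_gt0.
rewrite ler_pdivlMr // mulrC.
apply: (@le_trans _ _ (fine (omega_norm r rho f) * p%:R)).
  by rewrite -ler_pdivrMr // mulrAC.
apply: ler_pM => //; [exact: fine_ge0|by rewrite lerDl|].
by rewrite ler_nat -sz; exact: fact_prod_le.
Qed.

End Omega.

(** * Geometric limits and the chain rule along curves *)

Section SeqLim.
Variable R : realType.

Lemma real_seq_lim (a : nat -> R) (A : R) :
  (forall n, `|a n.+1 - a n| <= A / 2 ^+ n) ->
  exists l, forall n, `|l - a n| <= 2 * A / 2 ^+ n.
Proof.
move=> h.
have h2 n : A / 2 ^+ n.+1 * 2 = A / 2 ^+ n.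
  by rewrite exprS invfM; move: ((2 ^+ n)^-1) => u; field.
pose b n := a n - 2 * A / 2 ^+ n; pose c n := a n + 2 * A / 2 ^+ n.
have e n : 2 * A / 2 ^+ n = 2 * (A / 2 ^+ n) by rewrite mulrA.
have bS n : b n <= b n.+1.
  have := h n; rewrite ler_norml /b !e => /andP[]; have := h2 n; lra.
have cS n : c n.+1 <= c n.
  have := h n; rewrite ler_norml /c !e => /andP[]; have := h2 n; lra.
have A0 n : 0 <= 2 * A / 2 ^+ n.
  by rewrite e mulr_ge0 //; exact: le_trans (h n).
have bm n m : b n <= b (n + m)%N.
  by elim: m => [|m ih]; rewrite ?addn0 // addnS (le_trans ih).
have cm n m : c (n + m)%N <= c n.
  by elim: m => [|m ih]; rewrite ?addn0 // addnS (le_trans _ ih).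
have bc n m : b n <= c m.
  apply: (le_trans (bm n m)); apply: (@le_trans _ _ (c (n + m)%N)).
    by rewrite /b /c; have := A0 (n + m)%N; lra.
  by rewrite addnC cm.
have ub : has_sup (range b).
  split; first by exists (b 0%N); exists 0%N.
  by exists (c 0%N) => _ [n _ <-].
exists (sup (range b)) => n; rewrite ler_distl; apply/andP; split.
  by rewrite -/(b n); apply: ub_le_sup; [exact: ub.2|exists n].
by rewrite -/(c n); apply: ge_sup; [exact: ub.1|move=> _ [m _ <-]].
Qed.

(** Completeness of K, obtained from that of the reals componentwise; hence
    the constant 4. *)
Lemma K_seq_lim (k : scalars) (a : nat -> K R k) (A : R) :
  (forall n, cabs (a n.+1 - a n) <= A / 2 ^+ n) ->
  exists l, forall n, cabs (l - a n) <= 4 * A / 2 ^+ n.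
Proof.
move=> h.
have [|lr hr] := @real_seq_lim (fun n => reK (a n)) A.
  by move=> n; rewrite -reKB; exact: le_trans (re_le _) (h n).
have [|li hi] := @real_seq_lim (fun n => imK (a n)) A.
  by move=> n; rewrite -imKB; exact: le_trans (im_le _) (h n).
have ip : k = RealScalars \/ exists z : K R k, reK z = lr /\ imK z = li.
  case: k {h hr hi a} => [|]; [by left|right].
  by exists (Complex lr li).
case: ip => [E|[z [zr zi]]]; last first.
  exists z => n; apply: (le_trans (cabs_le _)); rewrite reKB imKB zr zi.
  apply: (le_trans (lerD (hr n) (hi n))); rewrite -!mulrA -mulrDl.
  by rewrite le_eqVlt; apply/orP; left; apply/eqP; ring.
exists (ofR k lr) => n; apply: (le_trans (cabs_le _)); rewrite reKB imKB reK_ofR imK_ofR.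
have -> : imK (a n) = 0 by move: (a n); rewrite E.
rewrite subrr normr0 addr0; apply: (le_trans (hr n)).
have : 0 <= 2 * A / 2 ^+ n by exact: le_trans (hr n).
rewrite -!mulrA; move: (A / 2 ^+ n) => y; lra.
Qed.

End SeqLim.

Section Lip.
Variables (R : realType) (k : scalars) (d : nat).
Local Notation K := (K R k).
Local Notation V := 'rV[K]_d.
Variables (U : set V) (oU : open U) (p0 : V) (dl : R).
Local Notation Om := (fun x : V => nrm1 (x - p0) <= dl).
Hypothesis OmU : forall x, Om x -> U x.

Lemma Om_conv x y (s : R) : Om x -> Om y -> 0 <= s <= 1 ->
  Om (x + ofR k s *: (y - x)).
Proof.
move=> hx hy /andP[s0 s1].
have -> : x + ofR k s *: (y - x) - p0 = ofR k (1 - s) *: (x - p0) + ofR k s *: (y - p0).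
  by apply/rowP => j; rewrite !mxE rmorphB rmorph1; ring.
apply: (le_trans (nrm1D _ _)); rewrite !nrm1Z !cabs_ofR.
rewrite ger0_norm ?subr_ge0 // ger0_norm //.
have := ler_wpM2l s0 hy; have s1' : 0 <= 1 - s by lra.
have := ler_wpM2l s1' hx; lra.
Qed.

Lemma lipOm (phi : V -> K) (C : R) x y : 0 <= C -> smooth_on U phi ->
  (forall l z, Om z -> cabs (pderiv l phi z) <= C) -> Om x -> Om y ->
  cabs (phi y - phi x) <= C * nrm1 (y - x).
Proof.
move=> C0 sp hC hx hy.
have := @lip_seg _ _ _ phi x (y - x) (fun s l => pderiv l phi (x + ofR k s *: (y - x)))
  (fun=> 0) (C * nrm1 (y - x)) (mulr_ge0 C0 (nrm1_ge0 _)).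
rewrite subrKC big1 ?subr0 => [|l _]; last by rewrite mulr0.
apply => s s01; first by apply/diff_has_grad/(sp [::])/OmU/Om_conv.
apply: (le_trans (cabs_sum _ _ _)); rewrite /nrm1 mulr_sumr; apply: ler_sum => l _.
by rewrite subr0 cabsM mulrC ler_wpM2r // hC //; exact: Om_conv.
Qed.

Lemma quadOm (phi : V -> K) (C : R) x y : 0 <= C -> smooth_on U phi ->
  (forall l m z, Om z -> cabs (pderiv m (pderiv l phi) z) <= C) -> Om x -> Om y ->
  cabs (phi y - phi x - \sum_(l < d) (y - x) 0 l * pderiv l phi x) <= C * nrm1 (y - x) ^+ 2.
Proof.
move=> C0 sp hC hx hy.
have := @lip_seg _ _ _ phi x (y - x) (fun s l => pderiv l phi (x + ofR k s *: (y - x)))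
  (fun l => pderiv l phi x) (C * nrm1 (y - x) ^+ 2) (mulr_ge0 C0 (sqr_ge0 _)).
rewrite subrKC; apply => s s01; first by apply/diff_has_grad/(sp [::])/OmU/Om_conv.
apply: (le_trans (cabs_sum _ _ _)).
rewrite expr2 [C * _]mulrCA {1}/nrm1 mulr_suml; apply: ler_sum => l _.
rewrite cabsM ler_wpM2l //.
apply: (le_trans (lipOm C0 (smooth_pd l sp) (hC l) hx (Om_conv hx hy s01))).
rewrite addrC addKr nrm1Z cabs_ofR ler_wpM2l //.
by case/andP: s01 => s0 s1; rewrite ger0_norm // ler_piMl.
Qed.

Variable T : R.
Hypothesis T0 : 0 <= T.

Lemma lipW_meas (y : R -> K) (Vf vf : R -> R) (C : R) : 0 <= C ->
  AC (k := RealScalars) T Vf vf -> (forall x, 0 < x -> x < T -> 0 <= vf x) ->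
  (forall s t, 0 <= s -> s <= t -> t <= T -> cabs (y t - y s) <= C * (Vf t - Vf s)) ->
  measK `]0, T[ y.
Proof.
move=> C0 aV v0 h; have cV := ACR_cont T0 aV.
have sub : `]0, T[ `<=` `[0, T] by apply: subset_itv; rewrite bnd_simp.
have key (r : K -> R) : (forall z z', `|r z - r z'| <= cabs (z - z')) ->
    measurable_fun (`]0, T[ : set (measurableTypeR R)) (fun s => r (y s)).
  move=> hr.
  apply: (@measurable_funS _ _ (measurableTypeR R) R `[0, T]) => //.
  apply: subspace_continuous_measurable_fun => //.
  apply/subspace_continuousP => t tT.
  apply/cvgrPdist_lt => e e0.
  have e1 : 0 < e / (C + 1) by rewrite divr_gt0 // ltr_wpDl.
  have /subspace_continuousP/(_ t tT)/cvgrPdist_lt/(_ _ e1) := cV.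
  rewrite !near_withinE; apply: filterS => s hs sT; have {hs} := hs sT.
  have key2 a b : a \in `[0, T] -> b \in `[0, T] -> a <= b ->
      `|Vf b - Vf a| < e / (C + 1) -> cabs (y b - y a) < e.
    rewrite !in_itv /= => /andP[a0 aT] /andP[b0 bT] ab.
    have := h a b a0 ab bT => h1 h2; apply: (le_lt_trans h1).
    apply: (@le_lt_trans _ _ ((C + 1) * `|Vf b - Vf a|)).
      have := ler_norm (Vf b - Vf a); have := normr_ge0 (Vf b - Vf a).
      have := ler_wpM2l C0 (ler_norm (Vf b - Vf a)); lra.
    by rewrite mulrC -ltr_pdivlMr // ltr_wpDl.
  move=> hs; apply: (le_lt_trans (hr _ _)).
  have [ts|st] := leP t s.
    by rewrite cabsB; apply: key2 => //; rewrite distrC.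
  by apply: key2 => //; exact: ltW.
split; apply: key => z z'; rewrite -?reKB -?imKB; [exact: re_le|exact: im_le].
Qed.

End Lip.

Section Chain.
Variables (R : realType) (k : scalars) (d : nat).
Local Notation K := (K R k).
Local Notation V := 'rV[K]_d.
Local Notation mu := (@lebesgue_measure R).
Variables (U : set V) (oU : open U) (p0 : V) (dl : R).
Local Notation Om := (fun x : V => nrm1 (x - p0) <= dl).
Hypothesis OmU : forall x, Om x -> U x.
Variable T : R.
Hypothesis T0 : 0 <= T.
Variables (x : R -> V) (xd : 'I_d -> R -> K).
Hypothesis xOm : forall t, 0 <= t <= T -> Om (x t).
Hypothesis xAC : forall j, AC T (fun t => x t 0 j) (xd j).

Let vx (s : R) : R := \sum_(j < d) cabs (xd j s).
Let Vx (t : R) : R := \sum_(j < d) \int[mu]_(s in `]0, t[) cabs (xd j s).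

Lemma aVx : AC (k := RealScalars) T Vx vx.
Proof. by apply: AC_sum => j _; exact: AC_cabs (xAC j).1. Qed.

Lemma vx0 (s : R) : 0 <= vx s.
Proof. by apply: sumr_ge0 => j _; exact: cabs_ge0. Qed.

Lemma x_lip (s t : R) : 0 <= s -> s <= t -> t <= T -> nrm1 (x t - x s) <= Vx t - Vx s.
Proof.
move=> s0 st tT; rewrite /nrm1 /Vx -sumrB; apply: ler_sum => j _.
rewrite !mxE; exact: (AC_le (xAC j) (AC_cabs (xAC j).1) s0 st tT).
Qed.

Lemma comp_meas (phi : V -> K) (C : R) : 0 <= C -> smooth_on U phi ->
  (forall l z, Om z -> cabs (pderiv l phi z) <= C) -> measK `]0, T[ (fun t => phi (x t)).
Proof.
move=> C0 sp hC; apply: (lipW_meas T0 C0 aVx (fun s _ _ => vx0 s)) => s t s0 st tT.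
apply: (le_trans (lipOm OmU C0 sp hC (xOm _) (xOm _))).
- by rewrite s0 (le_trans st).
- by rewrite (le_trans s0).
- by rewrite ler_wpM2l // x_lip.
Qed.

(** Taylor's formula of order two bounds the error by the square of the
    increment of the curve, as AC_quad requires. *)
Lemma chain_rule (phi : V -> K) (A C : R) : 0 <= C -> smooth_on U phi ->
  (forall l z, Om z -> cabs (pderiv l phi z) <= A) ->
  (forall l m z, Om z -> cabs (pderiv m (pderiv l phi) z) <= C) ->
  AC T (fun t => phi (x t)) (fun t => \sum_(l < d) xd l t * pderiv l phi (x t)).
Proof.
move=> C0 sp hA hC.
have mp l : measK `]0, T[ (fun t => pderiv l phi (x t)).
  exact: (comp_meas C0 (smooth_pd l sp) (hC l)).
have in01 t : `]0, T[%classic t -> Om (x t).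
  by rewrite /= in_itv /= => /andP[/ltW t0 /ltW tT]; apply: xOm; rewrite t0.
have ip l : integrableK `]0, T[ (fun t => xd l t * pderiv l phi (x t)).
  by apply: (integrableKM (C := A)) (xAC l).1 (mp l) _ => // t /in01 h; exact: hA.
have ipc l (c : K) : integrableK `]0, T[ (fun t => xd l t * pderiv l phi (x t) + - c * xd l t).
  by apply: integrableKD => //; apply: integrableKZ => //; exact: (xAC l).1.
apply: (@AC_quad _ _ T (C + C) _ _ _ _ T0 aVx (fun s _ _ => vx0 s)).
  exact: integrableK_sum.
move=> s t s0 st tT; have sT := le_trans st tT; have t0 := le_trans s0 st.
have xs : Om (x s) by apply: xOm; rewrite s0.
have xt : Om (x t) by apply: xOm; rewrite t0.
have Vst : 0 <= Vx t - Vx s by exact: le_trans (nrm1_ge0 _) (x_lip s0 st tT).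
rewrite !integralK_sum //; try by move=> l _; exact: intK_sub0 (ip l).
pose D l := integralK `]0, t[ (fun r => xd l r * pderiv l phi (x r) + - pderiv l phi (x s) * xd l r)
  - integralK `]0, s[ (fun r => xd l r * pderiv l phi (x r) + - pderiv l phi (x s) * xd l r).
have dE l : D l = integralK `]0, t[ (fun r => xd l r * pderiv l phi (x r)) -
   integralK `]0, s[ (fun r => xd l r * pderiv l phi (x r)) - (x t - x s) 0 l * pderiv l phi (x s).
  have xl := (xAC l).1.
  have zl : integrableK `]0, T[ (fun r => - pderiv l phi (x s) * xd l r) by exact: integrableKZ.
  rewrite /D !mxE ((xAC l).2 t) ?t0 // ((xAC l).2 s) ?s0 //.
  rewrite !integralKD //; try exact: intK_sub0 (ip l); try exact: intK_sub0 zl.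
  rewrite !integralKZ //; try exact: intK_sub0 xl.
  by ring.
rewrite [X in cabs X](_ : _ = (phi (x t) - phi (x s) - \sum_(l < d) (x t - x s) 0 l * pderiv l phi (x s))
   - \sum_(l < d) D l); last first.
  rewrite (eq_bigr _ (fun l _ => dE l)) !sumrB.
  by move: (\sum_(_ < _) _) (\sum_(_ < _) _) (\sum_(_ < _) _) => a b c; ring.
apply: (le_trans (cabsD _ _)); rewrite cabsN mulrDl; apply: lerD.
  apply: (le_trans (quadOm OmU C0 sp hC xs xt)); rewrite ler_wpM2l //.
  by rewrite ler_pXn2r ?nnegrE // x_lip.
apply: (le_trans (cabs_sum _ _ _)).
apply: (@le_trans _ _ (\sum_(l < d) C * (Vx t - Vx s) *
  (\int[mu]_(r in `]0, t[) cabs (xd l r) - \int[mu]_(r in `]0, s[) cabs (xd l r)))); last first.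
  by rewrite -mulr_sumr sumrB -mulrA expr2.
apply: ler_sum => l _.
have := AC_le (AC_int (ipc l (pderiv l phi (x s))))
  (AC_Z (C * (Vx t - Vx s) : Defs.K R RealScalars) (AC_cabs (xAC l).1)) s0 st tT.
rewrite -/(D l) -mulrBr; apply => r sr rt.
rewrite mulrC mulNr -mulrBl cabsM ler_wpM2r //.
have xr : Om (x r) by apply: xOm; rewrite (le_trans s0 (ltW sr)) (le_trans (ltW rt)).
apply: (le_trans (lipOm OmU C0 (smooth_pd l sp) (hC l) xs xr)).
rewrite ler_wpM2l //; apply: (le_trans (x_lip s0 (ltW sr) (le_trans (ltW rt) tT))).
rewrite lerD2r; apply: (AC_mono aVx (fun s _ _ => vx0 s)) => //; last exact: ltW.
exact: le_trans s0 (ltW sr).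
Qed.

End Chain.

(** * Controlled systems: solutions and their Chen expansion *)

(** b (b + 2) (b + 4) ... with K factors: a Lie derivative along a field of
    exponent 1 raises the exponent of a Cauchy estimate by 2. *)
Fixpoint rise2 (b K : nat) : nat := if K is K'.+1 then (b * rise2 b.+2 K')%N else 1%N.

Lemma rise2_rise a b K : (b <= 2 * a)%N -> (rise2 b K <= 2 ^ K * rise a K)%N.
Proof.
elim: K a b => [|K ih] a b ab //=; rewrite expnS mulnACA leq_mul //.
by apply: ih; lia.
Qed.

Lemma rise2_1 K : (rise2 1 K <= 2 ^ K * K`!)%N.
Proof. by rewrite -(rise1 K); exact: rise2_rise. Qed.

Section Sys.
Variables (R : realType) (k : scalars) (d n : nat).
Local Notation K := (K R k).
Local Notation V := 'rV[K]_d.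
Local Notation mu := (@lebesgue_measure R).
Variables (U : set V) (oU : open U) (Bs : set V) (BU : Bs `<=` U) (p0 : V) (dl rho : R).
Local Notation Om := (fun x : V => nrm1 (x - p0) <= dl).
Hypothesis OmB : forall x, Om x -> Bs x.
Hypothesis rho0 : 0 < rho.
Variables (g : 'I_n -> V -> V) (G : 'I_n -> R).
Hypothesis sg : forall i, vsm U (g i).
Hypothesis G0 : forall i, 0 <= G i.
Hypothesis hG : forall i j, bd Bs rho (fun x => g i x 0 j) (G i) 1.
Variable T : R.
Hypothesis T0 : 0 <= T.
Variable v : 'I_n -> R -> K.
Hypothesis iv : forall i, integrableK `]0, T[ (v i).

Let OmU x : Om x -> U x. Proof. by move=> h; apply: BU; exact: OmB. Qed.

Definition wt (s : R) : R := \sum_(i < n) G i * cabs (v i s).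
(** The weighted L1 norm of the controls on (0,t): it bounds the displacement
    and every remainder. *)
Definition Wt (t : R) : R := \sum_(i < n) G i * \int[mu]_(s in `]0, t[) cabs (v i s).

Lemma aW : AC (k := RealScalars) T Wt wt.
Proof.
apply: AC_sum => i _.
exact: (AC_Z (G i : Defs.K R RealScalars) (AC_cabs (iv i))).
Qed.

Lemma wt0 (s : R) : 0 <= wt s.
Proof. by apply: sumr_ge0 => i _; apply: mulr_ge0. Qed.

Lemma Wt_0 : Wt 0 = 0.
Proof. by rewrite /Wt big1 // => i _; rewrite itv00 Rintegral_set0 mulr0. Qed.

Lemma Wt_mono (s t : R) : 0 <= s -> s <= t -> t <= T -> Wt s <= Wt t.
Proof. exact: (AC_mono aW (fun s _ _ => wt0 s)). Qed.

Lemma Wt_ge0 (t : R) : 0 <= t -> t <= T -> 0 <= Wt t.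
Proof. by move=> t0 tT; rewrite -Wt_0 Wt_mono. Qed.

Definition Fld (x : R -> V) (s : R) (j : 'I_d) : K := \sum_(i < n) v i s * g i (x s) 0 j.

(** Solutions that stay in the l1 ball of radius dl about p0, where the
    Cauchy estimates are available. *)
Definition sol (x : R -> V) (p : V) := [/\ x 0 = p,
  forall t, 0 <= t <= T -> Om (x t) &
  forall j, AC T (fun t => x t 0 j) (fun s => Fld x s j)].

Lemma gder i j l z : Om z -> cabs (pderiv l (fun x => g i x 0 j) z) <= G i / rho.
Proof.
by move=> hz; have := hG i j [:: l] (OmB hz); rewrite /= !muln1 mulr1 expr1.
Qed.

Lemma Fld_le x s j : Om (x s) -> cabs (Fld x s j) <= wt s.
Proof.
move=> h; apply: (le_trans (cabs_sum _ _ _)); apply: ler_sum => i _.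
by rewrite cabsM mulrC ler_wpM2r //; exact: bd0 (hG i j) (OmB h).
Qed.

Lemma Fld_int x j : (forall t, 0 <= t <= T -> Om (x t)) ->
  (forall i, measK `]0, T[ (fun s => g i (x s) 0 j)) ->
  integrableK `]0, T[ (fun s => Fld x s j).
Proof.
move=> hx mg; apply: integrableK_sum => // i _.
apply: (integrableKM (C := G i)) (iv i) (mg i) _ => // t.
rewrite /= in_itv /= => /andP[/ltW t0 /ltW tT].
by apply: bd0 (hG i j) _; apply/OmB/hx; rewrite t0.
Qed.

Lemma Fld_int_lip x j : (forall t, 0 <= t <= T -> Om (x t)) ->
  (forall s t, 0 <= s -> s <= t -> t <= T -> nrm1 (x t - x s) <= d%:R * (Wt t - Wt s)) ->
  integrableK `]0, T[ (fun s => Fld x s j).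
Proof.
move=> hx lx; apply: Fld_int => // i.
have Gr : 0 <= G i / rho by rewrite divr_ge0 // ltW.
apply: (@lipW_meas _ _ T T0 _ _ _ (G i / rho * d%:R) (mulr_ge0 Gr (ler0n _ _)) aW (fun s _ _ => wt0 s)).
move=> s t s0 st tT.
apply: (le_trans (lipOm OmU Gr (sg i j) (gder i j) (hx _ _) (hx _ _))).
- by rewrite s0 (le_trans st).
- by rewrite (le_trans s0).
- by rewrite -[leRHS]mulrA ler_wpM2l // lx.
Qed.

Lemma sol_lip x p : sol x p ->
  forall s t, 0 <= s -> s <= t -> t <= T -> nrm1 (x t - x s) <= d%:R * (Wt t - Wt s).
Proof.
move=> [_ hx ax] s t s0 st tT.
rewrite mulr_natl -[d in _ *+ d]card_ord -sumr_const; apply: ler_sum => j _.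
rewrite !mxE; apply: (AC_le (ax j) aW s0 st tT) => r sr rt; apply: Fld_le.
by apply: hx; rewrite (le_trans s0 (ltW sr)) (le_trans (ltW rt)).
Qed.

(** The chain rule along a solution; all further expansions iterate it. *)
Lemma sol_chain x p phi B b : 0 <= B -> sol x p -> smooth_on U phi ->
  bd Bs rho phi B b ->
  AC T (fun t => phi (x t)) (fun s => \sum_(i < n) v i s * Lop (g i) phi (x s)).
Proof.
move=> B0 [_ hx ax] sp hb.
have h1 l z : Om z -> cabs (pderiv l phi z) <= B * (b * 1)%:R / rho.
  by move=> /OmB/(hb [:: l]); rewrite /= expr1.
have h2 l m z : Om z -> cabs (pderiv m (pderiv l phi) z) <= B * (b * (b.+1 * 1))%:R / rho ^+ 2.
  by move=> /OmB/(hb [:: m; l]).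
have C0 : 0 <= B * (b * (b.+1 * 1))%:R / rho ^+ 2.
  by rewrite divr_ge0 ?mulr_ge0 ?exprn_ge0 // ltW.
apply: AC_eq (chain_rule OmU T0 hx ax C0 sp h1 h2) => // s _ _.
under eq_bigr do rewrite /Fld mulr_suml.
rewrite exchange_big /=; apply: eq_bigr => i _.
by rewrite /Lop mulr_sumr; apply: eq_bigr => j _; rewrite mulrA.
Qed.

(** The Chen expansion of phi along the system started at p, graded by the
    number of integrations. *)
Fixpoint chen (p : V) (m : nat) (phi : V -> K) : R -> K :=
  match m with
  | 0 => fun=> phi p
  | m'.+1 => fun t => integralK `]0, t[ (fun s => \sum_(i < n) v i s * chen p m' (Lop (g i) phi) s)
  end.

Definition chen_dens (p : V) (m : nat) (phi : V -> K) : R -> K :=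
  match m with
  | 0 => fun=> 0
  | m'.+1 => fun s => \sum_(i < n) v i s * chen p m' (Lop (g i) phi) s
  end.

Lemma chen_AC p m phi : AC T (chen p m phi) (chen_dens p m phi).
Proof.
elim: m phi => [|m ih] phi /=; first exact: AC_cst.
by apply: AC_int; apply: integrableK_sum => // i _; exact: (AC_mulint T0 (ih _) (iv i)).
Qed.

Lemma bd_Lopg i phi B b : 0 <= B -> smooth_on U phi -> bd Bs rho phi B b ->
  bd Bs rho (Lop (g i) phi) (d%:R * (G i * (B * b%:R / rho))) b.+2.
Proof. by move=> B0 sp hb; exact: (bd_Lop oU BU rho0 (sg i) sp (G0 i) B0 (hG i) hb). Qed.

(** One integration of the chain rule replaces phi by its Lie derivatives
    along the fields g i, with the exponent raised by two; the induction is on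
    the number of terms. *)
Lemma chen_rem x p : sol x p -> forall m phi B b, 0 <= B -> smooth_on U phi ->
  bd Bs rho phi B b -> forall t, 0 <= t <= T ->
  cabs (phi (x t) - \sum_(j < m) chen p j phi t) <=
  B * (rise2 b m)%:R * (d%:R / rho) ^+ m * (Wt t ^+ m / m`!%:R).
Proof.
move=> sx; elim=> [|m ih] phi B b B0 sp hb t tT.
  rewrite big_ord0 subr0 !expr0 fact0 divr1 !mulr1.
  by case: sx => _ hx _; exact: bd0 hb (OmB (hx t tT)).
have [x0 hx ax] := sx.
pose E s := phi (x s) - \sum_(j < m.+1) chen p j phi s.
have aE : AC T E (fun s => \sum_(i < n) v i s * (Lop (g i) phi (x s) -
    \sum_(j < m) chen p j (Lop (g i) phi) s)).
  have a1 := sol_chain B0 sx sp hb.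
  have a2 := AC_sum (index_enum 'I_m.+1) (P := xpredT) (fun j _ => chen_AC p j phi).
  apply: AC_eq (AC_D a1 (AC_Z (-1) a2)) => // s *; rewrite mulN1r //.
  rewrite big_ord_recl /= add0r exchange_big /= -sumrB; apply: eq_bigr => i _.
  by rewrite -mulr_sumr mulrBr.
have E0 : E 0 = 0.
  rewrite /E big_ord_recl /= x0 big1 ?addr0 ?subrr // => j _.
  by rewrite intK00.
pose c := B * (rise2 b m.+1)%:R * (d%:R / rho) ^+ m.+1.
have aV := AC_Z (c : Defs.K R RealScalars) (AC_dpow m T0 aW).
have /andP[t0 tT'] := tT.
have := AC_le aE aV (lexx 0) t0 tT' _; rewrite E0 subr0 Wt_0 expr0n mul0r mulr0 subr0.
apply=> s s0 st.
have sT : 0 <= s <= T by rewrite ltW //= (le_trans (ltW st)).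
apply: (le_trans (cabs_sum _ _ _)).
have -> : c * (Wt s ^+ m / m`!%:R * wt s) =
   \sum_(i < n) cabs (v i s) * (d%:R * (G i * (B * b%:R / rho)) * (rise2 b.+2 m)%:R *
     (d%:R / rho) ^+ m * (Wt s ^+ m / m`!%:R)).
  rewrite /wt !mulr_sumr; apply: eq_bigr => i _; rewrite /c /= natrM exprS.
  by move: (rho^-1) (_ ^+ m / _) ((_ / rho) ^+ m) => *; ring.
apply: ler_sum => i _; rewrite cabsM ler_wpM2l //.
apply: ih => //; last exact: bd_Lopg.
  by rewrite !mulr_ge0 // invr_ge0 ltW.
exact: smooth_Lop.
Qed.

Lemma sol_cont x p : sol x p -> {within `[0, T], continuous x}.
Proof.
move=> sx; have cW := ACR_cont T0 aW.
apply/subspace_continuousP => t tT; apply/cvgV_P => e e0.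
have e1 : 0 < e / (d%:R + 1) by rewrite divr_gt0 // ltr_wpDl.
have /subspace_continuousP/(_ t tT)/cvgrPdist_lt/(_ _ e1) := cW.
rewrite !near_withinE; apply: filterS => s hs sT; have {hs} := hs sT.
have key a b : a \in `[0, T] -> b \in `[0, T] -> a <= b ->
    `|Wt b - Wt a| < e / (d%:R + 1) -> nrm1 (x b - x a) < e.
  rewrite !in_itv /= => /andP[a0 aT] /andP[b0 bT] ab h2.
  apply: (le_lt_trans (sol_lip sx a0 ab bT)).
  apply: (@le_lt_trans _ _ ((d%:R + 1) * `|Wt b - Wt a|)).
    have := normr_ge0 (Wt b - Wt a).
    have := ler_wpM2l (ler0n R d) (ler_norm (Wt b - Wt a)); lra.
  by rewrite mulrC -ltr_pdivlMr // ltr_wpDl.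
have [ts|st] := leP t s; first by move=> h; apply: key => //; rewrite distrC.
by move=> h; rewrite nrm1B; apply: key => //; exact: ltW.
Qed.

(** Picard iterates. *)
Fixpoint pic (p : V) (m : nat) : R -> V :=
  match m with
  | 0 => fun=> p
  | m'.+1 => fun t => \row_j (p 0 j + integralK `]0, t[ (fun s => Fld (pic p m') s j))
  end.

Section Picard.
Variable p : V.
Hypothesis small1 : nrm1 (p - p0) + d%:R * Wt T <= dl.
Hypothesis small2 : d%:R * Wt T / rho <= 1 / 2.

Let WT0 : 0 <= Wt T. Proof. by apply: Wt_ge0. Qed.

Lemma pic_inv m : (forall t, 0 <= t <= T -> Om (pic p m t)) /\
  (forall s t, 0 <= s -> s <= t -> t <= T ->
     nrm1 (pic p m t - pic p m s) <= d%:R * (Wt t - Wt s)).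
Proof.
elim: m => [|m [hO hL]].
  split=> [t _ /=|s t s0 st tT]; first by have := mulr_ge0 (ler0n R d) WT0; move: small1; lra.
  by rewrite /= subrr nrm1_0 mulr_ge0 // subr_ge0 Wt_mono.
have L (s t : R) : 0 <= s -> s <= t -> t <= T ->
     nrm1 (pic p m.+1 t - pic p m.+1 s) <= d%:R * (Wt t - Wt s).
  move=> s0 st tT; rewrite mulr_natl -[d in _ *+ d]card_ord -sumr_const; apply: ler_sum => j _.
  rewrite !mxE opprD addrACA subrr add0r.
  apply: (AC_le (AC_int (Fld_int_lip j hO hL)) aW s0 st tT) => r sr rt; apply: Fld_le.
  by apply: hO; rewrite (le_trans s0 (ltW sr)) (le_trans (ltW rt)).
split=> // t /andP[t0 tT].
have p0E : pic p m.+1 0 = p by apply/rowP => j; rewrite /= mxE intK00 addr0.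
apply: (le_trans (nrm1_tri _ p _)); rewrite -{2}p0E addrC.
have := L 0 t (lexx _) t0 tT; rewrite Wt_0 subr0.
have := ler_wpM2l (ler0n R d) (Wt_mono t0 tT (lexx T)).
move: small1; lra.
Qed.

Lemma pic_cauchy m t : 0 <= t <= T ->
  nrm1 (pic p m.+1 t - pic p m t) <= d%:R * Wt T / 2 ^+ m.
Proof.
elim: m t => [|m ih] t /andP[t0 tT].
  have p0E : pic p 1 0 = p by apply/rowP => j; rewrite /= mxE intK00 addr0.
  have := (pic_inv 1).2 0 t (lexx _) t0 tT; rewrite p0E Wt_0 subr0 expr0 divr1.
  by move/le_trans; apply; rewrite ler_wpM2l // Wt_mono.
have [hO hL] := pic_inv m; have [hO' hL'] := pic_inv m.+1.
set A := d%:R * Wt T in ih *.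
have A0 : 0 <= A by rewrite mulr_ge0.
pose c : R := (A / 2 ^+ m) / rho.
have c0 : 0 <= c by rewrite !divr_ge0 ?exprn_ge0 // ltW.
have step j : cabs ((pic p m.+2 t - pic p m.+1 t) 0 j) <= c * Wt T.
  have i1 := Fld_int_lip j hO hL; have i2 := Fld_int_lip j hO' hL'.
  have aE := AC_D (AC_int i2) (AC_Z (-1) (AC_int i1)).
  have aV := AC_Z (c : Defs.K R RealScalars) aW.
  have := AC_le aE aV (lexx 0) t0 tT _.
  rewrite !intK00 mulr0 addr0 subr0 Wt_0 mulr0 subr0 mulN1r => h.
  rewrite mxE [pic p m.+2 t 0 j]mxE mxE [pic p m.+1 t 0 j]mxE opprD addrACA subrr add0r.
  apply: (@le_trans _ _ (c * Wt t)); last by rewrite ler_wpM2l // Wt_mono.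
  apply: h => s s0 st; rewrite mulN1r /Fld -sumrB /wt mulr_sumr.
  have sT : 0 <= s <= T by rewrite ltW //= (le_trans (ltW st)).
  apply: (le_trans (cabs_sum _ _ _)); apply: ler_sum => i _.
  rewrite -mulrBr cabsM mulrA mulrC ler_wpM2r //.
  have Gr : 0 <= G i / rho by rewrite divr_ge0 // ltW.
  apply: (le_trans (lipOm OmU Gr (sg i j) (gder i j) (hO s sT) (hO' s sT))).
  rewrite (_ : c * G i = G i / rho * (A / 2 ^+ m)); last by rewrite /c; ring.
  by rewrite ler_wpM2l // ih.
apply: (@le_trans _ _ (\sum_(j < d) c * Wt T)).
  by apply: ler_sum => j _; exact: step.
rewrite sumr_const card_ord -[_ *+ d]mulr_natl.
rewrite (_ : d%:R * (c * Wt T) = (A / 2 ^+ m) * (A / rho)); last by rewrite /c /A; ring.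
rewrite exprS invfM [2^-1 * _]mulrC [leRHS]mulrA ler_wpM2l ?divr_ge0 ?exprn_ge0 //.
by move: small2; rewrite div1r.
Qed.

Lemma sol_exists : exists x, sol x p.
Proof.
set A := d%:R * Wt T.
have A0 : 0 <= A by rewrite mulr_ge0.
have hl t j : exists l, 0 <= t <= T -> forall m, cabs (l - pic p m t 0 j) <= 4 * A / 2 ^+ m.
  have [tT|] := boolP (0 <= t <= T); last by exists 0.
  have [|l hl] := @K_seq_lim R k (fun m => pic p m t 0 j) A; last by exists l.
  move=> m; apply: le_trans (pic_cauchy m tT).
  by rewrite -[X in cabs X](_ : (pic p m.+1 t - pic p m t) 0 j = _) ?nrm1_coord // mxE [in X in _ + X]mxE.
pose x t : V := \row_j (projT1 (cid (hl t j))).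
have hx t m : 0 <= t <= T -> nrm1 (x t - pic p m t) <= d%:R * (4 * A) / 2 ^+ m.
  move=> tT; apply: (@le_trans _ _ (\sum_(j < d) 4 * A / 2 ^+ m)).
    apply: ler_sum => j _; rewrite !mxE; exact: (projT2 (cid (hl t j)) tT m).
  by rewrite sumr_const card_ord -[_ *+ d]mulr_natl !mulrA.
have hO t : 0 <= t <= T -> Om (x t).
  move=> tT; apply: (@le_geo _ _ _ (d%:R * (4 * A))) => m.
  apply: (le_trans (nrm1_tri _ (pic p m t) _)); rewrite addrC.
  by apply: lerD; [exact: (pic_inv m).1|exact: hx].
have hL s t : 0 <= s -> s <= t -> t <= T -> nrm1 (x t - x s) <= d%:R * (Wt t - Wt s).
  move=> s0 st tT; apply: (@le_geo _ _ _ (2 * (d%:R * (4 * A)))) => m.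
  apply: (le_trans (nrm1_tri _ (pic p m t) _)).
  apply: (le_trans (lerD (lexx _) (nrm1_tri _ (pic p m s) _))).
  have h1 := hx t m; have h2 := hx s m; have h3 := (pic_inv m).2 s t s0 st tT.
  rewrite (nrm1B _ (x s)).
  have tT' : 0 <= t <= T by rewrite (le_trans s0 st).
  have sT' : 0 <= s <= T by rewrite s0 (le_trans st tT).
  move: (h1 tT') (h2 sT') h3; rewrite -(mulrA 2); move: (_ / 2 ^+ m) => y; lra.
have x0E : x 0 = p.
  apply/rowP => j; apply: subr0_eq; apply: cabs_eq0; apply/le_anti; rewrite cabs_ge0 andbT.
  apply: (@le_geo _ _ _ (d%:R * (4 * A))) => m; rewrite add0r.
  have -> : p 0 j = pic p m 0 0 j.
    by case: m => [//|m]; rewrite /= mxE intK00 addr0.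
  apply: le_trans (hx 0 m _); last by rewrite lexx.
  by rewrite -[X in cabs X](_ : (x 0 - pic p m 0) 0 j = _) ?nrm1_coord // mxE [in X in _ + X]mxE.
exists x; split=> // j.
have ix := Fld_int_lip j hO hL.
split=> // t tT; rewrite x0E; have /andP[t0 tT'] := tT.
apply: subr0_eq; apply: cabs_eq0; apply/le_anti; rewrite cabs_ge0 andbT.
pose D := d%:R * (4 * A).
have D0 : 0 <= D by rewrite !mulr_ge0.
apply: (@le_geo _ _ _ (D + D * (Wt T / rho))) => m; rewrite add0r.
have [hOm hLm] := pic_inv m.
have im := Fld_int_lip j hOm hLm.
rewrite [X in cabs X](_ : _ = (x t - pic p m.+1 t) 0 j -
  (integralK `]0, t[ (fun s => Fld x s j) - integralK `]0, t[ (fun s => Fld (pic p m) s j))); last first.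
  by rewrite !mxE; ring.
apply: (le_trans (cabsD _ _)); rewrite cabsN mulrDl; apply: lerD.
  apply: (le_trans (nrm1_coord _ _)); apply: (le_trans (hx t m.+1 tT)).
  rewrite ler_wpM2l // lef_pV2 ?posrE ?exprn_gt0 // exprS.
  by rewrite ler_peMl ?exprn_ge0 // ler1n.
pose c := (D / 2 ^+ m) / rho.
have c0 : 0 <= c by rewrite !divr_ge0 ?exprn_ge0 // ltW.
have aE := AC_D (AC_int ix) (AC_Z (-1) (AC_int im)).
have aV := AC_Z (c : Defs.K R RealScalars) aW.
have := AC_le aE aV (lexx 0) t0 tT' _.
rewrite !intK00 mulr0 addr0 subr0 Wt_0 mulr0 subr0 mulN1r => h.
apply: (@le_trans _ _ (c * Wt T)); last by rewrite /c le_eqVlt; apply/orP; left; apply/eqP; ring.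
apply: (@le_trans _ _ (c * Wt t)); last by rewrite ler_wpM2l // Wt_mono.
apply: h => s s0 st; rewrite mulN1r /Fld -sumrB /wt mulr_sumr.
have sT : 0 <= s <= T by rewrite ltW //= (le_trans (ltW st)).
apply: (le_trans (cabs_sum _ _ _)); apply: ler_sum => i _.
rewrite -mulrBr cabsM mulrA mulrC ler_wpM2r //.
have Gr : 0 <= G i / rho by rewrite divr_ge0 // ltW.
apply: (le_trans (lipOm OmU Gr (sg i j) (gder i j) (hOm s sT) (hO s sT))).
rewrite (_ : c * G i = G i / rho * (D / 2 ^+ m)); last by rewrite /c; ring.
by rewrite ler_wpM2l // hx.
Qed.

End Picard.

Lemma cont_measK (x : R -> V) (phi : V -> K) : {within `[0, T], continuous x} ->
  (forall t, 0 <= t <= T -> U (x t)) -> smooth_on U phi ->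
  measK `]0, T[ (fun t => phi (x t)).
Proof.
move=> cx hU sp.
have sub : `]0, T[ `<=` `[0, T] by apply: subset_itv; rewrite bnd_simp.
have key (r : K -> R) : (forall z z', `|r z - r z'| <= cabs (z - z')) ->
    measurable_fun (`]0, T[ : set (measurableTypeR R)) (fun s => r (phi (x s))).
  move=> hr.
  apply: (@measurable_funS _ _ (measurableTypeR R) R `[0, T]) => //.
  apply: subspace_continuous_measurable_fun => //.
  apply/subspace_continuousP => t tT.
  apply/cvgrPdist_le => e e0.
  have Ut : U (x t) by apply: hU; move: tT; rewrite /= in_itv.
  have [e1 e10 h1] := has_grad_cont (diff_has_grad (sp [::] _ Ut)) e0.
  have /subspace_continuousP/(_ t tT)/cvgV_P/(_ _ e10) := cx.
  rewrite !near_withinE; apply: filterS => s hs sT; have {}hs := hs sT.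
  rewrite distrC; apply: (le_trans (hr _ _)).
  by have := h1 _ hs; rewrite subrKC.
split; apply: key => z z'; rewrite -?reKB -?imKB; [exact: re_le|exact: im_le].
Qed.

(** As long as the curve stays in the ball, its displacement is at most d
    times Wt; at the first exit time this contradicts the strict inequality in
    the hypothesis. *)
Lemma sol_given (x : R -> V) (p : V) : {within `[0, T], continuous x} ->
  (forall t, 0 <= t <= T -> U (x t)) ->
  (forall t, 0 <= t <= T -> forall j, x t 0 j = p 0 j + integralK `]0, t[ (fun s => Fld x s j)) ->
  nrm1 (p - p0) + d%:R * Wt T < dl -> sol x p.
Proof.
move=> cx hU hI sm.
have x0 : x 0 = p.
  by apply/rowP => j; rewrite hI ?lexx // intK00 addr0.
suff hO t : 0 <= t <= T -> Om (x t).
  split=> // j; split; last by move=> t tT; rewrite x0 hI.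
  by apply: Fld_int => // i; exact: (cont_measK (phi := fun y => g i y 0 j) cx hU (sg i j)).
move=> tT; rewrite leNgt; apply/negP => bad.
pose A := [set s : R | 0 <= s <= T /\ dl < nrm1 (x s - p0)].
have iA : has_inf A.
  by split; [exists t|exists 0 => s [/andP[]]].
pose a := inf A.
have a0 : 0 <= a by apply: lb_le_inf; [exact: iA.1|move=> s [/andP[]]].
have aT : a <= T.
  by apply: (le_trans (inf_lbound iA.2 (_ : A t))) => //; case/andP: tT.
have before s : 0 <= s -> s < a -> Om (x s).
  move=> s0 sa; rewrite leNgt; apply/negP => h.
  have : a <= s by apply: inf_lbound; [exact: iA.2|split=> //; rewrite s0 ltW // (lt_le_trans sa)].
  by rewrite leNgt sa.
have na : nrm1 (x a - p0) <= nrm1 (p - p0) + d%:R * Wt T.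
  apply: (le_trans (nrm1_tri _ p _)); rewrite addrC lerD2l.
  apply: (@le_trans _ _ (\sum_(j < d) Wt T)); last first.
    by rewrite sumr_const card_ord mulr_natl.
  apply: ler_sum => j _; rewrite !mxE hI ?a0 // addrC addKr.
  apply: le_trans (Wt_mono a0 aT (lexx T)).
  have iw := aW; have [iwT hw] := iw.
  have ia : integrableK `]0, a[ (fun s => Fld x s j).
    apply: integrableK_sum => // i _.
    apply: (integrableKM (C := G i)) => //.
    - exact: intK_sub0 (iv i).
    - have [m1 m2] := cont_measK (phi := fun y => g i y 0 j) cx hU (sg i j).
      have sub : `]0, a[ `<=` `]0, T[ by apply: subset_itvl; rewrite bnd_simp.
      by split; [apply: measurable_funS m1|apply: measurable_funS m2].
    - move=> s; rewrite /= in_itv /= => /andP[/ltW s0 sa].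
      by apply: bd0 (hG i j) _; apply/OmB/before.
  have := le_integralK (mblo a) ia (integrable_sub0 (lexx 0) aT iwT).
  have := hw a; rewrite a0 aT => /(_ isT); rewrite Wt_0 add0r /= => <-; apply=> s.
  by rewrite /= in_itv /= => /andP[/ltW s0 sa]; apply: Fld_le; exact: before.
have aI : a \in `[0, T] by rewrite in_itv /= a0.
have e0 : 0 < dl - nrm1 (x a - p0) by rewrite subr_gt0; exact: le_lt_trans na sm.
have /subspace_continuousP/(_ a aI)/cvgV_P/(_ _ e0) := cx.
rewrite near_withinE => /nbhs_ballP[e /= e1 he].
have [s [sT hs] sa] := inf_adherent e1 iA.
have as_ : a <= s by apply: inf_lbound; [exact: iA.2|].
have : nrm1 (x s - x a) < dl - nrm1 (x a - p0).
  apply: he; last by rewrite /= in_itv.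
  by rewrite /ball /= distrC ger0_norm ?subr_ge0 // ltrBlDl.
have := nrm1_tri (x s) (x a) p0; lra.
Qed.

End Sys.

(** * Derivatives almost everywhere *)

Section NullModification.
Context d (T : measurableType d) (R : realType).
Variable mu : {measure set T -> \bar R}.
Local Open Scope ereal_scope.
Import HBNNSimple.

(** The functions are not assumed measurable: xi is defined through
    time_deriv, which is only known almost everywhere. A simple function below f
    can be cut to the complement of N, where it is below g. *)
Lemma ge0_null_le (f g : T -> \bar R) (N : set T) : measurable N -> mu N = 0 ->
  (forall x, 0 <= f x) -> (forall x, 0 <= g x) ->
  (forall x, ~ N x -> f x = g x) -> \int[mu]_x f x <= \int[mu]_x g x.
Proof.
move=> mN N0 f0 g0 e; rewrite [leLHS]ge0_integralTE //.
apply: ge_ereal_sup => _ [h hf <-].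
have mC : measurable (~` N) by exact: measurableC.
pose h' := proj_nnsfun h mC.
have hE1 x : ~ N x -> h' x = h x.
  by move=> Nx; rewrite /= mindicE mem_set ?mulr1.
have hE0 x : N x -> h' x = 0%R.
  by move=> Nx; rewrite /= mindicE memNset ?mulr0 // => /(_ Nx).
have -> : sintegral mu h = sintegral mu h'.
  rewrite -!integralT_nnsfun; apply: ge0_ae_eq_integral => //.
  - by apply/measurable_EFinP; exact: measurable_funTS.
  - by apply/measurable_EFinP; exact: measurable_funTS.
  - by move=> x _; rewrite lee_fin.
  - by move=> x _; rewrite lee_fin.
  exists N; split=> // x xN; apply: contrapT => Nx; apply: xN => _.
  by congr EFin; rewrite hE1.
rewrite ge0_integralTE //; apply: ereal_sup_ubound; exists h' => // x.
have [Nx|Nx] := pselect (N x).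
  apply: le_trans (g0 x); rewrite le_eqVlt; apply/orP; left; apply/eqP.
  by congr EFin; exact: hE0.
rewrite -e //; apply: le_trans (hf x); rewrite le_eqVlt; apply/orP; left; apply/eqP.
by congr EFin; exact: hE1.
Qed.

Lemma null_integral (D : set T) (f g : T -> \bar R) (N : set T) : measurable N -> mu N = 0 ->
  (forall x, D x -> ~ N x -> f x = g x) ->
  \int[mu]_(x in D) f x = \int[mu]_(x in D) g x.
Proof.
move=> mN N0 e.
suff H (u v : T -> \bar R) : (forall x, ~ N x -> u x = v x) ->
    \int[mu]_x u x = \int[mu]_x v x.
  rewrite integral_mkcond [RHS]integral_mkcond; apply: H => x Nx.
  by rewrite !patchE; case: ifPn => //; rewrite inE => Dx; exact: e.
move=> {}e; rewrite integralE [RHS]integralE; congr (_ - _).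
  apply/eqP; rewrite eq_le; apply/andP.
  by split; apply: (@ge0_null_le _ _ N) => // x Nx; rewrite !funeposE e.
apply/eqP; rewrite eq_le; apply/andP.
by split; apply: (@ge0_null_le _ _ N) => // x Nx; rewrite !funenegE e.
Qed.

End NullModification.

Section TimeDeriv.
Variables (R : realType) (k : scalars).
Local Notation K := (K R k).
Local Notation mu := (@lebesgue_measure R).

Lemma null_integralK (D : set R) (h h' : R -> K) (N : set (measurableTypeR R)) :
  measurable N -> mu N = 0%E -> (forall x, D x -> ~ N x -> h x = h' x) ->
  integralK D h = integralK D h'.
Proof.
move=> mN N0 e; apply: eqK; rewrite ?reK_int ?imK_int; congr fine;
  by apply: (null_integral mN N0) => x Dx Nx; rewrite e.
Qed.

Lemma real_deriv_ae (f : R -> R) (T : R) : mu.-integrable `]0, T[ (EFin \o f) ->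
  exists N : set (measurableTypeR R), [/\ measurable N, mu N = 0%E &
    forall t, 0 < t -> t < T -> ~ N t -> forall e : R, 0 < e ->
    \forall s \near t^', `|(s - t)^-1 * (\int[mu]_(x in `]0, s[) f x - \int[mu]_(x in `]0, t[) f x) - f t| < e].
Proof.
move=> fi.
pose g := f \_ `]0, T[.
have gi : mu.-integrable setT (EFin \o g).
  by rewrite -restrict_EFin; apply/integrable_restrict => //=; rewrite setTI.
have lg : locally_integrable setT g.
  by apply: open_integrable_locally => //; exact: openT.
have [N [mN N0 hN]] := lebesgue_differentiation lg.
exists N; split=> // t t0 tT Nt e e0.
have lpt : lebesgue_pt g t by apply: contrapT => h; apply: Nt; apply: hN.
have giT : mu.-integrable `]0, T] (EFin \o g) by exact: integrableS gi.
have t0' : (BRight 0 < BRight t)%O by rewrite bnd_simp.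
have [dG GE] := @FTC1_lebesgue_pt R g (BRight 0) t T tT giT t0' lpt.
pose G y := \int[mu]_(x in `]0, y]) g x.
have cvG : h^-1 *: (G (h + t) - G t) @[h --> 0^'] --> g t.
  have cv0 : h^-1 *: ((G \o shift t) (h *: (1 : R)) - G t) @[h --> 0^'] --> 'D_1 G t := dG.
  move: GE; rewrite -/G derive1E => <-.
  by move: cv0; under eq_fun do rewrite /= [_ *: 1]mulr1.
have gt : g t = f t by rewrite /g patchE mem_set //= in_itv /= t0.
have GI y : y <= T -> G y = \int[mu]_(x in `]0, y[) f x.
  move=> yT; rewrite /G -Rintegral_itv_bndo_bndc; last exact: integrableS gi.
  apply: eq_Rintegral => x; rewrite inE /= in_itv /= => /andP[x0 xy].
  by rewrite /g patchE mem_set //= in_itv /= x0 (lt_le_trans xy).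
move/cvgrPdist_lt : cvG => /(_ _ e0); rewrite !near_withinE => /nbhs_ballP[r /= r0 hr].
apply/nbhs_ballP; exists (Num.min r (T - t)); first by rewrite /= lt_min r0 subr_gt0.
move=> s; rewrite /ball /= lt_min => /andP[sr sT] st.
have := hr (s - t); rewrite /ball /= sub0r normrN distrC => /(_ sr).
rewrite subr_eq0 => /(_ st); rewrite subrK gt distrC !GI //; first exact: ltW.
have := ler_norm (s - t); rewrite distrC in sT; lra.
Qed.

(** The Lebesgue differentiation theorem, applied to both components of the
    density. *)
Lemma time_deriv_ae (T : R) (F phi : R -> K) : AC T F phi ->
  exists N : set (measurableTypeR R), [/\ measurable N, mu N = 0%E &
    forall t, 0 < t -> t < T -> ~ N t -> time_deriv F t = phi t].
Proof.
move=> [/integrableKP[r1 i1] hF].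
have [N1 [m1 n1 h1]] := real_deriv_ae r1; have [N2 [m2 n2 h2]] := real_deriv_ae i1.
exists (N1 `|` N2); split; first exact: measurableU.
  have : (mu (N1 `|` N2) <= mu N1 + mu N2)%E by exact: measureU2.
  by rewrite n1 n2 adde0 => h; apply/eqP; rewrite eq_le h measure_ge0.
move=> t t0 tT nN; rewrite /time_deriv; apply: cvg_lim; first exact: norm_hausdorff.
apply/cvgK_P => e e0; have e2 : 0 < e / 2 by lra.
have b1 := h1 t t0 tT (fun h => nN (or_introl h)) _ e2.
have b2 := h2 t t0 tT (fun h => nN (or_intror h)) _ e2.
have near0 : \forall s \near t^', 0 <= s <= T.
  rewrite near_withinE; apply/nbhs_ballP; exists (Num.min t (T - t)).
    by rewrite /= lt_min t0 subr_gt0.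
  move=> s; rewrite /ball /= lt_min => /andP[st sT] _.
  have := ler_norm (t - s); have := ler_norm (s - t); rewrite distrC in sT.
  move=> h3 h4; apply/andP; split; lra.
apply: filterS3 b1 b2 near0 => s a1 a2 sT.
have tT' : 0 <= t <= T by rewrite !ltW.
rewrite (hF s sT) (hF t tT') opprD addrACA subrr add0r.
apply: (le_lt_trans (cabs_le _)).
rewrite reKB imKB reKM imKM reK_ofR imK_ofR !mul0r subr0 addr0 reKB imKB !reK_int !imK_int.
by rewrite (splitr e); exact: ltrD.
Qed.

End TimeDeriv.

(** * Coordinates of the second kind *)

Section Brackets.
Variable q : nat.
Implicit Types a b c : br q.

(** With core: the decomposition c = ad_a^m (core a c) where m = cnt a c is
    maximal. *)
Fixpoint cnt a c : nat :=
  if c is Pair c1 c2 then (if c1 == a then (cnt a c2).+1 else 0%N) else 0%N.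

Fixpoint core a c : br q :=
  if c is Pair c1 c2 then (if c1 == a then core a c2 else c) else c.

Lemma len_core a c : (len (core a c) <= len c)%N.
Proof.
elim: c => [i|c1 _ c2 ih] //=; case: ifP => //= _.
exact: leq_trans ih (leq_addl _ _).
Qed.

Definition headed a b : bool := if b is Pair b1 _ then b1 == a else false.

Lemma headed_core a c : headed a (core a c) = false.
Proof. by elim: c => [i|c1 _ c2 ih] //=; case: ifP. Qed.

Lemma cnt_headed a c : headed a c = false -> cnt a c = 0%N /\ core a c = c.
Proof. by case: c => [i|c1 c2] //= ->. Qed.

Lemma iter_core a c : iter (cnt a c) (Pair a) (core a c) = c.
Proof. by elim: c => [i|c1 _ c2 ih] //=; case: ifP => //= /eqP ->; rewrite ih. Qed.

Fixpoint nocc0 b : nat := if b is Pair a c then (nocc0 a + nocc0 c)%N else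
  if b is Gen i then (i == ord0 : nat) else 0%N.

Lemma nocc0_nocc b : (nocc0 b + nocc b = len b)%N.
Proof.
elim: b => [i|b1 h1 b2 h2] /=; first by case: eqP.
by rewrite addnACA h1 h2.
Qed.

Fixpoint rleaf b : 'I_q.+1 := match b with Gen i => i | Pair _ c => rleaf c end.
(** The rightmost leaf of b carries the control against which xi_b is
    integrated. The occurrences in the rest of the tree (occ0_left for X_0,
    occ_left for the other letters) govern the density. *)
Fixpoint occ0_left b : nat := if b is Pair a c then (nocc0 a + occ0_left c)%N else 0%N.
Fixpoint occ_left b : nat := if b is Pair a c then (nocc a + occ_left c)%N else 0%N.

Lemma nocc0_left b : nocc0 b = (occ0_left b + (rleaf b == ord0))%N.
Proof. by elim: b => [i|a _ c ih] //=; rewrite ih addnA. Qed.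
Lemma nocc_left b : nocc b = (occ_left b + (rleaf b != ord0))%N.
Proof. by elim: b => [i|a _ c ih] //=; rewrite ih addnA. Qed.

End Brackets.

Section Time.
Variables (R : realType) (k : scalars).
Local Notation mu := (@lebesgue_measure R).

Lemma Rint1 (t : R) : 0 <= t -> \int[mu]_(s in `]0, t[) (1 : R) = t.
Proof.
move=> t0; have m : mu `]0, t[%classic = t%:E.
  rewrite lebesgue_measure_itv /= lte_fin; case: ltgtP t0 => // [_ _|<- _] //.
  by rewrite -EFinB subr0.
transitivity (1 * fine (mu `]0, t[%classic)); last by rewrite m mul1r.
by apply: Rintegral_cst.
Qed.

Lemma AC_time (T : R) : AC T (ofR k) (fun=> 1).
Proof.
split.
  apply/integrableKP; rewrite -(rmorph1 (@ofR R k)) reK_ofR imK_ofR; split; last exact: integrable0.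
  apply: measurable_bounded_integrable => //.
    by have := @lebesgue_measure_itv R `]0, T[ => /= ->; case: ifP => _; rewrite ?ltry // -EFinB ltry.
  by exists 1; split=> // x x1 y _; rewrite normr1 ltW.
move=> t /andP[t0 _]; rewrite rmorph0 add0r.
apply: eqK; rewrite ?reK_int ?imK_int ?reK_ofR ?imK_ofR -(rmorph1 (@ofR R k)) ?reK_ofR ?imK_ofR.
  by rewrite Rint1.
by rewrite /Rintegral integral0.
Qed.

End Time.

Section Xi.
Variables (R : realType) (k : scalars) (q : nat).
Local Notation K := (K R k).
Local Notation mu := (@lebesgue_measure R).
Variable u : 'I_q -> R -> K.

Definition ctrl (i : 'I_q.+1) : R -> K :=
  if unlift ord0 i is Some j then u j else fun=> 1.

(** The density of xi_b. The divided power 1 / m! of a block ad_a^m is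
    produced one factor at a time, which avoids the maximal decomposition in the
    definition of xi. *)
Fixpoint xi_dens (b : br q) : R -> K :=
  match b with
  | Gen i => ctrl i
  | Pair a c => fun s => (cnt a c).+1%:R^-1 * xi u a s * xi_dens c s
  end.

(** The inner fixpoint in the definition of xi computes the decomposition
    given by cnt and core. *)
Lemma xi_pairE a c : xi u (Pair a c) = fun t => ((cnt a c).+1`!%:R)^-1 *
  integralK `]0, t[ (fun s => xi u a s ^+ (cnt a c).+1 * time_deriv (xi u (core a c)) s).
Proof.
rewrite /= -[(cnt a c).+1]add1n; move: 1%N => m.
elim: c m => [i|c1 _ c2 ih] m; first by rewrite /= addn0.
rewrite [cnt _ _]/= [core _ _]/=; case: ifP => [_|e]; last by rewrite addn0.
by rewrite ih addSnnS.
Qed.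

Lemma xi_dens_pair a c : xi_dens (Pair a c) = fun s => (cnt a c).+1%:R^-1 * xi u a s * xi_dens c s.
Proof. by []. Qed.

Lemma xi_dens_core a c s : xi_dens (Pair a c) s =
  xi u a s ^+ (cnt a c).+1 / ((cnt a c).+1`!%:R) * xi_dens (core a c) s.
Proof.
elim: c => [i|c1 _ c2 ih]; first by rewrite /= invr1 mul1r expr1 mulr1.
case e : (c1 == a).
  have cE : cnt a (Pair c1 c2) = (cnt a c2).+1 by rewrite /= e.
  have kE : core a (Pair c1 c2) = core a c2 by rewrite /= e.
  rewrite xi_dens_pair cE kE (eqP e) ih (exprS _ (cnt a c2).+1) (factS (cnt a c2).+1) natrM invfM.
  by move: ((cnt a c2).+2%:R^-1) ((cnt a c2).+1`!%:R^-1) (_ ^+ _) => x y z; ring.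
have cE : cnt a (Pair c1 c2) = 0%N by rewrite /= e.
have kE : core a (Pair c1 c2) = Pair c1 c2 by rewrite /= e.
rewrite xi_dens_pair cE kE; move: (xi_dens _ s) (xi u a s) => y z.
by rewrite /= invr1 mul1r expr1 mulr1.
Qed.

Variable T : R.
Hypothesis T0 : 0 <= T.
Hypothesis iu : forall j, integrableK `]0, T[ (u j).

(** The time derivative in the definition of xi equals the density almost
    everywhere, so the integrals agree. *)
Lemma xi_AC b : AC T (xi u b) (xi_dens b).
Proof.
have [n] := ubnP (len b); elim: n b => [//|n ih] [i|a c]; rewrite ltnS => bn.
  rewrite /= /ctrl; case: (unlift ord0 i) => [j|]; last exact: (AC_time k T).
  exact: AC_int (iu j).
have la : (len a < n)%N by move: bn; rewrite /=; have := len_gt0 c; lia.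
have lc : (len (core a c) < n)%N.
  by apply: leq_ltn_trans (len_core a c) _; move: bn; rewrite /=; have := len_gt0 a; lia.
have aA := ih a la; have aC := ih _ lc.
set m := cnt a c.
have aD := AC_dpow m T0 aA.
have ic : integrableK `]0, T[ (fun s => xi_dens (core a c) s * (xi u a s ^+ m.+1 / m.+1`!%:R)).
  exact: AC_mulint T0 aD aC.1.
have ix : integrableK `]0, T[ (xi_dens (Pair a c)).
  by apply: eq_integrableK ic => // s _; rewrite xi_dens_core mulrC.
have [N [mN N0 hN]] := time_deriv_ae aC.
apply: AC_eq (AC_int ix) => // t /andP[t0 tT].
rewrite xi_pairE -/m.
have ip : integrableK `]0, t[ (fun s => xi u a s ^+ m.+1 * xi_dens (core a c) s).
  have := integrableKZ (m.+1`!%:R) (mblo T) ic; move=> /(intK_sub0 tT).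
  apply: eq_integrableK => // s _.
  rewrite mulrCA [_ * (_ / _)]mulrC divfK; last by rewrite pnatr_eq0 -lt0n fact_gt0.
  by rewrite mulrC.
transitivity (m.+1`!%:R^-1 * integralK `]0, t[ (fun s => xi u a s ^+ m.+1 * xi_dens (core a c) s)).
  rewrite -integralKZ //; apply: eq_integralK => s _; rewrite xi_dens_core -/m.
  by rewrite mulrA [m.+1`!%:R^-1 * _]mulrC.
congr (_ * _); apply: (null_integralK mN N0) => s; rewrite /= in_itv /= => /andP[s0 st] Ns.
by rewrite hN // (lt_le_trans st).
Qed.

Lemma xi0 b : xi u b 0 = 0.
Proof.
case: b => [i|a c]; last by rewrite xi_pairE intK00 mulr0.
by rewrite /=; case: (unlift ord0 i) => [j|]; rewrite ?intK00 ?rmorph0.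
Qed.

Variables (B : set (br q)) (le : rel (br q)).
Hypothesis hB : hall_set B le.

Lemma slt_irr a : slt le a a = false.
Proof. by rewrite /slt eqxx. Qed.

Lemma slt_trans a b c : B a -> B b -> B c -> slt le a b -> slt le b c -> slt le a c.
Proof.
move=> Ba Bb coord_bound /andP[ab lab] /andP[bc lbc]; apply/andP; split.
  apply/eqP => e; move: ab; rewrite e in lab *.
  by rewrite (hall_anti hB coord_bound Bb lab lbc) eqxx.
exact: (hall_trans hB Ba Bb coord_bound).
Qed.

Lemma slt_asym a b : B a -> B b -> slt le a b -> slt le b a -> False.
Proof. by move=> Ba Bb h1 h2; have := slt_trans Ba Bb Ba h1 h2; rewrite slt_irr. Qed.

Lemma hall_pairP a c : B (Pair a c) -> [/\ B a, B c, slt le a c & slt le a (Pair a c)].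
Proof.
by move=> h; have /(hall_pair hB)[Ba coord_bound ac _] := h; split=> //; exact: (hall_lt hB).
Qed.

(** By induction, both factors of a bracket without control letter would be
    X_0, which is not strictly below itself. *)
Lemma hall_nocc0 b : B b -> nocc b = 0%N -> b = Gen ord0.
Proof.
elim: b => [i _|b1 h1 b2 h2] /=; first by case: eqP => // ->.
move=> Bb /eqP; rewrite addn_eq0 => /andP[/eqP n1' /eqP n2'].
have [B1 B2 lt12 _] := hall_pairP Bb.
by move: lt12; rewrite (h1 B1 n1') (h2 B2 n2') slt_irr.
Qed.

Lemma hall_nocc_gt0 b : B b -> b <> Gen ord0 -> (0 < nocc b)%N.
Proof. by move=> Bb b0; rewrite lt0n; apply/eqP => /(hall_nocc0 Bb). Qed.

Lemma hall_core a c : B c -> B (core a c).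
Proof.
elim: c => [i|c1 _ c2 ih] //= coord_bound; case: ifP => // _; apply: ih.
by have [] := hall_pairP coord_bound.
Qed.

Variable Ub : R.
Hypothesis hU : forall j, \int[mu]_(s in `]0, T[) cabs (u j s) <= Ub.

Let Ub0 (j : 'I_q) : 0 <= Ub.
Proof. by apply: le_trans (hU j); apply: Rintegral_ge0 => x _. Qed.

(** The number of multiplications of divided powers charged to each letter.
    Every such multiplication costs a binomial coefficient, hence a power of 2;
    it must remain bounded for fixed nocc b, or the total cost would not be
    geometric in the length. *)
Definition kap (b : br q) : nat := (2 * nocc b + headed (Gen ord0) b)%N.

Local Notation dp n s := (s ^+ n / n`!%:R).

Lemma dp_mul (s : R) m n : 0 <= s -> dp m s * dp n s <= 2 ^+ (m + n) * dp (m + n) s.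
Proof.
move=> s0.
have -> : dp m s * dp n s = 'C(m + n, m)%:R * dp (m + n) s.
  have := bin_fact (leq_addr n m); rewrite addKn => /(congr1 (fun x => x%:R : R)).
  rewrite !natrM exprD => <-.
  have f1 : m`!%:R != 0 :> R by rewrite pnatr_eq0 -lt0n fact_gt0.
  have f2 : n`!%:R != 0 :> R by rewrite pnatr_eq0 -lt0n fact_gt0.
  have f3 : 'C(m + n, m)%:R != 0 :> R by rewrite pnatr_eq0 -lt0n bin_gt0 leq_addr.
  move: (m`!%:R) (n`!%:R) ('C(_, _)%:R) f1 f2 f3 => x y z *; field.
  by apply/and3P.
rewrite ler_wpM2r ?divr_ge0 ?exprn_ge0 // -natrX ler_nat; exact: bin_le2.
Qed.

Lemma dp_ge0 (s : R) n : 0 <= s -> 0 <= dp n s.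
Proof. by move=> s0; rewrite divr_ge0 ?exprn_ge0. Qed.

Definition xi_dens_ok b := forall s : R, 0 < s -> s < T ->
  cabs (xi_dens b s) <= 2 ^+ (kap b * len b) * dp (occ0_left b) s * Ub ^+ occ_left b * cabs (ctrl (rleaf b) s).

Definition xi_ok b := forall t : R, 0 <= t -> t <= T ->
  cabs (xi u b t) <= 2 ^+ (kap b * len b) * dp (nocc0 b) t * Ub ^+ nocc b.

Lemma xi_of_dens b : (0 < q)%N -> xi_dens_ok b -> xi_ok b.
Proof.
move=> q0 h t t0 tT; have U0 := Ub0 (Ordinal q0).
have aX := xi_AC b.
pose C := 2 ^+ (kap b * len b) : R.
have C0 : 0 <= C by rewrite exprn_ge0.
have X0 : xi u b t = xi u b t - xi u b 0 by rewrite xi0 subr0.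
have := h; rewrite /xi_dens_ok nocc0_left nocc_left /ctrl -/C.
case: unliftP => [j ->|->] {}h; rewrite ?eqxx ?(negbTE (neq_lift _ _)) 1?eq_sym ?(negbTE (neq_lift _ _)) ?addn0 ?addn1.
  have U1 := hU j.
  have ic : integrableK `]0, t[ (u j) by exact: intK_sub0 (iu j).
  pose D := C * dp (occ0_left b) t * Ub ^+ occ_left b.
  have D0 : 0 <= D by rewrite !mulr_ge0 ?exprn_ge0 ?dp_ge0 // invr_ge0.
  have aV := AC_Z (D : Defs.K R RealScalars) (AC_cabs (iu j)).
  have := AC_le aX aV (lexx 0) t0 tT _; rewrite xi0 !subr0 itv00 Rintegral_set0 mulr0 subr0.
  move=> key; apply: (@le_trans _ _ (D * \int[mu]_(s in `]0, t[) cabs (u j s))).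
    apply: key => s s0 st; apply: (le_trans (h s s0 (lt_le_trans st tT))).
    rewrite ler_wpM2r // /D ler_wpM2r ?exprn_ge0 // ler_wpM2l // ler_wpM2r ?invr_ge0 //.
    by rewrite lerXn2r ?nnegrE // ltW.
  rewrite exprS mulrCA -/D mulrC; apply: ler_wpM2r => //; apply: le_trans U1.
  exact: (AC_mono (AC_cabs (iu j)) (fun x _ _ => cabs_ge0 _) t0 tT (lexx _)).
pose D := C * Ub ^+ occ_left b.
have D0 : 0 <= D by rewrite mulr_ge0 ?exprn_ge0.
have aV := AC_Z (D : Defs.K R RealScalars) (AC_dpow (occ0_left b) T0 (AC_time RealScalars T)).
have := AC_le aX aV (lexx 0) t0 tT _; rewrite xi0 !subr0 expr0n mul0r mulr0 subr0.
move=> key; apply: (@le_trans _ _ (D * dp (occ0_left b).+1 t)); last first.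
  by rewrite /D mulrAC.
apply: key => s s0 st; apply: (le_trans (h s s0 (lt_le_trans st tT))).
by rewrite cabs1 !mulr1 /D mulrAC.
Qed.

(** In a Hall set b1 < (b1, b2), so an element headed by X_0 lies above X_0. *)
Lemma headed_lt_X0 a : B a -> slt le a (Gen ord0) -> headed (Gen ord0) a = false.
Proof.
case: a => [//|a1 a2] Ba lt; apply/negbTE/negP => /eqP e.
have [_ _ _ lt2] := hall_pairP Ba; rewrite e in Ba lt lt2.
exact: (slt_asym (hall_gen hB ord0) Ba lt2 lt).
Qed.

Lemma xi_X0 s : xi u (Gen ord0) s = ofR k s.
Proof. by rewrite /= unlift_none. Qed.

(** A block of left factors X_0 is absorbed in one divided power. In any
    other bracket (a, c) with c different from X_0, both factors contain a
    control letter, so each of them has at most nocc b - 1 of them and the charge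
    kap increases in time to pay for the product. If c is X_0 then a is not
    headed by X_0, by headed_lt_X0. *)
Lemma xi_dens_bound (q0 : (0 < q)%N) b : B b -> xi_dens_ok b.
Proof.
have U0 := Ub0 (Ordinal q0).
have [n] := ubnP (len b); elim: n b => [//|n ih] [i _ _ s s0 sT|a c].
  rewrite [xi_dens _ _]/= [rleaf _]/= [occ0_left _]/= [occ_left _]/= expr0 fact0 divr1 !mulr1.
  by rewrite ler_peMl // exprn_ege1 // ler1n.
rewrite ltnS => bn Bb s s0 sT; have s0' := ltW s0; have sT' := ltW sT.
have [Ba coord_bound ac alt] := hall_pairP Bb.
have la : (len a < n)%N by move: bn; rewrite /=; have := len_gt0 c; lia.
have lc : (len c < n)%N by move: bn; rewrite /=; have := len_gt0 a; lia.
have [aX0|aX0] := eqVneq a (Gen ord0).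
  (* c is a block ad_{X_0}^m applied to c', which does not start with X_0: the whole
     block is absorbed by a single divided power of s, at the cost of one power of 2 *)
  have cX : c <> Gen ord0 by move=> e; move: ac; rewrite aX0 e slt_irr.
  rewrite xi_dens_core cabsM; set m := cnt a c; set c' := core a c.
  have Bc' : B c' by exact: hall_core.
  have lc' : (len c' < n)%N by apply: leq_ltn_trans lc; exact: len_core.
  have hc' := ih c' lc' Bc' s s0 sT.
  have cE : c = iter m (Pair a) c' by rewrite iter_core.
  have E1 : occ0_left (Pair a c) = (m.+1 + occ0_left c')%N.
    rewrite cE -iterS aX0; elim: (m.+1) => //= l ->; rewrite ?addSn //.
  have E2 : occ_left (Pair a c) = occ_left c'.
    by rewrite cE -iterS aX0; elim: (m.+1).
  have E3 : len (Pair a c) = (m.+1 + len c')%N.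
    by rewrite cE -iterS aX0; elim: (m.+1) => //= l ->; rewrite addSn.
  have E4 : nocc (Pair a c) = nocc c'.
    by rewrite cE -iterS aX0; elim: (m.+1).
  have E5 : rleaf (Pair a c) = rleaf c'.
    by rewrite cE -iterS aX0; elim: (m.+1).
  have E6 : headed (Gen ord0) (Pair a c) by rewrite /= aX0 eqxx.
  have E7 : kap c' = (2 * nocc c')%N by rewrite /kap /c' aX0 headed_core addn0.
  rewrite /kap E1 E2 E3 E4 E5 E6.
  have -> : cabs (xi u a s ^+ m.+1 / m.+1`!%:R) = dp m.+1 s.
    by rewrite cabsM cabsX cabs_natV aX0 xi_X0 cabs_ofR ger0_norm.
  apply: (le_trans (ler_wpM2l (dp_ge0 _ s0') hc')).
  rewrite E7 [leLHS](_ : _ = 2 ^+ (2 * nocc c' * len c') * (dp m.+1 s * dp (occ0_left c') s)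
    * Ub ^+ occ_left c' * cabs (ctrl (rleaf c') s)); last first.
    by move: (dp _ s) (dp _ s) => x y; ring.
  rewrite ler_wpM2r // ler_wpM2r ?exprn_ge0 //.
  apply: (le_trans (ler_wpM2l (exprn_ge0 _ (ler0n R 2)) (dp_mul _ _ s0'))).
  rewrite [2 ^+ _ * (2 ^+ _ * _)]mulrA -exprD ler_wpM2r ?dp_ge0 // ler_weXn2l ?ler1n //.
  have el : (occ0_left c' <= len c')%N by move: (nocc0_left c') (nocc0_nocc c'); clear; lia.
  rewrite mulnDl mul1n mulnDr; move: (_ * len c')%N (_ * m.+1)%N => x y; move: el; clear; lia.
have hc := ih c lc coord_bound s s0 sT.
have ha := xi_of_dens q0 (ih a la Ba) s0' sT'.
have aN := hall_nocc_gt0 Ba (elimN eqP aX0).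
have hdb : headed (Gen ord0) (Pair a c) = false by rewrite /= (negbTE aX0).
rewrite xi_dens_pair !cabsM cabs_natV.
have [cX|cX] := pselect (c = Gen ord0).
  have hda : headed (Gen ord0) a = false by apply: headed_lt_X0; rewrite -?cX.
  rewrite cX /= invr1 mul1r (_ : ctrl ord0 s = 1) ?cabs1 ?mulr1 ?addn0; last by rewrite /ctrl unlift_none.
  apply: (le_trans ha); rewrite ler_wpM2r ?exprn_ge0 // ler_wpM2r ?dp_ge0 //.
  by rewrite ler_weXn2l ?ler1n // /kap hda /= (negbTE aX0) !addn0 leq_mul // leq_addr.
have cN := hall_nocc_gt0 coord_bound cX.
apply: (@le_trans _ _ (cabs (xi u a s) * cabs (xi_dens c s))).
  by rewrite ler_wpM2r // ler_piMl // invf_le1 ?ler1n // ltr0Sn.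
apply: (le_trans (ler_pM (cabs_ge0 _) (cabs_ge0 _) ha hc)).
rewrite [leLHS](_ : _ = 2 ^+ (kap a * len a) * 2 ^+ (kap c * len c) * (dp (nocc0 a) s * dp (occ0_left c) s)
   * (Ub ^+ nocc a * Ub ^+ occ_left c) * cabs (ctrl (rleaf c) s)); last first.
  by move: (dp _ s) (dp _ s) => x y; ring.
rewrite -!exprD /= ler_wpM2r // ler_wpM2r ?exprn_ge0 //.
apply: (le_trans (ler_wpM2l (exprn_ge0 _ (ler0n R 2)) (dp_mul _ _ s0'))).
rewrite [2 ^+ _ * (2 ^+ _ * _)]mulrA -exprD ler_wpM2r ?dp_ge0 // ler_weXn2l ?ler1n //.
have h1 : (kap a <= 2 * nocc (Pair a c) - 1)%N by rewrite /kap /=; case: (headed _ a); move: aN cN; clear; lia.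
have h2 : (kap c <= 2 * nocc (Pair a c) - 1)%N by rewrite /kap /=; case: (headed _ c); move: aN cN; clear; lia.
have -> : kap (Pair a c) = (2 * nocc (Pair a c))%N by rewrite /kap hdb addn0.
have h3 : (nocc0 a + occ0_left c <= len a + len c)%N.
  by move: (nocc0_left c) (nocc0_nocc c) (nocc0_nocc a); clear; lia.
have h4 : (0 < nocc (Pair a c))%N by rewrite /= addn_gt0 aN.
move: h1 h2 h3 h4; rewrite [nocc _]/=; move: (nocc a + nocc c)%N (kap a) (kap c) (len a) (len c) (nocc0 a + occ0_left c)%N => N ka kc la' lc' E; clear; nia.
Qed.

Lemma xi_bound (q0 : (0 < q)%N) b : B b -> xi_ok b.
Proof. by move=> Bb; apply: xi_of_dens => //; exact: xi_dens_bound. Qed.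

End Xi.

(** * Word functions and products of exponentials *)

Section TauAdd.
Variables (A : zmodType) (q : nat).

Fact tau_is_zmod (b : br q) : zmod_morphism (@tau A q b).
Proof.
elim: b => [i|b1 h1 b2 h2] c c'; apply/funext => w //.
rewrite [LHS]/= h2 h1 h1 h2.
transitivity ((tau b1 (tau b2 c) w - tau b1 (tau b2 c') w) -
  (tau b2 (tau b1 c) w - tau b2 (tau b1 c') w)); first by [].
transitivity ((tau b1 (tau b2 c) w - tau b2 (tau b1 c) w) -
  (tau b1 (tau b2 c') w - tau b2 (tau b1 c') w)); last by [].
by rewrite !opprD !opprK addrACA.
Qed.

HB.instance Definition _ (b : br q) := GRing.isZmodMorphism.Build
  (seq 'I_q.+1 -> A) (seq 'I_q.+1 -> A) (@tau A q b) (tau_is_zmod b).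

Fact iter_tau_is_zmod (b : br q) n : zmod_morphism (iter n (@tau A q b)).
Proof. by move=> c c'; elim: n => //= n ->; rewrite raddfB. Qed.

Lemma tau_pair (a b : br q) (c : seq 'I_q.+1 -> A) :
  tau (Pair a b) c = tau a (tau b c) - tau b (tau a c).
Proof. by []. Qed.

Definition wocc (w : seq 'I_q.+1) := count (fun i => i != ord0) w.

(** Restriction to the words whose degree satisfies P, the degree being the
    pair of the length and of the number of letters other than X_0; n and N
    record the part of the word already consumed by operators tau b. *)
Definition wcut (P : nat -> nat -> bool) (n N : nat) (c : seq 'I_q.+1 -> A) :
    seq 'I_q.+1 -> A :=
  fun w => if P (n + size w)%N (N + wocc w)%N then c w else 0.

Lemma tau_wcut P n N b c :
  tau b (wcut P n N c) = wcut P (n + len b) (N + nocc b) (tau b c).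
Proof.
elim: b n N c => [i|b1 h1 b2 h2] n N c; apply/funext => w.
  rewrite /= /wcut size_rcons /wocc -cats1 count_cat /= addn0.
  by rewrite -addnA add1n -[in RHS]addnA [((i != ord0) + _)%N]addnC.
rewrite /= h1 h2 h1 h2 /wcut !addnA [(n + len b2 + _)%N]addnAC [(N + nocc b2 + _)%N]addnAC.
by case: ifP => // _; rewrite subr0.
Qed.

Lemma iter_tau_wcut P n N b j c : iter j (tau b) (wcut P n N c) =
  wcut P (n + j * len b) (N + j * nocc b) (iter j (tau b) c).
Proof.
elim: j => [|j ih]; first by rewrite !mul0n !addn0.
by rewrite !iterS ih tau_wcut -!addnA !mulSn [(len b + _)%N]addnC [(nocc b + _)%N]addnC.
Qed.

Definition in_range (L M n N : nat) : bool := (n <= L)%N && (N <= M)%N.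

(** Word functions that vanish outside the finite range of degrees selected
    by L and M. *)
Definition wsup L M (c : seq 'I_q.+1 -> A) := forall w, ~~ in_range L M (size w) (wocc w) -> c w = 0.

Lemma wsupP L M c : wsup L M c <-> c = wcut (in_range L M) 0 0 c.
Proof.
split=> [h|e w]; last by rewrite e /wcut !add0n => /negbTE ->.
by apply/funext => w; rewrite /wcut !add0n; case: ifPn => // /h.
Qed.

Lemma wsup_wcut L M c : wsup L M (wcut (in_range L M) 0 0 c).
Proof. by move=> w h; rewrite /wcut !add0n (negbTE h). Qed.

Lemma wsup_tau L M b c : wsup L M c -> wsup (L - len b) M (tau b c).
Proof.
move=> /wsupP -> w h; rewrite tau_wcut /wcut; case: ifP => // h'.
by exfalso; move: h h'; rewrite /in_range; lia.
Qed.

Lemma wsup_tau0 L M b c : wsup L M c -> ~~ in_range L M (len b) (nocc b) -> tau b c = 0.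
Proof.
move=> /wsupP -> h; rewrite tau_wcut; apply/funext => w; rewrite /wcut; case: ifP => // h'.
by exfalso; move: h h'; rewrite /in_range; lia.
Qed.

Lemma wsup_le L L' M c : (L <= L')%N -> wsup L M c -> wsup L' M c.
Proof. by move=> h s w hw; apply: s; move: hw; rewrite /in_range; lia. Qed.

Lemma wsup_iter L M b j c : wsup L M c -> wsup (L - j) M (iter j (tau b) c).
Proof.
elim: j => [|j ih] h; first by rewrite subn0.
by apply: wsup_le _ (wsup_tau (ih h)); have := len_gt0 b; lia.
Qed.

Lemma wsup_iter' L M b j c : wsup L M c -> wsup L M (iter j (tau b) c).
Proof. by move=> h; apply: wsup_le _ (wsup_iter b h); rewrite leq_subr. Qed.

Lemma wsup_iter0 L M b j c : wsup L M c -> (L < j)%N -> iter j (tau b) c = 0.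
Proof.
case: j => [//|j] h; rewrite ltnS => Lj /=; apply: (wsup_tau0 (wsup_iter b h)).
by rewrite /in_range; have := len_gt0 b; lia.
Qed.

(** For operators A and C: A^n C is the sum of binomial(n, m) ad_A^m(C) A^(n
    - m). *)
Lemma tau_ad (a b : br q) n (c : seq 'I_q.+1 -> A) : iter n (tau a) (tau b c) =
  \sum_(m < n.+1) tau (iter m (Pair a) b) (iter (n - m) (tau a) c) *+ 'C(n, m).
Proof.
elim: n b c => [|n ih] b c; first by rewrite big_ord1.
have -> : iter n.+1 (tau a) (tau b c) = iter n (tau a) (tau (Pair a b) c) + iter n (tau a) (tau b (tau a c)).
  have := iter_tau_is_zmod a n (tau a (tau b c)) (tau b (tau a c)).
  by rewrite -tau_pair => ->; rewrite iterSr subrK.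
rewrite !ih.
have -> : \sum_(m < n.+1) tau (iter m (Pair a) b) (iter (n - m) (tau a) (tau a c)) *+ 'C(n, m) =
   \sum_(m < n.+2) tau (iter m (Pair a) b) (iter (n.+1 - m) (tau a) c) *+ 'C(n, m).
  rewrite [RHS]big_ord_recr /= bin_small // mulr0n addr0; apply: eq_bigr => m _.
  by rewrite -iterSr subSn // -ltnS.
rewrite [X in _ + X]big_ord_recl [RHS]big_ord_recl !bin0 addrCA; congr (_ + _).
rewrite -big_split; apply: eq_bigr => m _.
by rewrite !lift0 subSS (iterSr m (Pair a)) binS mulrnDr addrC.
Qed.
End TauAdd.

Lemma triangle (V : nmodType) (H : nat -> nat -> V) n :
  \sum_(i < n) \sum_(j < i.+1) H j (i - j)%N = \sum_(j < n) \sum_(l < n - j) H j l.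
Proof.
elim: n => [|n ih]; first by rewrite !big_ord0.
rewrite big_ord_recr /= ih [RHS]big_ord_recr /= subSnn big_ord1.
rewrite [X in _ + X]big_ord_recr /= subnn addrA -big_split; congr (_ + _).
apply: eq_bigr => j _ /=; rewrite subSn; last by rewrite ltnW.
by rewrite big_ord_recr.
Qed.

Lemma sum_stop (V : nmodType) (h : nat -> V) n N : (forall k, (n < k)%N -> h k = 0) ->
  (n < N)%N -> \sum_(k < N) h k = \sum_(k < n.+1) h k.
Proof.
move=> h0 nN; rewrite -(subnKC nN) big_split_ord /= [X in _ + X]big1 ?addr0 // => i _.
by apply: h0; rewrite leq_addr.
Qed.

Section Alg.
Variables (F : numFieldType) (q : nat).
Local Notation W := (seq 'I_q.+1 -> F).
Implicit Types (b : br q) (c : W).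
Variable x : br q -> F.

(** The term of degree K in the product of the exponentials of the operators
    x_b tau b, evaluated at the empty word. The head of s acts first on c, since
    it is the last flow applied to the point. *)
Fixpoint taylor_term (s : seq (br q)) (K : nat) c : F :=
  if s is b :: s' then \sum_(k < K.+1) x b ^+ k / k`!%:R * taylor_term s' (K - k) (iter k (tau b) c)
  else if K is 0 then c [::] else 0.

Variable L : nat.

(** The sum of all the terms taylor_term; cutting each exponential after L
    terms is harmless on word functions supported on lengths at most L
    (sum_taylor). *)
Fixpoint expprod (s : seq (br q)) c : F :=
  if s is b :: s' then \sum_(k < L.+1) x b ^+ k / k`!%:R * expprod s' (iter k (tau b) c)
  else c [::].

Fact expprod_is_zmod s : zmod_morphism (expprod s).
Proof.
elim: s => [|b s ih] c c' //=; rewrite -sumrB; apply: eq_bigr => k _.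
by rewrite iter_tau_is_zmod ih mulrBr.
Qed.
HB.instance Definition _ s := GRing.isZmodMorphism.Build W F (expprod s) (expprod_is_zmod s).

Fact taylor_is_zmod s K : zmod_morphism (taylor_term s K).
Proof.
elim: s K => [|b s ih] K c c' /=; first by case: K => //; rewrite subr0.
by rewrite -sumrB; apply: eq_bigr => k _; rewrite iter_tau_is_zmod ih mulrBr.
Qed.
HB.instance Definition _ s K := GRing.isZmodMorphism.Build W F (taylor_term s K) (taylor_is_zmod s K).

Lemma sum_taylor M s n K c : wsup n M c -> (n < K)%N -> (n <= L)%N ->
  \sum_(i < K) taylor_term s i c = expprod s c.
Proof.
elim: s n K c => [|b s ih] n K c hc nK nL.
  by case: K nK => // K _; rewrite big_ord_recl big1 ?addr0.
rewrite /= (triangle (fun k i => x b ^+ k / k`!%:R * taylor_term s i (iter k (tau b) c))).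
pose h k := x b ^+ k / k`!%:R * expprod s (iter k (tau b) c).
have h0 k : (n < k)%N -> h k = 0 by move=> nk; rewrite /h (wsup_iter0 b hc nk) raddf0 mulr0.
transitivity (\sum_(k < K) h k); last first.
  by rewrite (sum_stop h0 nK) (sum_stop h0 (_ : n < L.+1)%N).
apply: eq_bigr => k _; rewrite -mulr_sumr /h.
have [kn|nk] := leqP k n; last first.
  rewrite (wsup_iter0 b hc nk) raddf0 big1 ?mulr0 // => i _; exact: raddf0.
congr (_ * _); apply: (ih (n - k)%N); rewrite ?(leq_trans (leq_subr _ _)) ?ltn_sub2r //.
  exact: wsup_iter.
Qed.

(** Brackets outside the range of the support act by zero, so any two
    products with the same Hall elements in range agree. *)
Lemma expprod_filter M n s c : wsup n M c ->
  expprod s c = expprod [seq b <- s | in_range n M (len b) (nocc b)] c.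
Proof.
elim: s c => [//|b s ih] c hc /=; case: ifPn => [_|hb] /=.
  by apply: eq_bigr => k _; rewrite ih //; exact: wsup_iter'.
have z n' : iter n'.+1 (tau b) c = 0.
  by rewrite iterSr (wsup_tau0 hc hb); elim: n' => //= j ->; rewrite raddf0.
rewrite big_ord_recl expr0 fact0 divr1 mul1r big1 ?addr0 ?ih // => i _.
by rewrite lift0 z raddf0 mulr0.
Qed.

(** Commuting tau b past the exponential of x_a tau a replaces b by all the
    ad_a^m(b), with coefficient x_a^m / m!. This is also the factor between the
    density of xi at ad_a^m(b) and at b. *)
Lemma elim_core M (a b : br q) s c : wsup L M c -> expprod (a :: s) (tau b c) =
  \sum_(m < L.+1) x a ^+ m / m`!%:R *
    \sum_(l < L.+1) x a ^+ l / l`!%:R * expprod s (tau (iter m (Pair a) b) (iter l (tau a) c)).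
Proof.
move=> hc.
pose H m l := x a ^+ m / m`!%:R * (x a ^+ l / l`!%:R * expprod s (tau (iter m (Pair a) b) (iter l (tau a) c))).
have fN n : n`!%:R != 0 :> F by rewrite pnatr_eq0 -lt0n fact_gt0.
transitivity (\sum_(n < L.+1) \sum_(m < n.+1) H m (n - m)%N).
  rewrite /=; apply: eq_bigr => n _; rewrite tau_ad raddf_sum mulr_sumr; apply: eq_bigr => m _.
  rewrite raddfMn /= /H mulrA; move: (expprod _ _) => y.
  have mn : (m <= n)%N by rewrite -ltnS.
  have -> : x a ^+ n = x a ^+ m * x a ^+ (n - m) by rewrite -exprD subnKC.
  have := bin_fact mn => /(congr1 (fun z => z%:R : F)); rewrite !natrM => <-.
  rewrite -[y *+ _]mulr_natr; move: (fN m) (fN (n - m)%N).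
  have : 'C(n, m)%:R != 0 :> F by rewrite pnatr_eq0 -lt0n bin_gt0.
  move: (x a ^+ m) (x a ^+ (n - m)) => z z'.
  move: ('C(n,m)%:R) (m`!%:R) ((n - m)`!%:R) => u1 u2 u3 n1 n2 n3.
  by field; apply/and3P.
rewrite (triangle H); apply: eq_bigr => m _; rewrite mulr_sumr.
have H0 l : (L - m < l)%N -> H m l = 0.
  move=> hl; rewrite /H (@wsup_tau0 _ _ (L - l) M) ?raddf0 ?mulr0 //; first exact: wsup_iter.
  rewrite /in_range; have : (m < len (iter m (Pair a) b))%N.
    elim: (val m) => [|j ih]; first exact: len_gt0.
    by rewrite /=; have := len_gt0 a; lia.
  by lia.
rewrite (sum_stop H0 (_ : L - m < L.+1)%N) ?ltnS ?leq_subr // subSn //.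
by rewrite -ltnS.
Qed.

End Alg.

(** * Lazard elimination along a Hall set *)

Section Hall.
Variables (q : nat) (B : set (br q)) (le : rel (br q)).
Hypothesis hB : hall_set B le.
Variables (L M : nat) (J : seq (br q)).
Hypothesis hJ : forall b, b \in J <-> B b /\ in_range L M (len b) (nocc b).
Hypothesis sJ : pairwise (slt le) J.

Definition is_lazard_gen (s : seq (br q)) (b : br q) := if b is Pair a _ then a \notin s else true.
(** For a final segment s of the sorted Hall set: the free generators of the
    Lie algebra spanned by s, that is, the elements of s whose left factor has
    already been eliminated. *)
Definition lazard_gens s := [seq b <- s | is_lazard_gen s b].

Lemma slt_total a b : B a -> B b -> a <> b -> slt le a b \/ slt le b a.
Proof.
move=> Ba Bb /eqP ab; rewrite /slt ab eq_sym ab /=.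
by have [] := hall_total hB Ba Bb; [left|right].
Qed.

Lemma pw_uniq (s : seq (br q)) : pairwise (slt le) s -> uniq s.
Proof.
by rewrite uniq_pairwise; apply: sub_pairwise => a b; rewrite /slt => /andP[].
Qed.

Variables (pre s : seq (br q)) (b0 : br q).
Hypothesis eJ : J = pre ++ b0 :: s.

Let J0 : b0 \in J. Proof. by rewrite eJ mem_cat mem_head orbT. Qed.
Let B0 : B b0. Proof. by have [] := hJ b0 => /(_ J0)[]. Qed.
Let JB b : b \in J -> B b. Proof. by case/hJ. Qed.

Lemma mem_tail b : b \in s <-> b \in J /\ slt le b0 b.
Proof.
have := sJ; rewrite eJ pairwise_cat => /and3P[h1 _ /= /andP[/allP h2 _]].
split=> [bs|[]]; first by rewrite mem_cat in_cons bs !orbT; split=> //; exact: h2.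
rewrite mem_cat in_cons => /or3P[bp|/eqP ->|//]; last by rewrite slt_irr.
move=> lt; have lt' := allrelP h1 b b0 bp (mem_head _ _).
have Jb : b \in J by rewrite eJ mem_cat bp.
by case: (slt_asym hB B0 (JB Jb) lt lt').
Qed.

Lemma lazard_cons : lazard_gens (b0 :: s) = b0 :: [seq b <- s | is_lazard_gen (b0 :: s) b].
Proof.
rewrite /lazard_gens /= ifT //; case: b0 eJ B0 mem_tail => // a c e Bb h /=.
have [Ba _ _ lt] := hall_pairP hB Bb.
rewrite in_cons negb_or; apply/andP; split; first by move: lt => /andP[].
apply/negP => /h[_ lt']; exact: (slt_asym hB Bb Ba lt' lt).
Qed.

Lemma lazard_gen_headed b : is_lazard_gen (b0 :: s) b -> headed b0 b = false.
Proof. by case: b => //= a c; rewrite in_cons negb_or => /andP[/negbTE]. Qed.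

Lemma core_iter_pair b m : headed b0 b = false ->
  cnt b0 (iter m (Pair b0) b) = m /\ core b0 (iter m (Pair b0) b) = b.
Proof.
by move=> /cnt_headed[h1 h2]; elim: m => //= m [e1 e2]; rewrite eqxx e1 e2.
Qed.

Lemma len_iter (a b : br q) m : (m < len (iter m (Pair a) b))%N.
Proof.
elim: m => [|j ih]; first exact: len_gt0.
by rewrite /=; have := len_gt0 a; lia.
Qed.

Lemma inD_iter n N (a b : br q) m : in_range n N (len (iter m (Pair a) b)) (nocc (iter m (Pair a) b)) ->
  in_range n N (len b) (nocc b).
Proof. by elim: m => //= m ih h; apply: ih; move: h; rewrite /in_range; lia. Qed.

(** The Hall conditions guarantee that all ad_{b0}^m(b) are Hall elements
    above b0, within the range of degrees. *)
Lemma lazard_up b m : b \in s -> is_lazard_gen (b0 :: s) b -> in_range L M (len (iter m (Pair b0) b)) (nocc (iter m (Pair b0) b)) ->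
  iter m (Pair b0) b \in lazard_gens s.
Proof.
move=> bs Yb; have [Jb lt] := (mem_tail b).1 bs; have Bb := JB Jb.
have key j : B (iter j (Pair b0) b) /\ slt le b0 (iter j (Pair b0) b).
  elim: j => [//|j [ih1 ih2]]; rewrite iterS.
  suff h : B (Pair b0 (iter j (Pair b0) b)) by split=> //; exact: (hall_lt hB).
  apply/(hall_pair hB); split=> //; case: j {ih1 ih2} => [|j] /=; last exact: (hall_refl hB).
  case: b bs Yb Jb lt Bb => // a c bs Yb Jb lt Bb.
  have [Ba _ _ _] := hall_pairP hB Bb.
  have Ja : a \in J.
    by apply/hJ; split=> //; have [_] := (hJ _).1 Jb; rewrite /in_range /=; lia.
  have [ab|ab] := pselect (a = b0); first by rewrite ab; exact: (hall_refl hB).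
  have [|lt'] := slt_total Ba B0 ab; first by case/andP.
  move: Yb; rewrite /= in_cons negb_or => /andP[_ /negP[]].
  by apply/mem_tail.
move=> hD; have [h1 h2] := key m; rewrite mem_filter; apply/andP; split; last first.
  by apply/mem_tail; split=> //; apply/hJ.
case: m {hD h1 h2} => [|m] /=.
  by case: b Yb {bs Jb lt Bb key} => //= a c; rewrite in_cons negb_or => /andP[].
by apply/negP => /mem_tail[_]; rewrite slt_irr.
Qed.

(** Conversely, stripping all left factors b0 from a generator of the next
    stage gives a generator of the present stage. *)
Lemma lazard_down b : b \in lazard_gens s -> core b0 b \in s /\ is_lazard_gen (b0 :: s) (core b0 b).
Proof.
rewrite mem_filter => /andP[Yb bs]; have [Jb lt] := (mem_tail b).1 bs; have Bb := JB Jb.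
have coord_bound := hall_core hB b0 Bb; have hc := headed_core b0 b.
have Jc : core b0 b \in J.
  apply/hJ; split=> //; have [_] := (hJ _).1 Jb; rewrite -{1 2}[b](iter_core b0).
  exact: inD_iter.
have [c0|c0] := posnP (cnt b0 b).
  have cb : core b0 b = b by rewrite -{2}[b](iter_core b0) c0.
  rewrite cb; split=> //; rewrite cb in hc.
  case: b Yb hc {bs Jb lt Bb coord_bound Jc c0 cb} => //= a c ac hc.
  by rewrite in_cons negb_or hc.
have Bp : B (Pair b0 (core b0 b)).
  have := Bb; rewrite -{1}[b](iter_core b0); case: (cnt b0 b) c0 => // m _.
  by elim: m => //= m ih /(hall_pairP hB)[_ /ih].
have /(hall_pair hB)[_ _ lt2 h] := Bp; split; first by apply/mem_tail.
move: hc h coord_bound; case: (core b0 b) => //= a c ac lab coord_bound.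
rewrite in_cons ac /=; apply/negP => /mem_tail[Ja lt3].
have Ba := JB Ja.
by move: lt3 => /andP[/eqP n1' l1]; apply: n1'; exact: (hall_anti hB).
Qed.

(** One step of Lazard elimination: the generators after removal of b0 are
    the ad_{b0}^m(b), for b a generator other than b0. Brackets out of range are
    discarded by the hypothesis on g. *)
Lemma lazard_sum (V : nmodType) (g : br q -> V) :
  (forall b, ~~ in_range L M (len b) (nocc b) -> g b = 0) ->
  \sum_(b <- lazard_gens s) g b =
  \sum_(b <- [seq b <- s | is_lazard_gen (b0 :: s) b]) \sum_(m < L.+1) g (iter m (Pair b0) b).
Proof.
move=> g0; set Y' := [seq b <- s | _].
have us : uniq s.
  by have := pw_uniq sJ; rewrite eJ cat_uniq => /and3P[_ _ /= /andP[]].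
have [I [sI mI uI]] : exists I : seq nat, [/\ forall h : nat -> V,
    \sum_(m < L.+1) h m = \sum_(m <- I) h m, forall m, (m \in I) = (m < L.+1)%N & uniq I].
  exists (index_iota 0 L.+1); split=> [h|m|]; first by rewrite big_mkord.
    by rewrite mem_index_iota.
  exact: iota_uniq.
transitivity (\sum_(b <- Y') \sum_(m <- I) g (iter m (Pair b0) b)); last first.
  by apply: eq_bigr => b _; rewrite (sI (fun m => g (iter m (Pair b0) b))).
rewrite -(big_allpairs_dep (h := fun b m => iter m (Pair b0) b) (r1 := Y') (r2 := fun=> I) (F := g)).
rewrite [RHS](bigID (fun b => in_range L M (len b) (nocc b))) /= [X in _ = _ + X]big1 ?addr0 => [|b /g0 //].
rewrite -[RHS]big_filter; apply: perm_big; apply: uniq_perm.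
- by rewrite filter_uniq.
- apply: filter_uniq; apply: allpairs_uniq; rewrite ?filter_uniq //.
  move=> [b m] [b' m'] /allpairsP[[c n] /= [+ _ [-> ->]]] /allpairsP[[c' n'] /= [+ _ [-> ->]]].
  rewrite !mem_filter => /andP[/lazard_gen_headed h _] /andP[/lazard_gen_headed h' _] /= e.
  have [e1 e2] := core_iter_pair n h; have [e3 e4] := core_iter_pair n' h'.
  by rewrite e in e1 e2; rewrite -e1 -e2 e3 e4.
move=> b; rewrite [in RHS]mem_filter; apply/idP/andP => [bY|[hD /allpairsP[[c m] /= [+ _ e]]]].
  have [cs Yc] := lazard_down bY; split.
    move: bY; rewrite mem_filter => /andP[_ /mem_tail[/hJ[]]]//.
  apply/allpairsP; exists (core b0 b, cnt b0 b); split; rewrite ?iter_core //=.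
    by rewrite mem_filter Yc.
  rewrite mI ltnS; apply: leq_trans (ltnW (len_iter b0 (core b0 b) _)) _.
  rewrite iter_core; move: bY; rewrite mem_filter => /andP[_ /mem_tail[/hJ[_ /andP[]]]]//.
by rewrite mem_filter => /andP[Yc cs]; rewrite e in hD *; exact: lazard_up.
Qed.
End Hall.

Section Elim.
Variables (R : realType) (k : scalars) (q : nat).
Local Notation K := (K R k).
Local Notation W := (seq 'I_q.+1 -> K).
Variables (B : set (br q)) (le : rel (br q)).
Hypothesis hB : hall_set B le.
Variables (L M : nat) (J : seq (br q)).
Hypothesis hJ : forall b, b \in J <-> B b /\ in_range L M (len b) (nocc b).
Hypothesis sJ : pairwise (slt le) J.
Variables (T : R) (xx xd : br q -> R -> K).
Hypothesis T0 : 0 <= T.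
Hypothesis axx : forall b, AC T (xx b) (xd b).
Hypothesis xdP : forall a c s, xd (Pair a c) s = (cnt a c).+1%:R^-1 * xx a s * xd c s.
Hypothesis xx0 : forall b, xx b 0 = 0.

Local Notation E := (fun s c t => expprod (fun b => xx b t) L s c).

Lemma xd_iter a b m t : headed a b = false -> xd (iter m (Pair a) b) t = xx a t ^+ m / m`!%:R * xd b t.
Proof.
move=> h; elim: m => [|m ih]; first by rewrite /= expr0 fact0 divr1 mul1r.
have [e _] := core_iter_pair m h.
rewrite iterS xdP ih e exprS factS natrM invfM.
by move: (m.+1%:R^-1) (m`!%:R^-1) (xx a t ^+ m) (xx a t) (xd b t) => y1 y2 y3 y4 y5; ring.
Qed.

(** Induction on the final segment: the first exponential is differentiated
    by Leibniz' rule, and its derivative gives the generator b0; elim_core and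
    lazard_sum identify the remaining terms. *)
Lemma expprod_AC s c : (exists pre, J = pre ++ s) -> wsup L M c ->
  AC T (fun t => E s c t) (fun t => \sum_(b <- lazard_gens s) xd b t * E s (tau b c) t).
Proof.
elim: s c => [|b0 s ih] c [pre eJ] hc.
  by apply: AC_eq (AC_cst T (c [::])) => // t *; rewrite big_nil.
have {}ih c' : wsup L M c' -> AC T (fun t => E s c' t)
    (fun t => \sum_(b <- lazard_gens s) xd b t * E s (tau b c') t).
  by apply: ih; exists (rcons pre b0); rewrite cat_rcons.
pose dp0 m := if m is m'.+1 then fun t => xx b0 t ^+ m' / m'`!%:R * xd b0 t else fun=> 0.
have adp m : AC T (fun t => xx b0 t ^+ m / m`!%:R) (dp0 m).
  case: m => [|m]; last exact: AC_dpow.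
  by apply: AC_eq (AC_cst T (1 : K)) => // t *; rewrite expr0 fact0 divr1.
have main := AC_sum (index_enum 'I_L.+1) (P := xpredT) (fun (m : 'I_L.+1) _ =>
  AC_M T0 (adp m) (ih _ (wsup_iter' b0 (val m) hc))).
apply: AC_eq main => // t _ _; rewrite big_split /=.
rewrite (lazard_cons hB hJ sJ eJ) big_cons; congr (_ + _).
  rewrite big_ord_recl mul0r add0r mulr_sumr big_ord_recr /=.
  rewrite -iterSr (wsup_iter0 b0 hc (ltnSn L)) raddf0 !mulr0 addr0.
  by apply: eq_bigr => m _ /=; rewrite add0n -iterSr /= [RHS]mulrCA [RHS]mulrA.
transitivity (\sum_(b <- lazard_gens s) xd b t * \sum_(l < L.+1) xx b0 t ^+ l / l`!%:R *
   E s (tau b (iter l (tau b0) c)) t).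
  transitivity (\sum_(l < L.+1) \sum_(b <- lazard_gens s) xd b t * (xx b0 t ^+ l / l`!%:R *
     E s (tau b (iter l (tau b0) c)) t)).
    apply: eq_bigr => l _; rewrite mulr_suml; apply: eq_bigr => b _.
    by rewrite -mulrA; congr (_ * _); rewrite mulrC.
  by rewrite exchange_big; apply: eq_bigr => b _; rewrite mulr_sumr.
rewrite (lazard_sum hB hJ sJ eJ); last first.
  move=> b hb; rewrite big1 ?mulr0 // => l _.
  by rewrite (wsup_tau0 (wsup_iter' b0 l hc) hb) raddf0 mulr0.
rewrite big_seq [RHS]big_seq; apply: eq_bigr => b; rewrite mem_filter => /andP[/lazard_gen_headed h _].
have /= -> := @elim_core _ _ (xx^~ t) L M b0 b s c hc; rewrite mulr_sumr; apply: eq_bigr => m _.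
by rewrite (xd_iter _ _ h) -mulrA mulrCA.
Qed.

Variable v : 'I_q.+1 -> R -> K.
Hypothesis xdG : forall i t, xd (Gen i) t = v i t.

(** The Chen iterated integrals as linear forms in the word function; they
    carry the expansion chen through chi (chen_itint). *)
Fixpoint itint (j : nat) (c : W) : R -> K :=
  match j with
  | 0 => fun=> c [::]
  | j'.+1 => fun t => integralK `]0, t[ (fun s => \sum_(i < q.+1) v i s * itint j' (tau (Gen i) c) s)
  end.

Hypothesis iv : forall i, integrableK `]0, T[ (v i).

Definition itint_dens (j : nat) (c : W) : R -> K :=
  if j is j'.+1 then fun s => \sum_(i < q.+1) v i s * itint j' (tau (Gen i) c) s else fun=> 0.

Lemma itint_AC j c : AC T (itint j c) (itint_dens j c).
Proof.
elim: j c => [|j ih] c; first exact: AC_cst.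
apply: AC_int; apply: integrableK_sum => // i _.
exact: AC_mulint T0 (ih _) (iv i).
Qed.

Lemma itint_dens_int j c : integrableK `]0, T[ (itint_dens j c).
Proof. by have [] := itint_AC j c. Qed.

Lemma expprod_0 s c : E s c 0 = c [::].
Proof.
elim: s c => [//|b s ih] c /=; rewrite big_ord_recl big1 ?addr0 => [|i _].
  by rewrite expr0 fact0 divr1 mul1r ih.
by rewrite lift0 xx0 expr0n /= !mul0r.
Qed.

(** For the whole Hall set, a bracket is never a generator: its left factor
    is in range too. *)
Lemma lazard_full (g : br q -> K) : (forall b, ~~ in_range L M (len b) (nocc b) -> g b = 0) ->
  \sum_(b <- lazard_gens J) g b = \sum_(i < q.+1) g (Gen i).
Proof.
move=> g0; transitivity (\sum_(b <- [seq Gen i | i <- enum 'I_q.+1]) g b); last first.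
  by rewrite big_map big_enum.
rewrite [RHS](bigID (fun b => in_range L M (len b) (nocc b))) /= [X in _ = _ + X]big1 ?addr0 => [|b /g0 //].
rewrite -[RHS]big_filter; apply: perm_big; apply: uniq_perm.
- by rewrite filter_uniq // (pw_uniq sJ).
- rewrite filter_uniq // map_inj_uniq ?enum_uniq // => i j [] //.
move=> b; rewrite !mem_filter; apply/andP/andP => [[Yb Jb]|[hD /mapP[i _ e]]]; last first.
  by rewrite e in hD *; split=> //; apply/hJ; split=> //; exact: (hall_gen hB).
have [Bb hD] := (hJ _).1 Jb; split=> //.
case: b Yb Jb Bb hD => [i _ _ _ _|a c /negP Ya Jb Bb hD]; first by apply: map_f; rewrite mem_enum.
case: Ya; apply/hJ; have [Ba _ _ _] := hall_pairP hB Bb; split=> //.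
by move: hD; rewrite /in_range /=; lia.
Qed.

(** Both sides satisfy the same equation with the same initial value, and
    differentiation shortens the support of c by one letter. *)
Lemma expprod_itint n c : (n <= L)%N -> wsup n M c -> forall t, 0 <= t <= T ->
  E J c t = \sum_(j < n.+1) itint j c t.
Proof.
elim: n c => [|n ih] c nL hc t tT.
  rewrite big_ord1 /= -[RHS](expprod_0 J c).
  have [_ ->] := expprod_AC (ex_intro _ [::] (erefl _)) (wsup_le (leq0n L) hc); last exact: tT.
  rewrite [X in _ + X](_ : _ = 0) ?addr0 //.
  have -> : (fun t => \sum_(b <- lazard_gens J) xd b t * E J (tau b c) t) = fun=> 0.
    apply/funext => s; rewrite big1 // => b _.
    rewrite (wsup_tau0 hc) ?raddf0 ?mulr0 // /in_range; have := len_gt0 b; lia.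
  exact: integralK0.
have /andP[t0 tT'] := tT.
have hcL := wsup_le nL hc.
have [_ ->] := expprod_AC (ex_intro _ [::] (erefl _)) hcL; last exact: tT.
rewrite expprod_0 big_ord_recl /=; congr (_ + _).
transitivity (integralK `]0, t[ (fun s => \sum_(j < n.+1) itint_dens j.+1 c s)); last first.
  rewrite integralK_sum //; last by move=> i _; apply: intK_sub0 tT' _; exact: (itint_dens_int (val i).+1 c).
apply: eq_integralK => s; rewrite /= in_itv /= => /andP[s0 st].
rewrite lazard_full; last first.
  by move=> b hb; rewrite (wsup_tau0 hcL hb) raddf0 mulr0.
rewrite exchange_big; apply: eq_bigr => i _; rewrite xdG -mulr_sumr; congr (_ * _).
apply: ih; first exact: ltnW.
  by have := wsup_tau (b := Gen i) hc; rewrite /= subSS subn0.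
by rewrite (ltW s0) (le_trans (ltW st)).
Qed.
End Elim.

(** * Weighted bounds for the terms of the expansions *)

Lemma rise2_add a K j : (j <= K)%N -> rise2 a K = (rise2 a j * rise2 (a + 2 * j) (K - j))%N.
Proof.
elim: j a K => [|j ih] a K; first by rewrite muln0 addn0 subn0 mul1n.
case: K => [//|K] jK; rewrite /= subSS (ih a.+2 K jK) mulnA; congr (_ * rise2 _ _)%N; lia.
Qed.

Lemma binom_dp (R : realType) (x y : R) n : (x + y) ^+ n / n`!%:R =
  \sum_(j < n.+1) (x ^+ j / j`!%:R) * (y ^+ (n - j) / (n - j)`!%:R).
Proof.
rewrite addrC exprDn mulr_suml; apply: eq_bigr => j _.
have jn : (j <= n)%N by rewrite -ltnS.
have := bin_fact jn => /(congr1 (fun z => z%:R : R)); rewrite !natrM => <-.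
have fN m : m`!%:R != 0 :> R by rewrite pnatr_eq0 -lt0n fact_gt0.
move: (fN j) (fN (n - j)%N).
have : 'C(n, j)%:R != 0 :> R by rewrite pnatr_eq0 -lt0n bin_gt0.
rewrite -[_ * _ *+ 'C(n, j)]mulr_natr.
move: (y ^+ (n - j)) (x ^+ j) ('C(n,j)%:R) (j`!%:R) ((n - j)`!%:R) => z z' u1 u2 u3 n1 n2 n3.
by field; apply/and3P.
Qed.

Section Expand.
Variables (R : realType) (k : scalars) (d q : nat).
Local Notation K := (K R k).
Local Notation V := 'rV[K]_d.
Local Notation mu := (@lebesgue_measure R).
Variables (U : set V) (oU : open U) (Bs : set V) (BU : Bs `<=` U) (p0 : V) (dl rho : R).
Local Notation Om := (fun x : V => nrm1 (x - p0) <= dl).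
Hypothesis OmB : forall x, Om x -> Bs x.
Hypothesis rho0 : 0 < rho.
Variables (f : 'I_q.+1 -> V -> V) (F : br q -> R).
Hypothesis hf : forall i, vsm U (f i).
Hypothesis F0 : forall b, 0 <= F b.
Hypothesis hF : forall b j, bd Bs rho (fun x => vf f b x 0 j) (F b) 1.
Local Notation cc := (d%:R / rho).

Lemma cc0 : 0 <= cc. Proof. by rewrite divr_ge0 // ltW. Qed.

Local Notation LL b := (Lop (vf f b)).

Lemma iter_Lop b phi B a j : 0 <= B -> smooth_on U phi -> bd Bs rho phi B a ->
  smooth_on U (iter j (LL b) phi) /\
  bd Bs rho (iter j (LL b) phi) (B * (rise2 a j)%:R * (cc * F b) ^+ j) (a + 2 * j).
Proof.
have sb := vsm_vf oU hf b.
elim: j phi B a => [|j ih] phi B a B0 sp bp; first by rewrite /= !mulr1 muln0 addn0.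
have sp1 := smooth_Lop oU sb sp.
have bp1 := bd_Lop oU BU rho0 sb sp (F0 b) B0 (hF b) bp.
have B1 : 0 <= d%:R * (F b * (B * a%:R / rho)).
  by rewrite mulr_ge0 // mulr_ge0 // divr_ge0 ?(ltW rho0) // mulr_ge0.
have [s2 b2] := ih _ _ _ B1 sp1 bp1; rewrite iterSr; split=> //.
have -> : (a + 2 * j.+1 = (1 + a).+1 + 2 * j)%N by lia.
rewrite [X in bd _ _ _ X _](_ : _ = d%:R * (F b * (B * a%:R / rho)) * (rise2 a.+2 j)%:R * (cc * F b) ^+ j) //.
rewrite exprS /= natrM; move: (_ ^+ j) (rise2 _ _)%:R => y z.
by move: (rho^-1) => r; ring.
Qed.

Lemma chi_iter b phi p j : U p -> smooth_on U phi ->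
  chi f p (iter j (LL b) phi) = iter j (tau b) (chi f p phi).
Proof.
move=> Up sp; elim: j => [//|j ih].
rewrite !iterS -ih; apply: (chi_vf b oU hf _ Up).
elim: j {ih} => //= j ih; exact: (smooth_Lop oU (vsm_vf oU hf b)).
Qed.

Section Weights.
Variables (w1 w2 eps : R) (P : nat -> nat -> bool).
Hypotheses (w10 : 0 < w1) (w20 : 0 < w2) (eps0 : 0 <= eps).
Hypothesis hP : forall n N, P n N -> w1 ^+ n * w2 ^+ N <= eps.
Local Notation ww n N := (w1 ^+ n * w2 ^+ N).
Variables (x : br q -> K) (lam : br q -> R).
Hypothesis lam0 : forall b, 0 <= lam b.

Lemma ww_gt0 n N : 0 < ww n N.
Proof. by rewrite mulr_gt0 // exprn_gt0. Qed.

(** Each operator tau b consumes a part of the word whose weight compensates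
    the division of x_b by that weight; at the end, at the empty word, only words
    of weight at most eps are left. *)
Lemma taylor_wcut_le p s phi B a n N m : Bs p -> 0 <= B -> smooth_on U phi ->
  bd Bs rho phi B a ->
  (forall b, b \in s -> cabs (x b) * F b <= ww (len b) (nocc b) * lam b) ->
  ww n N * cabs (taylor_term x s m (wcut P n N (chi f p phi))) <=
  eps * B * (rise2 a m)%:R * ((cc * \sum_(b <- s) lam b) ^+ m / m`!%:R).
Proof.
move=> Bp; have Up := BU Bp.
elim: s phi B a n N m => [|b s ih] phi B a n N m B0 sp bp hx.
  rewrite big_nil mulr0; case: m => [|m]; last by rewrite /= cabs0 expr0n mul0r !mulr0.
  rewrite /= expr0 fact0 divr1 !mulr1 /wcut !addn0; case: ifP => [/hP hw|_].
    by apply: ler_pM => //; [exact: ltW (ww_gt0 _ _)|exact: bd0 bp Bp].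
  by rewrite cabs0 mulr0 mulr_ge0.
have hxs b' : b' \in s -> cabs (x b') * F b' <= ww (len b') (nocc b') * lam b'.
  by move=> h; apply: hx; rewrite in_cons h orbT.
have hxb := hx b (mem_head _ _).
have S0 : 0 <= \sum_(b <- s) lam b by apply: sumr_ge0.
rewrite big_cons [taylor_term _ _ _ _]/= mulrDr binom_dp mulr_sumr.
apply: (@le_trans _ _ (\sum_(i < m.+1) ww n N * cabs (x b ^+ i / i`!%:R *
    taylor_term x s (m - i) (iter i (tau b) (wcut P n N (chi f p phi)))))).
  by rewrite -mulr_sumr ler_wpM2l ?(ltW (ww_gt0 _ _)) // cabs_sum.
apply: ler_sum => i _; have im : (i <= m)%N by rewrite -ltnS.
rewrite iter_tau_wcut -(chi_iter _ _ Up sp) !cabsM cabs_natV cabsX.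
have [si bi] := iter_Lop b i B0 sp bp.
have Bi : 0 <= B * (rise2 a i)%:R * (cc * F b) ^+ i.
  by rewrite mulr_ge0 ?mulr_ge0 // exprn_ge0 // mulr_ge0 ?cc0.
have := ih _ _ _ (n + i * len b)%N (N + i * nocc b)%N (m - i)%N Bi si bi hxs.
move: (cabs (taylor_term _ _ _ _)) (cabs_ge0 (taylor_term x s (m - i) (wcut P (n + i * len b) (N + i * nocc b) (chi f p (iter i (LL b) phi))))) => A A0 hA.
have wE : ww (n + i * len b) (N + i * nocc b) = ww n N * ww (len b) (nocc b) ^+ i.
  by rewrite !exprD exprMn -!exprM ![(i * _)%N]mulnC; ring.
rewrite wE in hA; rewrite (rise2_add a im) natrM.
set W := ww (len b) (nocc b) in hA hxb; have W0 : 0 < W by exact: ww_gt0.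
have Wi : 0 < W ^+ i by rewrite exprn_gt0.
rewrite -(ler_pM2r Wi).
set X := cabs (x b) in hxb *; have X0 : 0 <= X := cabs_ge0 _.
have fi : 0 <= (i`!%:R)^-1 :> R by rewrite invr_ge0.
have h1 := ler_wpM2l (mulr_ge0 (exprn_ge0 i X0) fi) hA.
rewrite [leLHS](_ : _ = X ^+ i / i`!%:R * (ww n N * W ^+ i * A)); last by ring.
apply: (le_trans h1).
have h2 : (X * F b) ^+ i <= (W * lam b) ^+ i.
  rewrite lerXn2r // nnegrE; first by rewrite mulr_ge0.
  by rewrite mulr_ge0 // ltW.
pose Q := eps * B * (rise2 a i)%:R * (rise2 (a + 2 * i) (m - i))%:R * cc ^+ i / i`!%:R *
   ((cc * \sum_(b <- s) lam b) ^+ (m - i) / (m - i)`!%:R).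
have Q0 : 0 <= Q.
  rewrite /Q; apply: mulr_ge0; last by rewrite divr_ge0 // exprn_ge0 // mulr_ge0 ?cc0.
  apply: mulr_ge0 => //; apply: mulr_ge0; last by rewrite exprn_ge0 // cc0.
  by apply: mulr_ge0 => //; apply: mulr_ge0 => //; apply: mulr_ge0.
have h3 := ler_wpM2l Q0 h2.
rewrite [leLHS](_ : _ = Q * (X * F b) ^+ i).
  apply: (le_trans h3); rewrite le_eqVlt; apply/orP; left; apply/eqP.
  rewrite /Q !exprMn.
  move: (_ ^+ (m - i)) (_ ^+ (m - i)) (rise2 _ _)%:R (rise2 _ _)%:R => y1 y2 y3 y4.
  by move: (i`!%:R^-1) ((m-i)`!%:R^-1) (cc ^+ i) (W ^+ i) (lam b ^+ i) => z1 z2 z3 z4 z5; ring.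
rewrite /Q !exprMn.
move: (_ ^+ (m - i)) (_ ^+ (m - i)) (rise2 _ _)%:R (rise2 _ _)%:R => y1 y2 y3 y4.
by move: (i`!%:R^-1) ((m-i)`!%:R^-1) (cc ^+ i) (X ^+ i) (F b ^+ i) => z1 z2 z3 z4 z5; ring.
Qed.

Variable T : R.
Hypothesis T0 : 0 <= T.
Variable v : 'I_q.+1 -> R -> K.
Hypothesis iv : forall i, integrableK `]0, T[ (v i).
Local Notation G := (fun i : 'I_q.+1 => F (Gen i) / (w1 * w2 ^+ (i != ord0))).

(** The same gain as in taylor_wcut_le, letter by letter. *)
Lemma itint_wcut_le p phi (B : R) a n N m : Bs p -> 0 <= B -> smooth_on U phi ->
  bd Bs rho phi B a -> forall t : R, 0 <= t <= T ->
  ww n N * cabs (itint v m (wcut P n N (chi f p phi)) t) <=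
  eps * B * (rise2 a m)%:R * (cc ^+ m * (Wt G v t ^+ m / m`!%:R)).
Proof.
move=> Bp; have Up := BU Bp.
have G0 i : 0 <= G i.
  by rewrite divr_ge0 // mulr_ge0 ?(ltW w10) // exprn_ge0 // ltW.
elim: m phi B a n N => [|m ih] phi B a n N B0 sp bp t tT.
  rewrite /= expr0 fact0 divr1 !mulr1 /wcut !addn0; case: ifP => [/hP hw|_].
    by apply: ler_pM => //; [exact: ltW (ww_gt0 _ _)|exact: bd0 bp Bp].
  by rewrite cabs0 mulr0 mulr_ge0.
have /andP[t0 tT'] := tT.
have wN := ww_gt0 n N.
rewrite mulrC -ler_pdivlMr //.
pose A := eps * B * (rise2 a m.+1)%:R * cc ^+ m.+1 / ww n N.
have A0 : 0 <= A.
  apply: divr_ge0; last exact: ltW.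
  apply: mulr_ge0; last by rewrite exprn_ge0 // cc0.
  by apply: mulr_ge0 => //; apply: mulr_ge0.
have aW' := aW G iv.
have aV := AC_Z (A : Defs.K R RealScalars) (AC_dpow m T0 aW').
have aX := itint_AC T0 iv m.+1 (wcut P n N (chi f p phi)).
have := AC_le aX aV (lexx 0) t0 tT'.
rewrite {1}Wt_0 expr0n mul0r mulr0 subr0 [itint _ _ _ 0]/= intK00 subr0 => key.
apply: (le_trans (key _)) => [s s0 st|]; last first.
  by rewrite /A; move: (_ / m.+1`!%:R) (_^-1) (_ ^+ m.+1) => y z y'; rewrite le_eqVlt; apply/orP; left; apply/eqP; ring.
have sT : 0 <= s <= T by rewrite (ltW s0) (le_trans (ltW st)).
rewrite /itint_dens; apply: (le_trans (cabs_sum _ _ _)).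
rewrite [leRHS]mulrA /wt mulr_sumr; apply: ler_sum => i _.
have sG : vsm U (f i) := hf i.
have sp1 := smooth_Lop oU sG sp.
have bp1 := bd_Lop oU BU rho0 sG sp (F0 (Gen i)) B0 (hF (Gen i)) bp.
have B1 : 0 <= d%:R * (F (Gen i) * (B * a%:R / rho)).
  by rewrite mulr_ge0 // mulr_ge0 ?F0 // divr_ge0 ?(ltW rho0) // mulr_ge0.
have := ih _ _ _ (n + 1)%N (N + (i != ord0))%N B1 sp1 bp1 s sT.
rewrite (tau_wcut P n N (Gen i)) -(chi_vf (Gen i) oU hf sp Up) cabsM.
set Y := cabs (itint _ _ _ _) => hY.
rewrite !exprD expr1 in hY.
set w' := w1 * w2 ^+ (i != ord0).
have w'0 : 0 < w' by rewrite mulr_gt0 // exprn_gt0.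
have Y0 : 0 <= Y := cabs_ge0 _.
rewrite [leRHS]mulrA [cabs _ * Y]mulrC; apply: ler_wpM2r => //.
rewrite -(ler_pM2l (mulr_gt0 wN w'0)); apply: le_trans (_ : _ <= eps * (d%:R * (F (Gen i) * (B * a%:R / rho))) * (rise2 a.+2 m)%:R * (cc ^+ m * (Wt G v s ^+ m / m`!%:R))) _.
  by apply: le_trans hY; rewrite le_eqVlt; apply/orP; left; apply/eqP; rewrite /w'; ring.
rewrite le_eqVlt; apply/orP; left; apply/eqP.
rewrite /A exprS [rise2 a m.+1]/= natrM.
have : ww n N != 0 by rewrite gt_eqF.
have : w' != 0 by rewrite gt_eqF.
have : rho != 0 by rewrite gt_eqF.
move: (ww n N) (cc ^+ m) (Wt _ _ _ ^+ m / _) (rise2 _ _)%:R => y1 y3 y4 y5 n1 n2 n3.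
move: n2; move: w' w'0 => y2 _ n2; field; by rewrite n1 n2 n3.
Qed.
End Weights.
End Expand.

(** * Flows and finite products of exponentials *)

Lemma Rint_cst (R : realType) (a t : R) : 0 <= t ->
  \int[@lebesgue_measure R]_(s in `]0, t[) a = a * t.
Proof.
move=> t0; have m : @lebesgue_measure R `]0, t[%classic = t%:E.
  rewrite lebesgue_measure_itv /= lte_fin; case: ltgtP t0 => // [_ _|<- _] //.
  by rewrite -EFinB subr0.
transitivity (a * fine (@lebesgue_measure R `]0, t[%classic)); last by rewrite m.
by apply: Rintegral_cst.
Qed.

Section Step.
Variables (R : realType) (k : scalars) (d : nat).
Local Notation K := (K R k).
Local Notation V := 'rV[K]_d.
Local Notation mu := (@lebesgue_measure R).
Variables (U : set V) (oU : open U) (Bs : set V) (BU : Bs `<=` U) (p0 : V) (dl rho : R).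
Local Notation Om := (fun x : V => nrm1 (x - p0) <= dl).
Hypothesis OmB : forall x, Om x -> Bs x.
Hypothesis rho0 : 0 < rho.
Variables (h : V -> V) (G : R).
Hypothesis sh : vsm U h.
Hypothesis G0 : 0 <= G.
Hypothesis hG : forall j, bd Bs rho (fun x => h x 0 j) G 1.
Variable c : K.
Local Notation cc := (d%:R / rho).
Local Notation g := (fun _ : 'I_1 => h).
Local Notation Gc := (fun _ : 'I_1 => G).
Local Notation v := (fun (_ : 'I_1) (_ : R) => c).

Lemma int_cst (T : R) : integrableK `]0, T[ (fun=> c).
Proof.
by apply: eq_integrableK (AC_Z c (AC_time k T)).1 => // x _; rewrite mulr1.
Qed.

Lemma Wt_cst (t : R) : 0 <= t -> Wt Gc v t = G * cabs c * t.
Proof. by move=> t0; rewrite /Wt big_ord1 Rint_cst // mulrA. Qed.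

Lemma chen_cst p j phi (t : R) : 0 <= t -> chen g v p j phi t =
  c ^+ j * (ofR k t ^+ j / j`!%:R) * iter j (Lop h) phi p.
Proof.
elim: j phi t => [|j ih] phi t t0; first by rewrite /= !expr0 fact0 divr1 !mul1r.
have aT := AC_dpow j t0 (AC_time k t).
have := aT.2 t; rewrite t0 lexx rmorph0 expr0n mul0r add0r => /(_ isT) ->.
transitivity (integralK `]0, t[ (fun s => \sum_(i < 1) c * chen g v p j (Lop h phi) s)); first by [].
transitivity (integralK `]0, t[ (fun s => c ^+ j.+1 * iter j.+1 (Lop h) phi p *
   (ofR k s ^+ j / j`!%:R * 1))).
  apply: eq_integralK => s; rewrite /= in_itv /= => /andP[s0 _].
  rewrite big_ord1 ih ?(ltW s0) // mulr1 exprS -iterSr /=.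
  by move: (_ / _) (c ^+ j) (Lop _ _ _) => y z y'; ring.
rewrite integralKZ //; last exact: aT.1.
by rewrite mulrAC.
Qed.

Variable z : V.
Hypothesis small1 : nrm1 (z - p0) + d%:R * (G * cabs c) <= dl.
Hypothesis small2 : d%:R * (G * cabs c) / rho <= 1 / 2.

Let T01 : (0 : R) <= 1. Proof. exact: ler01. Qed.

(** The right-hand side is Lipschitz along the solution, so the integral
    equation gives a derivative at every time, including the end points. *)
Lemma quad_bound (x : R -> V) : sol p0 dl g 1 v x z -> exists2 D : R, 0 <= D &
  forall (a b w : R) j, 0 <= a -> a <= w -> w <= b -> b <= 1 ->
  cabs (x b 0 j - x a 0 j - ofR k (b - a) * (c * h (x w) 0 j)) <= D * (b - a) ^+ 2.
Proof.
move=> sx; have [x0 xOm xAC] := sx.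
pose B1 : R := d%:R * (G * (G * 1%:R / rho)).
have B10 : 0 <= B1 by rewrite mulr_ge0 // mulr_ge0 // mulr1 divr_ge0 // ltW.
pose D := cabs c * (cabs c * B1).
have D0 : 0 <= D by rewrite mulr_ge0 // mulr_ge0.
exists D => // a b w j a0 aw wb b1.
have ab : a <= b := le_trans aw wb.
have aH := sol_chain BU OmB rho0 T01 G0 sx (sh j) (hG j).
have hlip s t : 0 <= s -> s <= t -> t <= 1 ->
    cabs (h (x t) 0 j - h (x s) 0 j) <= cabs c * B1 * (t - s).
  move=> s0 st t1.
  have aV := AC_Z (cabs c * B1 : Defs.K R RealScalars) (AC_time RealScalars 1).
  rewrite mulrBr; apply: (AC_le aH aV s0 st t1) => r sr rt.
  rewrite big_ord1 cabsM mulr1 ler_wpM2l //.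
  have xr : Bs (x r).
    by apply: OmB; apply: xOm; rewrite (le_trans s0 (ltW sr)) (le_trans (ltW rt)).
  apply: (bd0 _ xr); have := bd_Lop oU BU rho0 sh (sh j) G0 G0 hG (hG j).
  exact.
pose Fr r := x r 0 j + - (c * h (x w) 0 j) * ofR k r.
have aF := AC_D (xAC j) (AC_Z (- (c * h (x w) 0 j)) (AC_time k 1)).
have aV := AC_Z (D * (b - a) : Defs.K R RealScalars) (AC_time RealScalars 1).
have := AC_le aF aV a0 ab b1 _; rewrite -mulrBr => key.
rewrite rmorphB /=.
rewrite [X in cabs X](_ : _ = x b 0 j + - (c * h (x w) 0 j) * ofR k b - (x a 0 j + - (c * h (x w) 0 j) * ofR k a)); last by ring.
rewrite expr2 mulrA; apply: key => r ar rb.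
rewrite /Fld big_ord1 !mulr1 -mulrBr cabsM /D -mulrA; apply: ler_wpM2l => //.
have [rw|wr] := leP r w.
  rewrite cabsB; apply: (le_trans (hlip r w _ rw _)); rewrite ?(le_trans a0 (ltW ar)) ?(le_trans wb) //.
  by apply: ler_wpM2l; [rewrite mulr_ge0|lra].
apply: (le_trans (hlip w r _ (ltW wr) _)); rewrite ?(le_trans a0 aw) ?(le_trans (ltW rb)) //.
by apply: ler_wpM2l; [rewrite mulr_ge0|lra].
Qed.

Lemma sol_flow (x : R -> V) : sol p0 dl g 1 v x z -> flow U (fun y => c *: h y) z (x 1).
Proof.
move=> sx; have [x0 xOm xAC] := sx; exists x; split=> // t t01.
split; first by apply: BU; apply: OmB; exact: xOm.
have [D D0 hD] := quad_bound sx; have /andP[t0 t1] := t01.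
have key (s : R) : 0 <= s <= 1 -> nrm1 (x s - x t - ofR k (s - t) *: (c *: h (x t))) <= d%:R * D * `|s - t| ^+ 2.
  move=> /andP[s0 s1]; rewrite /nrm1 -mulrA -[d in d%:R * _](card_ord d) mulr_natl -sumr_const.
  apply: ler_sum => j _; rewrite !mxE.
  have [st|ts] := leP s t.
    have := hD s t t j s0 st (lexx _) t1; rewrite real_normK ?num_real // -[(s - t) ^+ 2]sqrrN opprB.
    rewrite -cabsN !rmorphB /=; apply: le_trans; rewrite le_eqVlt; apply/orP; left; apply/eqP; congr cabs; ring.
  have := hD t s t j t0 (lexx _) (ltW ts) s1; rewrite real_normK ?num_real //.
apply/cvgV_P => e e0; rewrite near_withinE.
have e1 : 0 < e / (d%:R * D + 1) by rewrite divr_gt0 // ltr_wpDl // mulr_ge0.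
near=> s => s01.
have st : s != t by near: s; exact: nbhs_dnbhs_neq.
have ste : `|s - t| < e / (d%:R * D + 1).
  near: s; apply: nbhs_dnbhs; exists (e / (d%:R * D + 1)) => //= s /=.
  by rewrite distrC.
have st0 : 0 < `|s - t| by rewrite normr_gt0 subr_eq0.
have sK : ofR k (s - t) != 0.
  by apply/eqP => h0; move: st0; rewrite -(cabs_ofR k) h0 cabs0 ltxx.
have -> : ofR k (s - t)^-1 *: (x s - x t) - c *: h (x t) =
   ofR k (s - t)^-1 *: (x s - x t - ofR k (s - t) *: (c *: h (x t))).
  by rewrite [RHS]scalerBr; congr (_ - _); rewrite [RHS]scalerA -rmorphM mulVf ?subr_eq0 // rmorph1 scale1r.
rewrite nrm1Z cabs_ofR normfV -(ltr_pM2l st0) mulrA mulfV ?gt_eqF // mul1r.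
apply: le_lt_trans (key s _) _; first by move: s01; rewrite /= in_itv.
rewrite expr2 mulrCA ltr_pM2l //; apply: (@le_lt_trans _ _ ((d%:R * D + 1) * `|s - t|)).
  by rewrite ler_wpM2r // lerDl.
by rewrite mulrC -ltr_pdivlMr // ltr_wpDl // mulr_ge0.
Unshelve. all: by end_near. Qed.

(** The flow of c *: h at time 1 is the system on [0,1] with the single
    constant control c; its Chen expansion is the exponential series. *)
Lemma flow_step : exists y, [/\ flow U (fun y => c *: h y) z y,
  nrm1 (y - p0) <= nrm1 (z - p0) + d%:R * (G * cabs c) &
  forall phi B a m, 0 <= B -> smooth_on U phi -> bd Bs rho phi B a ->
  cabs (phi y - \sum_(j < m) c ^+ j / j`!%:R * iter j (Lop h) phi z) <=
  B * (rise2 a m)%:R * (cc ^+ m * ((G * cabs c) ^+ m / m`!%:R))].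
Proof.
have W1 : Wt Gc v 1 = G * cabs c by rewrite Wt_cst // mulr1.
have [x sx] : exists x, sol p0 dl g 1 v x z.
  by apply: (sol_exists BU OmB rho0 (fun=> sh) (fun=> G0) (fun=> hG)) => //;
    [move=> _; exact: int_cst|rewrite W1|rewrite W1].
exists (x 1); split; first exact: sol_flow.
  have := sol_lip OmB (fun=> hG) (fun=> int_cst 1) sx (lexx 0) T01 (lexx 1).
  rewrite W1 Wt_0 subr0; case: sx => -> _ _ hl.
  by apply: le_trans (nrm1_tri _ z _) _; rewrite addrC lerD.
move=> phi B a m B0 sp bp.
have := chen_rem oU BU OmB rho0 (fun=> sh) (fun=> G0) (fun=> hG) T01 (fun=> int_cst 1) sx m B0 sp bp.
move=> /(_ 1); rewrite ler01 lexx W1 -!mulrA => /(_ isT); apply: le_trans.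
rewrite le_eqVlt; apply/orP; left; apply/eqP; congr (cabs (_ - _)).
by apply: eq_bigr => j _; rewrite chen_cst // rmorph1 expr1n mul1r.
Qed.
End Step.

Section Product.
Variables (R : realType) (k : scalars) (d q : nat).
Local Notation K := (K R k).
Local Notation V := 'rV[K]_d.
Variables (U : set V) (oU : open U) (Bs : set V) (BU : Bs `<=` U) (p0 : V) (dl rho : R).
Local Notation Om := (fun x : V => nrm1 (x - p0) <= dl).
Hypothesis OmB : forall x, Om x -> Bs x.
Hypothesis rho0 : 0 < rho.
Variables (f : 'I_q.+1 -> V -> V) (F : br q -> R).
Hypothesis hf : forall i, vsm U (f i).
Hypothesis F0 : forall b, 0 <= F b.
Hypothesis hF : forall b j, bd Bs rho (fun x => vf f b x 0 j) (F b) 1.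
Local Notation cc := (d%:R / rho).
Variable x : br q -> K.
Local Notation Sg s := (\sum_(b <- s) F b * cabs (x b)).

(** The errors of the successive factors add up to a binomial expansion,
    because rise2 is multiplicative (rise2_add). *)
Lemma oprod_expand p s : Om p -> nrm1 (p - p0) + d%:R * Sg s <= dl ->
  d%:R * Sg s / rho <= 1 / 2 ->
  exists y, [/\ oprod U (fun b y => x b *: vf f b y) s p y,
    nrm1 (y - p0) <= nrm1 (p - p0) + d%:R * Sg s &
    forall phi B a m, 0 <= B -> smooth_on U phi -> bd Bs rho phi B a ->
    cabs (phi y - \sum_(j < m) taylor_term x s j (chi f p phi)) <=
    B * (rise2 a m)%:R * (cc ^+ m * (Sg s ^+ m / m`!%:R))].
Proof.
move=> pOm; elim: s => [|b s ih] h1 h2.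
  exists p; split; rewrite ?big_nil ?mulr0 ?addr0 // => phi B a m B0 sp bp.
  case: m => [|m].
    rewrite big_ord0 subr0 /= fact0 !expr0 divr1 !mulr1.
    by apply: bd0 bp _; exact: OmB.
  rewrite big_ord_recl /= big1 // addr0 subrr cabs0 expr0n mul0r !mulr0 //.
have FX b' : 0 <= F b' * cabs (x b') by rewrite mulr_ge0.
have S0 : 0 <= Sg s by apply: sumr_ge0.
rewrite big_cons in h1 h2.
have d0 : 0 <= d%:R :> R := ler0n _ _.
have [||z [oz wocc hz]] := ih.
- by apply: le_trans h1; rewrite lerD2l ler_wpM2l // lerDr.
- by apply: le_trans h2; rewrite ler_pM2r ?invr_gt0 // ler_wpM2l // lerDr.
have [||y [fy ny hy]] := flow_step oU BU OmB rho0 (vsm_vf oU hf b) (F0 b) (hF b) (c := x b) (z := z).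
- apply: le_trans h1; rewrite mulrDr [d%:R * _ + _]addrC addrA; exact: lerD.
- by apply: le_trans h2; rewrite ler_pM2r ?invr_gt0 // ler_wpM2l // lerDl.
exists y; split; first by exists z.
  by rewrite big_cons mulrDr [d%:R * _ + _]addrC addrA; apply: le_trans ny _; rewrite lerD2r.
move=> phi B a m B0 sp bp.
have Up : U p by apply: BU; exact: OmB.
pose Lk j := iter j (Lop (vf f b)) phi.
pose c0 j := x b ^+ j / j`!%:R.
rewrite [\sum_(j < m) _](_ : _ = \sum_(j < m) c0 j * \sum_(i < m - j) taylor_term x s i (chi f p (Lk j))); last first.
  rewrite /= (triangle (fun j i => x b ^+ j / j`!%:R * taylor_term x s i (iter j (tau b) (chi f p phi)))).
  by apply: eq_bigr => j _; rewrite -mulr_sumr (chi_iter oU hf b j Up sp).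
apply: (le_trans (cabs_tri _ (\sum_(j < m) c0 j * Lk j z - \sum_(j < m) c0 j * \sum_(i < m - j) taylor_term x s i (chi f p (Lk j))))).
rewrite opprB addrA subrK -sumrB.
have e1 := hy phi B a m B0 sp bp.
have e2 : cabs (\sum_(j < m) (c0 j * Lk j z - c0 j * \sum_(i < m - j) taylor_term x s i (chi f p (Lk j)))) <=
   \sum_(j < m) B * (rise2 a m)%:R * cc ^+ m * ((F b * cabs (x b)) ^+ j / j`!%:R * (Sg s ^+ (m - j) / (m - j)`!%:R)).
  apply: (le_trans (cabs_sum _ _ _)); apply: ler_sum => j _.
  have jm : (j <= m)%N by rewrite ltnW.
  have [sj bj] := iter_Lop oU BU rho0 hf F0 hF b j B0 sp bp.
  have Bj : 0 <= B * (rise2 a j)%:R * (cc * F b) ^+ j.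
    by rewrite mulr_ge0 ?mulr_ge0 // exprn_ge0 // mulr_ge0 // divr_ge0 // ltW.
  rewrite -mulrBr cabsM; apply: (le_trans (ler_wpM2l (cabs_ge0 _) (hz _ _ _ (m - j)%N Bj sj bj))).
  have ccE : cc ^+ m = cc ^+ j * cc ^+ (m - j) by rewrite -exprD subnKC.
  rewrite /c0 cabsM cabs_natV cabsX (rise2_add a jm) natrM ccE ![(_ * F b) ^+ _]exprMn ![(F b * _) ^+ _]exprMn.
  move: (Sg s ^+ _ / _) (cabs (x b) ^+ j) (F b ^+ j) (rise2 _ _)%:R (rise2 _ _)%:R => y1 y2 y3 y4 y5.
  move: (cc ^+ j) (cc ^+ (m - j)) (j`!%:R^-1) => y6 y7 y8.
  by rewrite le_eqVlt; apply/orP; left; apply/eqP; ring.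
apply: (le_trans (lerD e1 e2)).
rewrite big_cons binom_dp big_ord_recr /= subnn expr0 fact0 divr1 mulr1.
rewrite -mulr_sumr; move: (\sum_(j < m) _) ((F b * _) ^+ m / m`!%:R) (cc ^+ m) => S D C.
by rewrite le_eqVlt; apply/orP; left; apply/eqP; ring.
Qed.
End Product.

(** * Counting trees and enumerating a Hall set *)

Section Trees.
Variables (q : nat).
Implicit Types b : br q.

Fixpoint trees n : seq (br q) :=
  if n is n'.+1 then [seq Gen i | i <- enum 'I_q.+1] ++ [seq Pair a b | a <- trees n', b <- trees n']
  else [::].

Lemma trees_len b n : (len b <= n)%N -> b \in trees n.
Proof.
elim: n b => [|n ih] b; first by rewrite leqNgt len_gt0.
rewrite [trees _]/= mem_cat; case: b => [i|a b] h.
  by apply/orP; left; apply: map_f; rewrite mem_enum.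
apply/orP; right; apply/allpairsP; exists (a, b).
have := len_gt0 a; have := len_gt0 b; move: h; rewrite [len _]/= => h h1 h2.
by split=> //; apply: ih; move: h h1 h2; clear; rewrite /=; lia.
Qed.

Variable R : realType.

Lemma uniq_sub_sum (g : br q -> R) (s t : seq (br q)) : (forall b, 0 <= g b) ->
  uniq s -> {subset s <= t} -> \sum_(b <- s) g b <= \sum_(b <- t) g b.
Proof.
move=> g0; elim: s t => [|b s ih] t; first by rewrite big_nil sumr_ge0.
move=> /= /andP[bs us] st.
have bt : b \in t by apply: st; rewrite mem_head.
rewrite big_cons (perm_big _ (perm_to_rem bt)) big_cons /= lerD2l; apply: ih => // c cs.
have := st c; rewrite in_cons cs orbT (perm_mem (perm_to_rem bt)) in_cons => /(_ isT) /orP[/eqP e|//].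
by move: bs; rewrite -e cs.
Qed.

(** The sum S over the trees of depth at most n becomes (q+1) x + S^2 at
    depth n + 1, and this map preserves the interval from 0 to 2 (q+1) x. *)
Lemma tree_sum (x : R) (s : seq (br q)) : 0 <= x -> 4 * q.+1%:R * x <= 1 -> uniq s ->
  \sum_(b <- s) x ^+ len b <= 2 * q.+1%:R * x.
Proof.
move=> x0 hx us; set a := q.+1%:R * x.
have a0 : 0 <= a by rewrite mulr_ge0.
have ha : 4 * a <= 1 by rewrite mulrA.
have key n : \sum_(b <- trees n) x ^+ len b <= 2 * a.
  elim: n => [|n ih]; first by rewrite big_nil mulr_ge0.
  rewrite [trees _]/= big_cat /=.
  have -> : \sum_(b <- [seq Gen i | i <- enum 'I_q.+1]) x ^+ len b = a.
    rewrite big_map big_enum /= (eq_bigr (fun=> x)); last by move=> i _; rewrite expr1.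
    by rewrite sumr_const card_ord /a mulr_natl.
  rewrite (big_allpairs_dep (h := @Pair q) (r1 := trees n) (r2 := fun=> trees n) (F := fun b => x ^+ len b)).
  set S := \sum_(b <- trees n) x ^+ len b in ih *.
  have S0 : 0 <= S by apply: sumr_ge0 => b _; rewrite exprn_ge0.
  rewrite (eq_bigr (fun b => x ^+ len b * S)); last first.
    by move=> b _; rewrite /S mulr_sumr; apply: eq_bigr => c _; rewrite /= exprD.
  rewrite -mulr_suml -/S.
  have : S * S <= 2 * a * (2 * a) by apply: ler_pM.
  nra.
have [n hn] : exists n, {subset s <= trees n}.
  exists (\sum_(b <- s) len b)%N => b bs; apply: trees_len.
  by rewrite (big_rem b bs) /= leq_addr.
rewrite -mulrA -/a; apply: le_trans (key n); apply: uniq_sub_sum => // b.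
by rewrite exprn_ge0.
Qed.

End Trees.

Section Enum.
Variables (q : nat) (B : set (br q)) (le : rel (br q)).
Hypothesis hB : hall_set B le.

(** Only finitely many brackets have a given length, and le is total on the
    Hall set. *)
Lemma enum_hall (L M : nat) : exists J : seq (br q),
  (forall b, b \in J <-> B b /\ in_range L M (len b) (nocc b)) /\ pairwise (slt le) J.
Proof.
pose P b := `[< B b >] && in_range L M (len b) (nocc b).
pose s := undup [seq b <- trees q L | P b].
have ms b : b \in s <-> B b /\ in_range L M (len b) (nocc b).
  rewrite /s mem_undup mem_filter; split=> [/andP[/andP[/asboolP]]//|[Bb h]].
  apply/andP; split; first by apply/andP; split=> //; exact/asboolP.
  by apply: trees_len; case/andP: h.
exists (sort le s); split=> [b|]; first by rewrite mem_sort.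
have sB : {in s, forall b, B b} by move=> b /ms[].
have so : sorted le (sort le s).
  by apply: (@sort_sorted_in _ (mem s)) => [a b /sB Ba /sB Bb|]; [apply/orP; exact: (hall_total hB)|exact/allP].
have tr : {in sort le s & &, transitive le}.
  move=> b a c; rewrite !mem_sort => /sB Bb /sB Ba /sB coord_bound; exact: (hall_trans hB).
have pw : pairwise le (sort le s) by rewrite -(sorted_pairwise_in tr) //; exact/allP.
have un : uniq (sort le s) by rewrite sort_uniq undup_uniq.
move: un pw; rewrite uniq_pairwise; elim: (sort le s) => //= a l ih /andP[/allP h1 h2] /andP[/allP h3 h4].
rewrite ih // andbT; apply/allP => b bl; apply/andP; split; [exact: h1|exact: h3].
Qed.

Lemma pairwise_eq (s t : seq (br q)) : (forall b, b \in s -> B b) ->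
  pairwise (slt le) s -> pairwise (slt le) t -> s =i t -> s = t.
Proof.
move=> sB ps pt st.
have tr : {in s & &, transitive (slt le)}.
  by move=> b a c /sB Bb /sB Ba /sB coord_bound; exact: (slt_trans hB Ba Bb coord_bound).
apply: (irr_sorted_eq_in tr) => //; [|exact: pairwise_sorted|exact: pairwise_sorted].
by move=> b _; rewrite /slt eqxx.
Qed.
End Enum.

Section Numbers.
Variable R : realType.

Lemma geo_sum n : \sum_(j < n) (1 / 4 : R) ^+ j <= 2.
Proof.
suff : \sum_(j < n) (1 / 4 : R) ^+ j <= 4 / 3 * (1 - (1 / 4) ^+ n).
  have : 0 <= (1 / 4 : R) ^+ n by rewrite exprn_ge0.
  by move: (_ ^+ n) (\sum_(i < n) _) => y S; lra.
elim: n => [|n ih]; first by rewrite big_ord0 expr0; lra.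
rewrite big_ord_recr /= exprS; move: ih; have : 0 <= (1 / 4 : R) ^+ n by rewrite exprn_ge0.
move: (_ ^+ n) (\sum_(i < n) _) => y S; lra.
Qed.

Lemma rise2_small (x : R) m : 0 <= x -> x <= 1 / 8 ->
  (rise2 1 m)%:R * (x ^+ m / m`!%:R) <= (1 / 4) ^+ m.
Proof.
move=> x0 hx; have f0 : 0 < m`!%:R :> R by rewrite ltr0n fact_gt0.
apply: (@le_trans _ _ ((2 ^ m * m`!)%:R * (x ^+ m / m`!%:R))).
  by apply: ler_wpM2r; [rewrite divr_ge0 // exprn_ge0|rewrite ler_nat rise2_1].
rewrite natrM -mulrA [m`!%:R * _]mulrC divfK ?gt_eqF // natrX -exprMn.
by rewrite lerXn2r ?nnegrE ?mulr_ge0 //; lra.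
Qed.

(** Used to let an upper bound of the norm of the control decrease to the
    norm. *)
Lemma pow_near (N e : R) m : 0 <= N -> 0 <= e -> exists2 Q : R, 0 <= Q &
  forall s : R, 0 <= s -> s <= 1 -> (N + e * s) ^+ m <= N ^+ m + s * Q.
Proof.
move=> N0 e0; elim: m => [|m [Q Q0 ih]]; first by exists 0 => // s _ _; rewrite !expr0 mulr0 addr0.
exists (e * N ^+ m + Q * (N + e)); first by rewrite addr_ge0 ?mulr_ge0 ?exprn_ge0 ?addr_ge0.
move=> s s0 s1; rewrite !exprS.
have := ih s s0 s1; have : 0 <= N ^+ m by rewrite exprn_ge0.
have : 0 <= N + e * s by rewrite addr_ge0 // mulr_ge0.
move: (N ^+ m) (_ ^+ m) => y z h0 y0 hz.
have := ler_wpM2l h0 hz; move/le_trans; apply.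
have : 0 <= Q * e * s * (1 - s) by rewrite !mulr_ge0 // subr_ge0.
nra.
Qed.

(** Only the factorial of the number of X_0, which the divided power of t
    provides, is left to be compensated. *)
Lemma fact_split q (b : br q) M : (nocc b <= M)%N ->
  ((len b)`!%:R : R) <= 2 ^+ len b * (nocc0 b)`!%:R * M`!%:R.
Proof.
move=> h; rewrite -natrX -!natrM ler_nat -(nocc0_nocc b).
rewrite -(bin_fact (leq_addr (nocc b) (nocc0 b))) addKn -mulnA; apply: leq_mul; first exact: bin_le2.
by rewrite leq_mul2l; apply/orP; right; rewrite leq_fact.
Qed.
End Numbers.

(** * Truncated products on a Hall set *)

Section Est.
Variables (R : realType) (k : scalars) (d q : nat).
Local Notation K := (K R k).
Local Notation V := 'rV[K]_d.
Variables (U : set V) (oU : open U) (Bs : set V) (BU : Bs `<=` U) (p : V) (dl rho : R).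
Local Notation Om := (fun x : V => nrm1 (x - p) <= dl).
Hypothesis OmB : forall x, Om x -> Bs x.
Hypothesis dl0 : 0 <= dl.
Hypothesis rho0 : 0 < rho.
Variables (f : 'I_q.+1 -> V -> V) (F : br q -> R).
Hypothesis hf : forall i, vsm U (f i).
Hypothesis F0 : forall b, 0 <= F b.
Hypothesis hF : forall b j, bd Bs rho (fun x => vf f b x 0 j) (F b) 1.
Local Notation cc := (d%:R / rho).
Variables (B : set (br q)) (le : rel (br q)).
Hypothesis hB : hall_set B le.
Variable M : nat.
Variable x : br q -> K.
Variables (lam : br q -> R) (Lam theta : R).
Hypothesis lam0 : forall b, 0 <= lam b.
Hypothesis hLam : forall s, uniq s -> \sum_(b <- s) lam b <= Lam.
Hypothesis hcL : cc * Lam <= 1 / 8.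
Hypothesis hdL : d%:R * Lam <= dl.
Hypotheses (th0 : 0 < theta) (th1 : theta <= 1).
Hypothesis hx : forall b, B b -> (nocc b <= M)%N ->
  cabs (x b) * F b <= (1 / 2) ^+ len b * theta ^+ nocc b * lam b.

Let half0 : 0 < 1 / 2 :> R. Proof. lra. Qed.

Lemma Om_p : nrm1 (p - p) <= dl. Proof. by rewrite subrr nrm1_0. Qed.
Let Bp : Bs p. Proof. exact: OmB Om_p. Qed.

Local Notation h := (fun b y => x b *: vf f b y).
Local Notation ok y s := (forall phi (A : R) m, 0 <= A -> smooth_on U phi -> bd Bs rho phi A 1 ->
    cabs (phi y - \sum_(j < m) taylor_term x s j (chi f p phi)) <= A * (1 / 4) ^+ m).

Lemma cc_ge0 : 0 <= cc. Proof. by rewrite divr_ge0 // ltW. Qed.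

(** The bound is uniform in the finite set s: this is where summability over
    all brackets is used. *)
Lemma prod_ok s : uniq s -> (forall b, b \in s -> B b /\ (nocc b <= M)%N) ->
  exists2 y, oprod U h s p y & ok y s.
Proof.
move=> us hs; set S := \sum_(b <- s) F b * cabs (x b).
have S0 : 0 <= S by apply: sumr_ge0 => b _; rewrite mulr_ge0.
have SL : S <= Lam.
  apply: le_trans (hLam us); rewrite /S big_seq [leRHS]big_seq; apply: ler_sum => b bs.
  have [Bb nb] := hs b bs; rewrite mulrC; apply: (le_trans (hx Bb nb)).
  rewrite ler_piMl //; apply: mulr_ile1.
  - by apply: exprn_ge0; exact: ltW.
  - by apply: exprn_ge0; exact: ltW.
  - by apply: exprn_ile1; lra.
  - by apply: exprn_ile1 => //; exact: ltW.
have h1 : d%:R * S <= d%:R * Lam by rewrite ler_wpM2l.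
have h2 : cc * S <= 1 / 8 by apply: le_trans hcL; rewrite ler_wpM2l // cc_ge0.
have [||y [oy _ hy]] := oprod_expand oU BU OmB rho0 hf F0 hF (x := x) (s := s) Om_p.
- by rewrite subrr nrm1_0 add0r (le_trans h1).
- by rewrite mulrAC; apply: le_trans h2 _; lra.
exists y => // phi A m A0 sp bp; apply: (le_trans (hy _ _ _ m A0 sp bp)).
rewrite -/S -mulrA ler_wpM2l // mulrA -[_ * cc ^+ m * _]mulrA [cc ^+ m * _]mulrA -exprMn.
by apply: rise2_small => //; rewrite mulr_ge0 // cc_ge0.
Qed.

(** The word function splits into its restriction to D, on which the series
    terminates, and the rest, whose weight is at most eps. *)
Lemma trunc s phi (A eps : R) (D : nat -> nat -> bool) L Mm :
  uniq s -> (forall b, b \in s -> B b /\ (nocc b <= M)%N) ->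
  0 <= A -> smooth_on U phi -> bd Bs rho phi A 1 -> 0 <= eps ->
  wsup L Mm (wcut D 0 0 (chi f p phi)) ->
  (forall n N, ~~ D n N -> (1 / 2) ^+ n * theta ^+ N <= eps) ->
  cabs (\sum_(j < L.+1) taylor_term x s j (chi f p phi) - expprod x L s (wcut D 0 0 (chi f p phi)))
  <= 2 * eps * A.
Proof.
move=> us hs A0 sp bp e0 + hD; set c := chi f p phi => hw.
have cE : c = wcut D 0 0 c + wcut (fun n N => ~~ D n N) 0 0 c.
  apply/funext => w; transitivity (wcut D 0 0 c w + wcut (fun n N => ~~ D n N) 0 0 c w); last by [].
  by rewrite /wcut; case: (D _ _) => /=; rewrite ?addr0 ?add0r.
rewrite {1}cE (eq_bigr _ (fun (j : 'I_L.+1) _ => raddfD _ _ _)) big_split /=.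
rewrite (sum_taylor x s hw (ltnSn L) (leqnn L)) [expprod _ _ _ _ + _]addrC addrK.
apply: (le_trans (cabs_sum _ _ _)).
apply: (@le_trans _ _ (\sum_(j < L.+1) eps * A * (1 / 4) ^+ j)); last first.
  rewrite -mulr_sumr; have := ler_wpM2l (mulr_ge0 e0 A0) (geo_sum R L.+1).
  by rewrite [_ * 2]mulrC [2 * (_ * _)]mulrA.
apply: ler_sum => j _.
have := taylor_wcut_le oU BU rho0 hf F0 hF half0 th0 e0 hD lam0 0 0 j Bp A0 sp bp (x := x) (s := s).
rewrite !expr0 [1 * 1]mulr1 [1 * cabs _]mul1r => /(_ _)/le_trans; apply => [b bs|].
  by have [Bb nb] := hs b bs; exact: hx.
rewrite -mulrA ler_wpM2l ?mulr_ge0 //; apply: rise2_small; first by rewrite mulr_ge0 ?cc_ge0 ?sumr_ge0.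
by apply: le_trans hcL; rewrite ler_wpM2l ?cc_ge0 // hLam.
Qed.

Variable J : nat -> seq (br q).
Hypothesis hJ : forall L b, b \in J L <-> B b /\ in_range L M (len b) (nocc b).
Hypothesis sJ : forall L, pairwise (slt le) (J L).

(** The candidate for the value at p of the infinite product, up to an error
    of order 2^(-L): it only involves Lie derivatives along words of length at
    most L. *)
Definition gtrunc (L : nat) (phi : V -> K) : K :=
  expprod x L (J L) (wcut (fun n _ => (n <= L)%N) 0 0 (chi f p phi)).

Lemma wocc_size (w : seq 'I_q.+1) : (wocc w <= size w)%N.
Proof. exact: count_size. Qed.

Lemma wsup_len L (c : seq 'I_q.+1 -> K) : wsup L L (wcut (fun n _ => (n <= L)%N) 0 0 c).
Proof.
move=> w hw; rewrite /wcut !add0n; case: ifP => // h1; exfalso; move: hw h1 (wocc_size w).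
by rewrite /in_range; clear; lia.
Qed.

(** After truncation by length, only the elements of J L act, whatever the
    other factors of the product are. *)
Lemma near_gtrunc L s y : pairwise (slt le) s -> (forall b, b \in s -> B b /\ (nocc b <= M)%N) ->
  {subset J L <= s} -> ok y s ->
  forall phi (A : R), 0 <= A -> smooth_on U phi -> bd Bs rho phi A 1 ->
  cabs (phi y - gtrunc L phi) <= 2 * A / 2 ^+ L.
Proof.
move=> ps hs Js oy phi A A0 sp bp; have us := pw_uniq ps.
set c := wcut (fun n _ => (n <= L)%N) 0 0 (chi f p phi).
have JE : [seq b <- s | in_range L L (len b) (nocc b)] = J L.
  have sB b : b \in J L -> B b by case/hJ.
  apply/esym/(pairwise_eq hB sB) => //; first exact: pairwise_filter.
  move=> b; rewrite mem_filter; apply/idP/andP => [/[dup] bJ /hJ[Bb hD]|[hD /[dup] bs /hs[Bb nb]]].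
    by split; [move: hD (nocc_len b); rewrite /in_range; clear; lia|exact: Js].
  by apply/hJ; split=> //; move: hD nb; rewrite /in_range; clear; lia.
have EJ : expprod x L s c = gtrunc L phi.
  by rewrite (expprod_filter _ _ _ (@wsup_len L (chi f p phi))) JE.
have e0 : 0 <= (1 / 2) ^+ L.+1 :> R by rewrite exprn_ge0 // ltW.
have h1 : cabs (\sum_(j < L.+1) taylor_term x s j (chi f p phi) - expprod x L s c) <= 2 * (1 / 2) ^+ L.+1 * A.
  apply: (trunc us hs A0 sp bp e0 (@wsup_len L (chi f p phi))) => n N; rewrite -ltnNge => Ln.
  apply: (@le_trans _ _ ((1 / 2) ^+ n)); first by rewrite ler_piMr ?exprn_ge0 ?exprn_ile1 // ltW.
  by rewrite ler_wiXn2l //; lra.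
have h2 := oy phi A L.+1 A0 sp bp; rewrite EJ in h1.
apply: (le_trans (cabs_tri _ (phi y - \sum_(j < L.+1) taylor_term x s j (chi f p phi)))).
rewrite opprB addrC; set S := \sum_(j < _) _ in h1 h2 *.
rewrite [X in _ + cabs X](_ : _ = S - gtrunc L phi); last by ring.
apply: (le_trans (lerD h2 h1)).
have -> : (1 / 4 : R) = 1 / 2 * (1 / 2) by lra.
have -> : 2 * A / 2 ^+ L = 2 * A * (1 / 2) ^+ L by rewrite div1r exprVn.
rewrite exprMn !exprS; have : (1 / 2) ^+ L <= 1 :> R by rewrite exprn_ile1 //; lra.
have : 0 <= (1 / 2) ^+ L :> R by rewrite exprn_ge0 // ltW.
move: (_ ^+ L) => y0 h3 h4.
have : 0 <= A * y0 * (1 - y0) by rewrite !mulr_ge0 // subr_ge0.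
have : 0 <= A * y0 by rewrite mulr_ge0.
nra.
Qed.

Lemma J_sub L b : b \in J L -> B b /\ (nocc b <= M)%N.
Proof. by move/hJ => [Bb /andP[]]. Qed.

Lemma gtrunc_cauchy L phi (A : R) : 0 <= A -> smooth_on U phi -> bd Bs rho phi A 1 ->
  cabs (gtrunc L.+1 phi - gtrunc L phi) <= 4 * A / 2 ^+ L.
Proof.
move=> A0 sp bp.
have [y _ oy] := prod_ok (pw_uniq (sJ L.+1)) (@J_sub L.+1).
have h1 := near_gtrunc (sJ L.+1) (@J_sub L.+1) (fun b h => h) oy A0 sp bp.
have sub : {subset J L <= J L.+1}.
  by move=> b /hJ[Bb hD]; apply/hJ; split=> //; move: hD; rewrite /in_range; clear; lia.
have h2 := near_gtrunc (sJ L.+1) (@J_sub L.+1) sub oy A0 sp bp.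
rewrite [gtrunc L.+1 phi - _](_ : _ = - (phi y - gtrunc L.+1 phi) + (phi y - gtrunc L phi)); last by ring.
apply: (le_trans (cabsD _ _)); rewrite cabsN; apply: (le_trans (lerD h1 h2)).
rewrite exprS invfM; have : 0 <= A / 2 ^+ L by rewrite divr_ge0 // exprn_ge0.
rewrite ![_ * A]mulrC -!mulrA; move: (_ ^- L) => z; nra.
Qed.

(** Passes from the truncation in both degrees, where the algebraic identity
    holds, to the truncation by length, where the product converges. The errors
    are 3 (hypothesis), 2 (trunc), 1 (remainder of the product) and 4
    (near_gtrunc), in units of eps A. *)
Lemma near_sys phi (A eps : R) L (X : K) : 0 <= A -> smooth_on U phi -> bd Bs rho phi A 1 ->
  (1 / 2) ^+ L.+1 <= eps -> theta ^+ M.+1 <= eps ->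
  cabs (X - expprod x L (J L) (wcut (in_range L M) 0 0 (chi f p phi))) <= 3 * eps * A ->
  cabs (X - gtrunc L phi) <= 10 * eps * A.
Proof.
move=> A0 sp bp he1 he2 hX.
have e0 : 0 <= eps by apply: le_trans he1; rewrite exprn_ge0 // ltW.
have [y _ oy] := prod_ok (pw_uniq (sJ L)) (@J_sub L).
have h1 := near_gtrunc (sJ L) (@J_sub L) (fun b h => h) oy A0 sp bp.
have h2 : cabs (\sum_(j < L.+1) taylor_term x (J L) j (chi f p phi) -
    expprod x L (J L) (wcut (in_range L M) 0 0 (chi f p phi))) <= 2 * eps * A.
  apply: (trunc (pw_uniq (sJ L)) (@J_sub L) A0 sp bp e0 (@wsup_wcut _ _ L M _)) => n N.
  rewrite negb_and -!ltnNge => /orP[hn|hN].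
    apply: le_trans he1; apply: (@le_trans _ _ ((1 / 2) ^+ n)); first by rewrite ler_piMr ?exprn_ge0 ?exprn_ile1 // ltW.
    by rewrite ler_wiXn2l //; lra.
  apply: le_trans he2; apply: (@le_trans _ _ (theta ^+ N)).
    by rewrite ler_piMl ?exprn_ge0 ?exprn_ile1 // ?ltW //; lra.
  by rewrite ler_wiXn2l // ltW.
have h3 := oy phi A L.+1 A0 sp bp.
set S := \sum_(j < _) _ in h2 h3; set E := expprod _ _ _ _ in hX h2.
rewrite (_ : X - gtrunc L phi = (X - E) - (S - E) - (phi y - S) + (phi y - gtrunc L phi)); last by ring.
apply: (le_trans (cabsD _ _)); apply: (le_trans (lerD (cabsD _ _) h1)).
rewrite cabsN; apply: (le_trans (lerD (lerD (cabsD _ _) h3) (lexx _))); rewrite cabsN.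
apply: (le_trans (lerD (lerD (lerD hX h2) (lexx _)) (lexx _))).
have -> : 2 * A / 2 ^+ L = 4 * A * (1 / 2) ^+ L.+1.
  rewrite exprS div1r exprVn; move: (_ ^- L) => z; lra.
have h4 : (1 / 4) ^+ L.+1 <= eps.
  by apply: le_trans he1; rewrite lerXn2r ?nnegrE //; lra.
have := ler_wpM2l A0 h4; have := ler_wpM2l A0 he1.
move: (_ ^+ L.+1) (_ ^+ L.+1) => z1 z2; lra.
Qed.
End Est.

(** * The controlled system against the truncated products *)

Section SysEst.
Variables (R : realType) (k : scalars) (d q : nat).
Local Notation K := (K R k).
Local Notation V := 'rV[K]_d.
Variables (U : set V) (oU : open U) (Bs : set V) (BU : Bs `<=` U) (p : V) (dl rho : R).
Local Notation Om := (fun x : V => nrm1 (x - p) <= dl).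
Hypothesis OmB : forall x, Om x -> Bs x.
Hypothesis dl0 : 0 <= dl.
Hypothesis rho0 : 0 < rho.
Variables (f : 'I_q.+1 -> V -> V) (F : br q -> R).
Hypothesis hf : forall i, vsm U (f i).
Hypothesis F0 : forall b, 0 <= F b.
Hypothesis hF : forall b j, bd Bs rho (fun x => vf f b x 0 j) (F b) 1.
Local Notation cc := (d%:R / rho).
Variables (B : set (br q)) (le : rel (br q)).
Hypothesis hB : hall_set B le.
Variable M : nat.
Variable (T : R) (u : 'I_q -> R -> K).
Hypothesis T0 : 0 <= T.
Hypothesis iu : forall j, integrableK `]0, T[ (u j).

Lemma ctrl_int i : integrableK `]0, T[ (ctrl u i).
Proof. by rewrite /ctrl; case: (unlift ord0 i) => [j|]; [exact: iu|exact: (AC_time k T).1]. Qed.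

(** The Chen expansion depends on phi through its word function only. *)
Lemma chen_itint (v : 'I_q.+1 -> R -> K) j phi t : U p -> smooth_on U phi ->
  chen f v p j phi t = itint v j (chi f p phi) t.
Proof.
move=> Up; elim: j phi t => [//|j ih] phi t sp.
transitivity (integralK `]0, t[ (fun s => \sum_(i < q.+1) v i s * chen f v p j (Lop (f i) phi) s)); first by [].
transitivity (integralK `]0, t[ (fun s => \sum_(i < q.+1) v i s * itint v j (tau (Gen i) (chi f p phi)) s)); last by [].
apply: eq_integralK => s _; apply: eq_bigr => i _; rewrite ih; last exact: (smooth_Lop oU (hf i)).
by have -> := chi_vf (Gen i) oU hf sp Up.
Qed.

Lemma itintD j (c c' : seq 'I_q.+1 -> K) t : 0 <= t <= T ->
  itint (ctrl u) j (c + c') t = itint (ctrl u) j c t + itint (ctrl u) j c' t.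
Proof.
elim: j c c' t => [//|j ih] c c' t tT; have /andP[t0 tT'] := tT.
transitivity (integralK `]0, t[ (fun s => itint_dens (ctrl u) j.+1 c s + itint_dens (ctrl u) j.+1 c' s)); last first.
  by rewrite integralKD //; apply: intK_sub0 tT' _; apply: (itint_dens_int T0 ctrl_int j.+1).
apply: eq_integralK => s; rewrite /= in_itv /= => /andP[s0 st].
transitivity (\sum_(i < q.+1) (ctrl u i s * itint (ctrl u) j (tau (Gen i) c) s +
   ctrl u i s * itint (ctrl u) j (tau (Gen i) c') s)); last by rewrite big_split.
apply: eq_bigr => i _; rewrite -mulrDr; congr (_ * _).
transitivity (itint (ctrl u) j (tau (Gen i) c + tau (Gen i) c') s); first by [].
by apply: ih; rewrite (ltW s0) (le_trans (ltW st)).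
Qed.

Variables (theta eps : R).
Hypotheses (th0 : 0 < theta) (th1 : theta <= 1).
Hypothesis W1 : cc * Wt (fun i => F (Gen i)) (ctrl u) T <= 1 / 8.
Hypothesis W2 : cc * Wt (fun i => F (Gen i) / (1 / 2 * theta ^+ (i != ord0))) (ctrl u) T <= 1 / 8.
Variables (L : nat) (J : seq (br q)).
Hypothesis hJ : forall b, b \in J <-> B b /\ in_range L M (len b) (nocc b).
Hypothesis sJ : pairwise (slt le) J.
Hypothesis he1 : (1 / 2) ^+ L.+1 <= eps.
Hypothesis he2 : theta ^+ M.+1 <= eps.

Let half0 : 0 < 1 / 2 :> R. Proof. lra. Qed.

(** The part of the word function in range is handled by expprod_itint, the
    part out of range by itint_wcut_le. *)
Lemma sys_est (X : R -> V) phi (A : R) : sol p dl f T (ctrl u) X p ->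
  0 <= A -> smooth_on U phi -> bd Bs rho phi A 1 ->
  cabs (phi (X T) - expprod (fun b => xi u b T) L J (wcut (in_range L M) 0 0 (chi f p phi))) <= 3 * eps * A.
Proof.
move=> sX A0 sp bp.
have Bp : Bs p by apply: OmB; rewrite subrr nrm1_0.
have Up := BU Bp.
have e0 : 0 <= eps by apply: le_trans he1; rewrite exprn_ge0 // ltW.
have TT : 0 <= T <= T by rewrite T0 lexx.
have cc0 : 0 <= cc by rewrite divr_ge0 // ltW.
have G10 i : 0 <= F (Gen i) by exact: F0.
have hG1 i j : bd Bs rho (fun x => f i x 0 j) (F (Gen i)) 1 by exact: (hF (Gen i)).
have r1 := chen_rem oU BU OmB rho0 hf G10 hG1 T0 ctrl_int sX L.+1 A0 sp bp TT.
set c := chi f p phi.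
pose Pc := fun n N => ~~ in_range L M n N.
have cE : c = wcut (in_range L M) 0 0 c + wcut Pc 0 0 c.
  apply/funext => w; transitivity (wcut (in_range L M) 0 0 c w + wcut Pc 0 0 c w); last by [].
  by rewrite /wcut /Pc; case: (in_range _ _) => /=; rewrite ?addr0 ?add0r.
have E1 := expprod_itint hB hJ sJ T0 (xi_AC T0 iu) (xd := xi_dens u) (fun a b s => erefl) (xi0 u) (fun i t => erefl)
  ctrl_int (leqnn L) (@wsup_wcut _ _ L M c) TT.
rewrite E1; set S := \sum_(j < L.+1) itint _ j (wcut (in_range L M) 0 0 c) T.
have E2 : \sum_(j < L.+1) chen f (ctrl u) p j phi T = S + \sum_(j < L.+1) itint (ctrl u) j (wcut Pc 0 0 c) T.
  rewrite /S -big_split; apply: eq_bigr => j _.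
  by rewrite (chen_itint _ _ _ Up sp) -/c {1}cE itintD.
rewrite E2 in r1; set O := \sum_(j < L.+1) _ in r1.
rewrite (_ : _ - S = (phi (X T) - (S + O)) + O); last by ring.
apply: (le_trans (cabsD _ _)); apply: (le_trans (lerD r1 (lexx _))).
have h1 : A * (rise2 1 L.+1)%:R * cc ^+ L.+1 * (Wt (fun i => F (Gen i)) (ctrl u) T ^+ L.+1 / L.+1`!%:R) <= A * eps.
  rewrite -!mulrA ler_wpM2l // mulrA -[_ * cc ^+ _ * _]mulrA [cc ^+ _ * _]mulrA -exprMn.
  have w0 := Wt_ge0 G10 ctrl_int T0 (lexx T).
  apply: (le_trans (rise2_small _ (mulr_ge0 cc0 w0) W1)); apply: le_trans he1.
  by rewrite lerXn2r ?nnegrE //; lra.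
have h2 : cabs O <= 2 * eps * A.
  apply: (le_trans (cabs_sum _ _ _)).
  apply: (@le_trans _ _ (\sum_(j < L.+1) eps * A * (1 / 4) ^+ j)); last first.
    rewrite -mulr_sumr; have := ler_wpM2l (mulr_ge0 e0 A0) (geo_sum R L.+1).
    by rewrite [_ * 2]mulrC [2 * (_ * _)]mulrA.
  apply: ler_sum => j _.
  have hP n N : Pc n N -> (1 / 2) ^+ n * theta ^+ N <= eps.
    rewrite /Pc negb_and -!ltnNge => /orP[hn|hN].
      apply: le_trans he1; apply: (@le_trans _ _ ((1 / 2) ^+ n)); first by rewrite ler_piMr ?exprn_ge0 ?exprn_ile1 // ltW.
      by rewrite ler_wiXn2l //; lra.
    apply: le_trans he2; apply: (@le_trans _ _ (theta ^+ N)).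
      by rewrite ler_piMl ?exprn_ge0 ?exprn_ile1 // ?ltW //; lra.
    by rewrite ler_wiXn2l // ltW.
  have := itint_wcut_le oU BU rho0 hf F0 hF half0 th0 e0 hP T0 ctrl_int 0 0 j Bp A0 sp bp TT.
  rewrite !expr0 [1 * 1]mulr1 [1 * cabs _]mul1r => /le_trans; apply.
  rewrite -mulrA ler_wpM2l ?mulr_ge0 // mulrA [_ * cc ^+ _]mulrC -mulrA.
  have G20 i : 0 <= F (Gen i) / (1 / 2 * theta ^+ (i != ord0)).
    by rewrite divr_ge0 // mulr_ge0 ?(ltW half0) // exprn_ge0 // ltW.
  have w0 := Wt_ge0 G20 ctrl_int T0 (lexx T).
  have := rise2_small j (mulr_ge0 cc0 w0) W2; apply: le_trans.
  rewrite [(cc * _) ^+ _]exprMn; move: (cc ^+ j) (Wt _ _ _ ^+ j) => y z.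
  by rewrite le_eqVlt; apply/orP; left; apply/eqP; ring.
have := lerD h1 h2; lra.
Qed.
End SysEst.

Section Bounds.
Variables (R : realType) (k : scalars) (d q M : nat).
Local Notation K := (K R k).
Local Notation mu := (@lebesgue_measure R).
Hypotheses (hd : (0 < d)%N) (hq : (0 < q)%N).
Variables (r A0 delta : R).
Hypotheses (r0 : 0 < r) (A00 : 0 < A0) (delta0 : 0 < delta).
Local Notation H := (vf_rate d r A0).
Local Notation F := (@vf_bound R d q r A0).

(** The bound 1/8 makes the expansions converge like powers of 1/4; the bound
    delta / r keeps every curve within delta of its starting point. *)
Definition small_rate : R := Num.min (1 / 8) (delta / r).
Definition eta_den : R := 2 * q.+1%:R * M`!%:R * 2 ^+ (2 * M + 4) * H.
(** Chosen so that the sum of xi_weight over all brackets is at most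
    xi_weight_sum. *)
Definition eta0 : R := small_rate / eta_den.
Definition kappa : R := 2 ^+ (2 * M + 4) * H * eta0.
(** Bounds xi_b f_b after division by the weight 2^(-|b|) theta^(nocc b). *)
Definition xi_weight (b : br q) : R := r / (2 * d%:R) * M`!%:R * kappa ^+ len b.
Definition xi_weight_sum : R := r / (2 * d%:R) * small_rate.

Let dR : 0 < d%:R :> R. Proof. by rewrite ltr0n. Qed.
Let H0 : 0 < H. Proof. exact: vf_rate_gt0. Qed.
Let fM : 1 <= M`!%:R :> R. Proof. by rewrite ler1n fact_gt0. Qed.

Lemma small_rate_gt0 : 0 < small_rate.
Proof. by rewrite lt_min; apply/andP; split; [lra|rewrite divr_gt0]. Qed.
Lemma small_rate_le : small_rate <= 1 / 8. Proof. by rewrite ge_min lexx. Qed.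
Lemma small_rate_r : r * small_rate <= delta.
Proof. by rewrite mulrC -ler_pdivlMr // ge_min lexx orbT. Qed.
Lemma eta_den_gt0 : 0 < eta_den.
Proof. by rewrite /eta_den; do 4?apply: mulr_gt0 => //; rewrite ?exprn_gt0 ?ltr0n ?fact_gt0. Qed.
Lemma eta0_gt0 : 0 < eta0. Proof. by rewrite divr_gt0 ?small_rate_gt0 ?eta_den_gt0. Qed.
Lemma Zeta : eta_den * eta0 = small_rate.
Proof. by rewrite mulrC divfK // gt_eqF // eta_den_gt0. Qed.

Lemma kappa_ge0 : 0 <= kappa.
Proof.
apply: mulr_ge0; last exact: ltW eta0_gt0.
by apply: mulr_ge0; [exact: exprn_ge0|exact: ltW].
Qed.

Lemma kappa_le : 2 * q.+1%:R * M`!%:R * kappa = small_rate.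
Proof. by rewrite -Zeta /kappa /eta_den !mulrA. Qed.

Lemma Heta : 32 * (H * eta0) <= small_rate.
Proof.
rewrite -kappa_le /kappa -[_ * H * eta0]mulrA; have := mulr_gt0 H0 eta0_gt0.
move: (H * eta0) => y y0.
have h1 : 1 <= q.+1%:R :> R by rewrite ler1n.
have h2 : 16 <= 2 ^+ (2 * M + 4) :> R.
  by rewrite exprD (_ : 2 ^+ 4 = 16) ?ler_peMl ?exprn_ege1 //; lra.
rewrite mulrA; apply: ler_wpM2r; first exact: ltW.
move: (2 ^+ _) (q.+1%:R) (M`!%:R) h2 h1 fM => a b c ha hb hc.
have : 1 <= b * c by rewrite -[1]mulr1 ler_pM.
move=> hbc; have : 16 <= b * c * a by rewrite -[16]mul1r ler_pM // ltW.
lra.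
Qed.

Lemma xi_weight_ge0 b : 0 <= xi_weight b.
Proof. by rewrite /xi_weight !mulr_ge0 ?exprn_ge0 ?kappa_ge0 ?invr_ge0 ?mulr_ge0 // ltW. Qed.

Lemma xi_weight_sum_le s : uniq s -> \sum_(b <- s) xi_weight b <= xi_weight_sum.
Proof.
move=> us; rewrite /xi_weight -mulr_sumr /xi_weight_sum -mulrA; apply: ler_wpM2l.
  by rewrite divr_ge0 ?mulr_ge0 // ltW.
have hk : 4 * q.+1%:R * kappa <= 1.
  have := kappa_le; have := small_rate_le; have : 0 <= q.+1%:R * kappa by rewrite mulr_ge0 // kappa_ge0.
  rewrite [2 * _ * _]mulrAC -[2 * _ * _ * kappa]mulrA -[4 * _ * _]mulrA.
  move: (_ * kappa) (M`!%:R) fM => y c hc y0 h1 h2.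
  have : y <= c * y by rewrite ler_peMl.
  by lra.
have := tree_sum kappa_ge0 hk us.
have := kappa_le; move: (\sum_(b <- s) _) => S e hS.
have := ler_wpM2l (le_trans ler01 fM) hS; rewrite -e; lra.
Qed.

Lemma ccL : d%:R / (r / 2) * xi_weight_sum = small_rate.
Proof. by rewrite /xi_weight_sum; field; rewrite !gt_eqF. Qed.

Lemma dLam : d%:R * xi_weight_sum <= delta.
Proof.
have -> : d%:R * xi_weight_sum = r * small_rate / 2 by rewrite /xi_weight_sum; field; rewrite gt_eqF.
have := small_rate_r; have : 0 <= r * small_rate by rewrite mulr_ge0 ?ltW // small_rate_gt0.
lra.
Qed.

Lemma F_gen i : F (Gen i) = r / (2 * d%:R) * H.
Proof. by rewrite /vf_bound [len _]/= expr1 mulr1. Qed.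

Variables (t : R) (u : 'I_q -> R -> K).
Hypotheses (t0 : 0 <= t) (te : t <= eta0).
Hypothesis iu : forall j, integrableK `]0, t[ (u j).
Variable Ub : R.
Hypothesis hU : L1norm `]0, t[ u <= Ub.

Lemma L1norm_ge0 : 0 <= L1norm `]0, t[ u.
Proof. by apply: sumr_ge0 => i _; apply: Rintegral_ge0 => x _. Qed.

Lemma L1norm_coord j : \int[mu]_(s in `]0, t[) cabs (u j s) <= L1norm `]0, t[ u.
Proof.
rewrite /L1norm (bigD1 j) //= lerDl; apply: sumr_ge0 => i _.
by apply: Rintegral_ge0 => x _.
Qed.

Lemma Wt_ctrl (g0 g1 : R) (G : 'I_q.+1 -> R) : G ord0 = g0 ->
  (forall j, G (lift ord0 j) = g1) -> Wt G (ctrl u) t = g0 * t + g1 * L1norm `]0, t[ u.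
Proof.
move=> e0 e1; rewrite /Wt big_ord_recl e0; congr (_ + _).
  congr (_ * _); rewrite -[RHS](Rint1 t0); apply: eq_Rintegral => s _.
  by rewrite /ctrl unlift_none cabs1.
rewrite /L1norm mulr_sumr; apply: eq_bigr => j _; rewrite e1; congr (_ * _).
by apply: eq_Rintegral => s _; rewrite /ctrl liftK.
Qed.

Variables (B : set (br q)) (le : rel (br q)).
Hypothesis hB : hall_set B le.
Hypotheses (U0 : 0 < Ub) (U2 : Ub <= 2 * eta0).
(** The weight theta of a control letter. Its proportionality to the bound Ub
    on the norm of the controls is what produces the power M + 1 in the error. *)
Definition ctrl_ratio : R := Ub / (2 * eta0).

Lemma th_gt0 : 0 < ctrl_ratio. Proof. by rewrite divr_gt0 // mulr_gt0 // eta0_gt0. Qed.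
Lemma th_le1 : ctrl_ratio <= 1. Proof. by rewrite ler_pdivrMr ?mul1r // mulr_gt0 // eta0_gt0. Qed.
Lemma thE : Ub = 2 * eta0 * ctrl_ratio.
Proof. by rewrite /ctrl_ratio mulrC divfK // gt_eqF // mulr_gt0 // eta0_gt0. Qed.

(** The factorial in the bound of f_b is split by fact_split; the power nocc
    b of Ub is written with theta. *)
Lemma xi_F b : B b -> (nocc b <= M)%N ->
  cabs (xi u b t) * F b <= (1 / 2) ^+ len b * ctrl_ratio ^+ nocc b * xi_weight b.
Proof.
move=> Bb nM.
have hU' j : \int[mu]_(s in `]0, t[) cabs (u j s) <= Ub := le_trans (L1norm_coord j) hU.
have h1 := xi_bound t0 iu hB hU' hq Bb t0 (lexx t).
have e0 := eta0_gt0.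
have F0 : 0 <= F b by exact: vf_bound_ge0.
apply: (le_trans (ler_wpM2r F0 h1)).
have kl : (kap b <= 2 * M + 1)%N by rewrite /kap; case: (headed _ b); move: nM; clear; lia.
have h2 : (2 : R) ^+ (kap b * len b) <= 2 ^+ ((2 * M + 1) * len b).
  by rewrite ler_weXn2l ?ler1n // leq_mul2r kl orbT.
have h3 : t ^+ nocc0 b <= (2 * eta0) ^+ nocc0 b.
  have e2 : t <= 2 * eta0 by move: e0 te; move: eta0 => y; lra.
  by rewrite lerXn2r ?nnegrE // (le_trans t0).
have h4 := fact_split R nM.
have hn := nocc0_nocc b.
have f0 : 0 < (nocc0 b)`!%:R :> R by rewrite ltr0n fact_gt0.
have c00 : 0 <= r / (2 * d%:R) * H ^+ len b.
  by rewrite mulr_ge0 ?exprn_ge0 ?divr_ge0 ?mulr_ge0 // ltW.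
apply: (@le_trans _ _ (2 ^+ ((2 * M + 1) * len b) * ((2 * eta0) ^+ nocc0 b / (nocc0 b)`!%:R) * Ub ^+ nocc b *
   (r / (2 * d%:R) * H ^+ len b * (2 ^+ len b * (nocc0 b)`!%:R * M`!%:R)))).
  apply: ler_pM => //.
  - by rewrite !mulr_ge0 ?exprn_ge0 ?invr_ge0 // ltW.
  - apply: ler_wpM2r; first by rewrite exprn_ge0 // ltW.
    by apply: ler_pM; rewrite ?exprn_ge0 // ?divr_ge0 ?exprn_ge0 // ler_wpM2r // invr_ge0 ltW.
  - exact: ler_wpM2l.
rewrite {1}thE [(2 * eta0 * ctrl_ratio) ^+ _]exprMn /xi_weight /kappa.
rewrite le_eqVlt; apply/orP; left; apply/eqP.
have e1 : (2 * eta0) ^+ nocc0 b * (2 * eta0) ^+ nocc b = (2 * eta0) ^+ len b by rewrite -exprD hn.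
have e2 : (2 : R) ^+ ((2 * M + 1) * len b) * 2 ^+ len b * (2 * eta0) ^+ len b * H ^+ len b =
   (1 / 2) ^+ len b * (2 ^+ (2 * M + 4) * H * eta0) ^+ len b.
  rewrite exprM -!exprMn; congr (_ ^+ _); rewrite !exprD expr1 (_ : 2 ^+ 4 = 16); last by lra.
  by move: ((2 : R) ^+ (2 * M)) => y; field.
transitivity (ctrl_ratio ^+ nocc b * (r / (2 * d%:R)) * M`!%:R * ((nocc0 b)`!%:R^-1 * (nocc0 b)`!%:R) *
  (2 ^+ ((2 * M + 1) * len b) * 2 ^+ len b * ((2 * eta0) ^+ nocc0 b * (2 * eta0) ^+ nocc b) * H ^+ len b)).
  move: (r / _) ((2 : R) ^+ ((2 * M + 1) * len b)) ((2 * eta0) ^+ nocc0 b) ((2 * eta0) ^+ nocc b) ((nocc0 b)`!%:R^-1) => *; ring.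
rewrite e1 e2 mulVf ?gt_eqF // mulr1.
by move: (r / _) ((1 / 2) ^+ _) ((2 ^+ _ * _ * _) ^+ len b) (ctrl_ratio ^+ nocc b) => *; ring.
Qed.

Let c0H : R := r / (2 * d%:R) * H.
Let c0H0 : 0 <= c0H. Proof. by rewrite mulr_ge0 ?divr_ge0 ?mulr_ge0 // ltW. Qed.

Lemma W1_eq : Wt (fun i => F (Gen i)) (ctrl u) t = c0H * (t + L1norm `]0, t[ u).
Proof. by rewrite (@Wt_ctrl c0H c0H) ?F_gen // -?mulrDr // => j; rewrite F_gen. Qed.

Lemma W1_le : Wt (fun i => F (Gen i)) (ctrl u) t <= c0H * (3 * eta0).
Proof.
rewrite W1_eq ler_wpM2l //; move: hU U2 te; move: (L1norm _ _) eta0 => N e h1 h2 h3; lra.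
Qed.

Lemma cc_c0H (y : R) : d%:R / (r / 2) * (c0H * y) = H * y.
Proof. by rewrite /c0H; move: H => h; field; rewrite !gt_eqF. Qed.

Lemma W1_small : d%:R / (r / 2) * Wt (fun i => F (Gen i)) (ctrl u) t <= 1 / 8.
Proof.
have h0 : 0 <= d%:R / (r / 2) by rewrite !divr_ge0 // ltW.
apply: (le_trans (ler_wpM2l h0 W1_le)); rewrite cc_c0H.
have := Heta; have := small_rate_le; have : 0 <= H * eta0 by rewrite mulr_ge0 ?ltW // eta0_gt0.
by rewrite [H * (3 * _)]mulrCA; move: (H * eta0) small_rate => y e; lra.
Qed.

Lemma W1_d : d%:R * Wt (fun i => F (Gen i)) (ctrl u) t < delta.
Proof.
apply: (@le_lt_trans _ _ (d%:R * (c0H * (3 * eta0)))); first by rewrite ler_wpM2l // W1_le.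
have -> : d%:R * (c0H * (3 * eta0)) = r / 2 * (3 * (H * eta0)).
  by rewrite /c0H; move: H => h; field; rewrite !gt_eqF.
have h1 := ler_wpM2l (ltW r0) Heta; have := small_rate_r.
have : 0 < r * small_rate by rewrite mulr_gt0 // small_rate_gt0.
lra.
Qed.

Lemma W2_small : d%:R / (r / 2) *
  Wt (fun i => F (Gen i) / (1 / 2 * ctrl_ratio ^+ (i != ord0))) (ctrl u) t <= 1 / 8.
Proof.
have h0 : 0 <= d%:R / (r / 2) by rewrite !divr_ge0 // ltW.
have th := th_gt0.
rewrite (@Wt_ctrl (c0H * 2) (c0H * (2 / ctrl_ratio))); last 2 first.
- by rewrite F_gen eqxx expr0 mulr1 invf_div divr1.
- move=> j; rewrite F_gen (_ : (lift ord0 j != ord0) = true) ?expr1; last by rewrite eq_sym neq_lift.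
  by rewrite [(1 / 2 * ctrl_ratio)^-1]invfM invf_div divr1.
have h1 : L1norm `]0, t[ u / ctrl_ratio <= 2 * eta0.
  by rewrite ler_pdivrMr // -thE.
have h2 : c0H * 2 * t + c0H * (2 / ctrl_ratio) * L1norm `]0, t[ u <= c0H * (6 * eta0).
  rewrite [leLHS](_ : _ = c0H * (2 * t + 2 * (L1norm `]0, t[ u / ctrl_ratio))); last first.
    by move: (ctrl_ratio^-1) => y; ring.
  apply: ler_wpM2l => //.
  by move: h1 te; move: (_ / ctrl_ratio) eta0 => N e h1 h2; lra.
apply: (le_trans (ler_wpM2l h0 h2)); rewrite cc_c0H.
have := Heta; have := small_rate_le; have : 0 <= H * eta0 by rewrite mulr_ge0 ?ltW // eta0_gt0.
by rewrite [H * (6 * _)]mulrCA; move: (H * eta0) small_rate => y e; lra.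
Qed.
End Bounds.

(** * The limit product and the error estimate *)

Section Continuity.
Variables (R : realType) (k : scalars) (d q : nat).
Local Notation K := (K R k).
Local Notation V := 'rV[K]_d.

(** Continuity at p in epsilon-delta form. *)
Definition econt (g : V -> K) (p : V) := forall e : R, 0 < e ->
  exists2 dl : R, 0 < dl & forall h, nrm1 h < dl -> cabs (g (p + h) - g p) <= e.

Lemma econt_cst (c : K) p : econt (fun=> c) p.
Proof. by move=> e e0; exists 1 => // h _; rewrite subrr cabs0 ltW. Qed.

Lemma econt_D g1 g2 p : econt g1 p -> econt g2 p -> econt (fun y => g1 y + g2 y) p.
Proof.
move=> c1 c2 e e0; have e2 : 0 < e / 2 by rewrite divr_gt0.
have [d1 d10 h1] := c1 _ e2; have [d2 d20 h2] := c2 _ e2.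
exists (Num.min d1 d2) => [|h]; first by rewrite lt_min d10.
rewrite lt_min => /andP[/h1 a1 /h2 a2].
rewrite (_ : _ - _ = g1 (p + h) - g1 p + (g2 (p + h) - g2 p)); last by ring.
by apply: (le_trans (cabsD _ _)); apply: (le_trans (lerD a1 a2)); lra.
Qed.

Lemma econt_Z (c : K) g p : econt g p -> econt (fun y => c * g y) p.
Proof.
move=> cg e e0; have c1 : 0 < cabs c + 1 by rewrite ltr_wpDl.
have [dl d0 h1] := cg _ (divr_gt0 e0 c1); exists dl => // h /h1 a1.
rewrite -mulrBr cabsM; apply: (le_trans (ler_wpM2l (cabs_ge0 _) a1)).
by rewrite mulrCA ger_pMr // ler_pdivrMr // mul1r lerDl.
Qed.

Lemma econt_sum (I : Type) (s : seq I) (g : I -> V -> K) p :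
  (forall i, econt (g i) p) -> econt (fun y => \sum_(i <- s) g i y) p.
Proof.
move=> h; elim: s => [|i s ih].
  move=> e /(econt_cst 0 p)[dl d0 hd]; exists dl => // h' /hd.
  by rewrite !big_nil.
move=> e /(econt_D (h i) ih)[dl d0 hd]; exists dl => // h' /hd.
by rewrite !big_cons.
Qed.

Variables (U : set V) (oU : open U).
Variable f : 'I_q.+1 -> V -> V.
Hypothesis hf : forall i, vsm U (f i).

Lemma econt_tau (b : br q) (c : V -> seq 'I_q.+1 -> K) p : (forall w, econt (c^~ w) p) ->
  forall w, econt (fun y => tau b (c y) w) p.
Proof.
elim: b c => [i|b1 h1 b2 h2] c hc w; first exact: hc.
move=> e /(econt_D (h1 _ (h2 _ hc) w) (econt_Z (-1) (h2 _ (h1 _ hc) w)))[dl d0 hd].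
by exists dl => // h /hd; rewrite /= !mulN1r.
Qed.

Lemma econt_expprod (x : br q -> K) L s (c : V -> seq 'I_q.+1 -> K) p : (forall w, econt (c^~ w) p) ->
  econt (fun y => expprod x L s (c y)) p.
Proof.
elim: s c => [|b s ih] c hc; first exact: hc.
apply: econt_sum => i; apply: econt_Z; apply: ih.
elim: (val i) => [//|j ihj] w; exact: econt_tau.
Qed.

Lemma econt_gtrunc (x : br q -> K) (J : nat -> seq (br q)) L phi p : U p -> smooth_on U phi ->
  econt (fun y => gtrunc y f x J L phi) p.
Proof.
move=> Up sp; apply: (econt_expprod x L (J L) (c := fun y => wcut (fun n _ => (n <= L)%N) 0 0 (chi f y phi))) => w.
rewrite /wcut /=; case: (0 + size w <= L)%N; last exact: econt_cst.
exact: (has_grad_cont (diff_has_grad (smooth_diff (smooth_Lw oU hf w sp) Up))).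
Qed.
End Continuity.

Section Final.
Variables (R : realType) (k : scalars) (d q : nat).
Hypotheses (hd : (0 < d)%N) (hq : (0 < q)%N).
Local Notation K := (K R k).
Local Notation V := 'rV[K]_d.
Variables (B : set (br q)) (le : rel (br q)).
Hypothesis hB : hall_set B le.
Variables (M : nat) (r delta A0 : R).
Hypotheses (hr : 0 < r) (hdelta : 0 < delta) (A00 : 0 < A0).
Variables (U : set V) (f : 'I_q.+1 -> V -> V).
Hypotheses (oU : open U) (BU : cball k d (4 * delta) `<=` U).
Hypothesis hf : forall i, vsm U (f i).
Hypothesis hb : forall i j, bd (cball k d (4 * delta)) r (fun x => f i x 0 j) A0 1.

Local Notation F := (@vf_bound R d q r A0).
Local Notation eta := (eta0 d q M r A0 delta).
Local Notation sm := (small_rate r delta).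

Let dR : 0 < d%:R :> R. Proof. by rewrite ltr0n. Qed.
Let rho0 : 0 < r / 2. Proof. by rewrite divr_gt0. Qed.
Let F0 b : 0 <= F b. Proof. exact: vf_bound_ge0. Qed.
Let hF b j : bd (cball k d (4 * delta)) (r / 2) (fun x => vf f b x 0 j) (F b) 1.
Proof. exact: (bd_vf oU BU hd hr A00 hf hb b j). Qed.
Let G0 (i : 'I_q.+1) : 0 <= F (Gen i). Proof. exact: F0. Qed.
Let hG (i : 'I_q.+1) j : bd (cball k d (4 * delta)) (r / 2) (fun x => f i x 0 j) (F (Gen i)) 1.
Proof. exact: (hF (Gen i)). Qed.
Let eta_gt0 : 0 < eta. Proof. exact: eta0_gt0. Qed.

Lemma ball_Om p x : cball k d delta p -> nrm1 (x - p) <= delta -> cball k d (4 * delta) x.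
Proof.
move=> pd xp; have := cball_near (ltW hdelta) pd xp; rewrite /cball /= => h; apply: (le_trans h).
by move: hdelta; lra.
Qed.

Lemma ball_U p : cball k d delta p -> U p.
Proof. by move=> pd; apply: BU; apply: (ball_Om pd); rewrite subrr nrm1_0 ltW. Qed.

Lemma Fld_sys (u : 'I_q -> R -> K) (x : R -> V) s j : Fld f (ctrl u) x s j =
  f ord0 (x s) 0 j + \sum_(i < q) u i s * f (lift ord0 i) (x s) 0 j.
Proof.
rewrite /Fld big_ord_recl; congr (_ + _); first by rewrite /ctrl unlift_none mul1r.
by apply: eq_bigr => i _; rewrite /ctrl liftK.
Qed.

(** Picard iteration in the ball of radius delta about p, which lies in the
    ball of radius 4 delta about 0. *)
Lemma exists_sol (T : R) (u : 'I_q -> R -> K) p : 0 <= T -> T <= eta ->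
  (forall i, integrableK `]0, T[ (u i)) -> L1norm `]0, T[ u <= eta ->
  cball k d delta p -> exists x, is_solution U f T u p x.
Proof.
move=> T0 Te iu hu pd.
have hU : L1norm `]0, T[ u <= 2 * eta by apply: (le_trans hu); move: eta_gt0; move: eta => e; lra.
have w1 := W1_small hd hr A00 hdelta T0 Te hU (lexx _).
have w2 := ltW (W1_d hd hr A00 hdelta T0 Te hU (lexx _)).
have iv := ctrl_int iu.
have s1 : nrm1 (p - p) + d%:R * Wt (fun i => F (Gen i)) (ctrl u) T <= delta.
  by rewrite subrr nrm1_0 add0r.
have s2 : d%:R * Wt (fun i => F (Gen i)) (ctrl u) T / (r / 2) <= 1 / 2.
  by rewrite mulrAC; apply: (le_trans w1); lra.
have [x sx] := sol_exists BU (fun x => ball_Om pd (x := x)) rho0 hf G0 hG T0 iv s1 s2.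
have [x0 xOm xAC] := sx; exists x; split.
- exact: (sol_cont (fun x => ball_Om pd (x := x)) hG T0 iv sx).
- by move=> t tT; apply: BU; apply: (ball_Om pd); exact: xOm.
move=> t tT j; have [_ ->] := xAC j => //; rewrite x0; congr (_ + _).
by apply: eq_integralK => s _; rewrite Fld_sys.
Qed.

Lemma sol_of_is (T t : R) (u : 'I_q -> R -> K) p x : 0 <= t -> t <= T -> t <= eta ->
  (forall i, integrableK `]0, t[ (u i)) -> L1norm `]0, t[ u <= 2 * eta ->
  cball k d delta p -> is_solution U f T u p x ->
  sol p delta f t (ctrl u) x p.
Proof.
move=> t0 tT te iu hU pd [xc xU xE]; have iv := ctrl_int iu.
have w2 := W1_d hd hr A00 hdelta t0 te hU (lexx _).
apply: (sol_given (fun x => ball_Om pd (x := x)) hf G0 hG t0 iv).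
- by apply: continuous_subspaceW xc; apply: subset_itvl; rewrite bnd_simp.
- by move=> s /andP[s0 st]; apply: xU; rewrite s0 (le_trans st).
- move=> s /andP[s0 st] j; rewrite xE ?s0 ?(le_trans st) //; congr (_ + _).
  by apply: eq_integralK => s' _; rewrite Fld_sys.
by rewrite subrr nrm1_0 add0r.
Qed.

(** A Cauchy bound for the coordinate functions, the test functions of the
    whole proof. *)
Definition coord_bound : R := Num.max (r / 2) (4 * delta).

Let Bc0 : 0 < coord_bound. Proof. by rewrite lt_max rho0. Qed.

Lemma bdc j : bd (cball k d (4 * delta)) (r / 2) (fun x => x 0 j) coord_bound 1.
Proof.
apply: bd_coord => //; first by rewrite le_max lexx.
move=> x xd; apply: (le_trans (enorm_coord _ _)); apply: (le_trans xd).
by rewrite le_max lexx orbT.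
Qed.

Let smc (j : 'I_d) : smooth_on U (fun x : V => x 0 j). Proof. exact: smooth_coord. Qed.

Variable J : nat -> seq (br q).
Hypothesis hJ : forall L b, b \in J L <-> B b /\ in_range L M (len b) (nocc b).
Hypothesis sJ : forall L, pairwise (slt le) (J L).

Section Time.
Variables (t : R) (u : 'I_q -> R -> K).
Hypotheses (t0 : 0 <= t) (te : t <= eta).
Hypothesis iu : forall i, integrableK `]0, t[ (u i).
Hypothesis hu : L1norm `]0, t[ u <= eta.

Local Notation N := (L1norm `]0, t[ u).
Local Notation x := (fun b => xi u b t).
Local Notation G := (fun p L j => gtrunc p f x J L (fun y : V => y 0 j)).

Let N2 : N <= 2 * eta. Proof. by apply: (le_trans hu); move: eta_gt0; move: eta => e; lra. Qed.
Let E2 : 0 < 2 * eta. Proof. by rewrite mulr_gt0. Qed.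
Let hcL : d%:R / (r / 2) * xi_weight_sum d r delta <= 1 / 8.
Proof. by rewrite ccL //; exact: small_rate_le. Qed.
Let hdL : d%:R * xi_weight_sum d r delta <= delta. Proof. exact: dLam. Qed.
Let lam0 (b : br q) : 0 <= xi_weight d M r A0 delta b. Proof. exact: xi_weight_ge0. Qed.
Let hLam (s : seq (br q)) : uniq s -> \sum_(b <- s) xi_weight d M r A0 delta b <= xi_weight_sum d r delta.
Proof. exact: xi_weight_sum_le. Qed.

Lemma prod_near p s L : cball k d delta p -> pairwise (slt le) s ->
  (forall b, b \in s -> B b /\ (nocc b <= M)%N) -> {subset J L <= s} ->
  exists2 y, oprod U (fun b y => x b *: vf f b y) s p y &
  forall j, cabs (y 0 j - G p L j) <= 2 * coord_bound / 2 ^+ L.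
Proof.
move=> pd ps hs Js.
have OmB := fun x => ball_Om pd (x := x).
have th0 := th_gt0 q M hd hr A00 hdelta E2.
have th1 := th_le1 hd hr A00 hdelta (lexx (2 * eta)).
have hx := xi_F hd hq hr A00 hdelta t0 te iu N2 hB E2.
have [y oy ok] := prod_ok oU BU OmB (ltW hdelta) rho0 hf F0 hF lam0 hLam hcL hdL th0 th1 hx (pw_uniq ps) hs.
exists y => // j.
exact: (near_gtrunc oU BU OmB (ltW hdelta) rho0 hf F0 hF hB lam0 hLam hcL th0 th1 hx hJ sJ ps hs Js ok (ltW Bc0) (smc j) (bdc j)).
Qed.

(** The estimates are used with theta = 1: the limit does not depend on the
    bound Ub of the controls. *)
Lemma G_lim p : exists gp : V, cball k d delta p -> forall j L,
  cabs (gp 0 j - G p L j) <= 16 * coord_bound / 2 ^+ L.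
Proof.
have [pd|pd] := pselect (cball k d delta p); last by exists 0.
have OmB := fun x => ball_Om pd (x := x).
have th0 := th_gt0 q M hd hr A00 hdelta E2.
have th1 := th_le1 hd hr A00 hdelta (lexx (2 * eta)).
have hx := xi_F hd hq hr A00 hdelta t0 te iu N2 hB E2.
have hl j : exists l : K, forall L, cabs (l - G p L j) <= 16 * coord_bound / 2 ^+ L.
  have [l hl] := K_seq_lim (fun L => gtrunc_cauchy oU BU OmB (ltW hdelta) rho0 hf F0 hF hB lam0 hLam hcL hdL th0 th1 hx hJ sJ L (ltW Bc0) (smc j) (bdc j)).
  by exists l => L; rewrite (_ : 16 * coord_bound = 4 * (4 * coord_bound)) //; lra.
have [l hl'] := choice hl.
by exists (\row_j l j) => _ j L; rewrite mxE.
Qed.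

(** L is large enough for the truncation in length to cost no more than the
    truncation in the number of control letters. The constant 42 is the 10 of
    near_sys plus 32, twice the 16 in the distance of gtrunc L to its limit. *)
Lemma limit_est p (g : V) (X : R -> V) L (Ub : R) : cball k d delta p ->
  (forall j L, cabs (g 0 j - G p L j) <= 16 * coord_bound / 2 ^+ L) ->
  sol p delta f t (ctrl u) X p -> N <= Ub -> 0 < Ub -> Ub <= 2 * eta ->
  (1 / 2) ^+ L.+1 <= (Ub / (2 * eta)) ^+ M.+1 ->
  nrm1 (X t - g) <= d%:R * (42 * coord_bound * (Ub / (2 * eta)) ^+ M.+1).
Proof.
move=> pd hg sX NU U0 U2 hL.
have OmB := fun x => ball_Om pd (x := x).
have th0 := th_gt0 q M hd hr A00 hdelta U0.
have th1 := th_le1 hd hr A00 hdelta U2.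
have hx := xi_F hd hq hr A00 hdelta t0 te iu NU hB U0.
have w1 := W1_small hd hr A00 hdelta t0 te NU U2.
have w2 := W2_small hd hr A00 hdelta t0 te NU U0.
rewrite /nrm1 mulr_natl -[d in _ *+ d](card_ord d) -sumr_const; apply: ler_sum => j _; rewrite !mxE.
have h1 := sys_est oU BU OmB (ltW hdelta) rho0 hf F0 hF hB t0 iu th0 th1 w1 w2 (hJ L) (sJ L) hL (lexx _) sX (ltW Bc0) (smc j) (bdc j).
have h2 := near_sys oU BU OmB (ltW hdelta) rho0 hf F0 hF hB lam0 hLam hcL hdL th0 th1 hx hJ sJ (ltW Bc0) (smc j) (bdc j) hL (lexx _) h1.
have h3 := hg j L.
rewrite (_ : X t 0 j - g 0 j = (X t 0 j - G p L j) - (g 0 j - G p L j)); last by ring.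
apply: (le_trans (cabsD _ _)); rewrite cabsN; apply: (le_trans (lerD h2 h3)).
have -> : 16 * coord_bound / 2 ^+ L = 32 * coord_bound * (1 / 2) ^+ L.+1.
  by rewrite exprS div1r exprVn; move: (_ ^- L) => z; lra.
have h4 := ler_wpM2l (ltW Bc0) hL.
rewrite /ctrl_ratio; move: h4; move: (_ ^+ L.+1) (_ ^+ M.+1) coord_bound => z1 z2 z3; lra.
Qed.

(** theta must be positive, so Ub is taken slightly above the norm of u; the
    constants do not depend on Ub, and Ub tends to the norm. *)
Lemma final_est p (g : V) (X : R -> V) : cball k d delta p ->
  (forall j L, cabs (g 0 j - G p L j) <= 16 * coord_bound / 2 ^+ L) ->
  sol p delta f t (ctrl u) X p ->
  nrm1 (X t - g) <= d%:R * (42 * coord_bound) / (2 * eta) ^+ M.+1 * N ^+ M.+1.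
Proof.
move=> pd hg sX.
have N0 : 0 <= N by exact: L1norm_ge0.
have [Q Q0 hQ] := pow_near M.+1 N0 (ltW eta_gt0).
set C := d%:R * (42 * coord_bound) / (2 * eta) ^+ M.+1.
have C0 : 0 <= C.
  by apply: divr_ge0; [rewrite mulr_ge0 // mulr_ge0 // ltW|rewrite exprn_ge0 // ltW].
apply: (@le_geo _ _ _ (C * Q)) => n.
pose s : R := 1 / 2 ^+ n.
have s0 : 0 < s by rewrite divr_gt0 // exprn_gt0.
have s1 : s <= 1 by rewrite ler_pdivrMr ?exprn_gt0 // mul1r exprn_ege1 //; lra.
pose Ub := N + eta * s.
have es : 0 < eta * s by rewrite mulr_gt0.
have NU : N <= Ub by rewrite lerDl ltW.
have U0 : 0 < Ub by rewrite ltr_wpDl.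
have U2 : Ub <= 2 * eta.
  have : eta * s <= eta by rewrite ger_pMr.
  by rewrite /Ub; move: hu; move: (eta * s) N eta => a b c; lra.
have th0 : 0 < (Ub / (2 * eta)) ^+ M.+1 by rewrite exprn_gt0 // divr_gt0.
have [L hL] : exists L, (1 / 2) ^+ L.+1 <= (Ub / (2 * eta)) ^+ M.+1.
  have := near_infty_natSinv_expn_lt (PosNum th0); case=> L _ /(_ L (leqnn L)) /= h.
  exists L; apply: le_trans (ltW h).
  have -> : (1 / 2 : R) ^+ L.+1 = 1 / 2 * (1 / 2 ^+ L) by rewrite exprS !div1r exprVn.
  by rewrite ler_piMl ?divr_ge0 ?exprn_ge0 //; lra.
apply: (le_trans (limit_est pd hg sX NU U0 U2 hL)).
rewrite expr_div_n.
have -> : d%:R * (42 * coord_bound * (Ub ^+ M.+1 / (2 * eta) ^+ M.+1)) = C * Ub ^+ M.+1.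
  by rewrite /C; move: ((2 * eta) ^- M.+1) => z; ring.
apply: (le_trans (ler_wpM2l C0 (hQ s (ltW s0) s1))).
rewrite mulrDr lerD2l /s div1r le_eqVlt; apply/orP; left; apply/eqP.
by move: (2 ^- n) => z; ring.
Qed.

Lemma g_cont (g : V -> V) :
  (forall p, cball k d delta p -> forall j L, cabs (g p 0 j - G p L j) <= 16 * coord_bound / 2 ^+ L) ->
  {within cball k d delta, continuous g}.
Proof.
move=> hg; apply/subspace_continuousP => p pd; apply/cvgV_P => e e0.
have c0 : 0 < d%:R * (16 * coord_bound) by rewrite !mulr_gt0.
have [L hL] : exists L, d%:R * (16 * coord_bound) / 2 ^+ L < e / 4.
  have e4 : 0 < e / 4 / (d%:R * (16 * coord_bound)) by rewrite !divr_gt0.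
  have := near_infty_natSinv_expn_lt (PosNum e4); case=> L _ /(_ L (leqnn L)) /= h.
  by exists L; move: h; rewrite ltr_pdivlMr // div1r mulrC.
have e4d : 0 < e / (4 * d%:R) by rewrite divr_gt0 // mulr_gt0.
have hc j := econt_gtrunc oU hf x J L (ball_U pd) (smc j) e4d.
have [dl dl0 hdl] : exists2 dl : R, 0 < dl & forall h, nrm1 h < dl -> forall j, cabs (G (p + h) L j - G p L j) <= e / (4 * d%:R).
  have hc' j : exists dl : R, 0 < dl /\ forall h, nrm1 h < dl -> cabs (G (p + h) L j - G p L j) <= e / (4 * d%:R).
    by have [dl ? ?] := hc j; exists dl.
  have [dl hdl] := choice hc'.
  exists (\big[Num.min/1]_j dl j).
    by apply: (big_ind (fun y : R => 0 < y)) => // [a b a0 b0|j _]; [rewrite lt_min a0|have [] := hdl j].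
  move=> h hh j; apply: (hdl j).2; apply: (lt_le_trans hh).
  by rewrite (bigD1 j) //= ge_min lexx.
rewrite near_withinE; apply/nbhs_rV; exists dl => // h hh pd'.
rewrite /nrm1; apply: (@le_lt_trans _ _ (\sum_(j < d) (2 * (16 * coord_bound / 2 ^+ L) + e / (4 * d%:R)))).
  apply: ler_sum => j _; rewrite !mxE.
  rewrite (_ : g (p + h) 0 j - g p 0 j = (g (p + h) 0 j - G (p + h) L j) - (g p 0 j - G p L j) + (G (p + h) L j - G p L j)); last by ring.
  have a1 := hg _ pd' j L; have a2 := hg _ pd j L; have a3 := hdl h hh j.
  apply: (le_trans (cabsD _ _)); apply: (le_trans (lerD (cabsD _ _) a3)).
  rewrite cabsN; apply: (le_trans (lerD (lerD a1 a2) (lexx _))).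
  by move: (16 * coord_bound / _) (e / _) => y z; lra.
rewrite sumr_const card_ord -[(_ + _) *+ d]mulr_natl mulrDr.
have -> : d%:R * (e / (4 * d%:R)) = e / 4 by field; rewrite gt_eqF.
have -> : d%:R * (2 * (16 * coord_bound / 2 ^+ L)) = 2 * (d%:R * (16 * coord_bound) / 2 ^+ L).
  by move: (2 ^- L) => z; ring.
by move: hL e0; move: (_ / 2 ^+ L) => y; lra.
Qed.

Lemma g_oprod (g : V -> V) :
  (forall p, cball k d delta p -> forall j L, cabs (g p 0 j - G p L j) <= 16 * coord_bound / 2 ^+ L) ->
  oprod_cvg U le [set b | B b /\ (nocc b <= M)%N] (fun b y => xi u b t *: vf f b y) delta g.
Proof.
move=> hg e e0.
have c0 : 0 < d%:R * (18 * coord_bound) by rewrite !mulr_gt0.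
have [L hL] : exists L, d%:R * (18 * coord_bound) / 2 ^+ L < e.
  have e4 : 0 < e / (d%:R * (18 * coord_bound)) by rewrite !divr_gt0.
  have := near_infty_natSinv_expn_lt (PosNum e4); case=> L _ /(_ L (leqnn L)) /= h.
  by exists L; move: h; rewrite ltr_pdivlMr // div1r mulrC.
exists (J L) => [b /hJ[Bb /andP[_ nb]]//|s ps hs Js p pd].
have [y oy hy] := prod_near pd ps hs Js; exists y => //.
apply: (le_trans (enorm_nrm1 _)); apply: le_trans (ltW hL).
rewrite /nrm1; apply: (@le_trans _ _ (\sum_(j < d) (18 * coord_bound / 2 ^+ L))).
  apply: ler_sum => j _; rewrite !mxE.
  rewrite (_ : g p 0 j - y 0 j = (g p 0 j - G p L j) - (y 0 j - G p L j)); last by ring.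
  apply: (le_trans (cabsD _ _)); rewrite cabsN; apply: (le_trans (lerD (hg p pd j L) (hy j))).
  by move: (_ ^- L) => z; lra.
by rewrite sumr_const card_ord -[(_ / _) *+ d]mulr_natl mulrA.
Qed.
End Time.
End Final.

Theorem proposition143 (R : realType) (k : scalars) (d q : nat)
    (hd : (0 < d)%N) (hq : (0 < q)%N)
    (B : set (br q)) (le : rel (br q)) (hB : hall_set B le)
    (M : nat) (r delta : R) (hr : 0 < r) (hdelta : 0 < delta)
    (U : set 'rV[K R k]_d) (f : 'I_q.+1 -> 'rV[K R k]_d -> 'rV[K R k]_d)
    (hf : forall i, in_Comega r (4%:R * delta) U (f i)) :
  exists eta C : R, [/\ 0 < eta, 0 < C &
    forall (T : R) (u : 'I_q -> R -> K R k),
      0 < T -> T <= eta ->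
      (forall i, integrableK `]0, T[ (u i)) ->
      L1norm `]0, T[ u <= eta ->
      (forall p, cball k d delta p -> exists x, is_solution U f T u p x) /\
      (forall t, 0 <= t <= T ->
        exists g : 'rV[K R k]_d -> 'rV[K R k]_d,
          [/\ {within cball k d delta, continuous g},
              oprod_cvg U le [set b | B b /\ (nocc b <= M)%N]
                (fun b y => xi u b t *: vf f b y) delta g &
              forall p, cball k d delta p ->
                forall x, is_solution U f T u p x ->
                  enorm (x t - g p) <= C * L1norm `]0, t[ u ^+ M.+1])].
Proof.
have d40 : 0 <= 4 * delta by rewrite mulr_ge0 // ltW.
have oU : open U by have [] := hf ord0.
have BU : cball k d (4 * delta) `<=` U by have [] := hf ord0.
have vs i : vsm U (f i) by have [] := hf i.
have hA i : exists A : R, 0 < A /\ forall j, bd (cball k d (4 * delta)) r (fun x => f i x 0 j) A 1.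
  by have [A A0 hA] := omega_bd hr d40 (hf i); exists A.
have [A hA'] := choice hA.
pose A0 := \sum_i A i.
have Ai i : A i <= A0.
  by rewrite /A0 (bigD1 i) //= lerDl; apply: sumr_ge0 => j _; rewrite ltW //; have [] := hA' j.
have A00 : 0 < A0 by apply: lt_le_trans (Ai ord0); have [] := hA' ord0.
have hb i j : bd (cball k d (4 * delta)) r (fun x => f i x 0 j) A0 1.
  by apply: (bd_le hr (Ai i)); have [_] := hA' i.
have [J hJ] := choice (fun L => enum_hall hB L M).
have hJ1 L := (hJ L).1; have hJ2 L := (hJ L).2.
have e0 := eta0_gt0 q M hd hr A00 hdelta.
set eta := eta0 _ _ _ _ _ _ in e0.
exists eta, (d%:R * (42 * coord_bound r delta) / (2 * eta) ^+ M.+1).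
have Bc0 : 0 < coord_bound r delta by rewrite lt_max divr_gt0.
split => //.
  by apply: divr_gt0; [apply: mulr_gt0; [rewrite ltr0n|rewrite mulr_gt0]|rewrite exprn_gt0 // mulr_gt0].
move=> T u T0 Te iu hu; split.
  move=> p pd; exact: (exists_sol hd hr hdelta A00 oU BU vs hb (ltW T0) Te iu hu pd).
move=> t /andP[t0 tT]; have te := le_trans tT Te.
have iut i : integrableK `]0, t[ (u i) by apply: intK_sub0 tT (iu i).
have hut : L1norm `]0, t[ u <= eta.
  apply: le_trans hu; apply: ler_sum => i _.
  exact: (AC_mono (AC_cabs (iu i)) (fun x _ _ => cabs_ge0 _) t0 tT (lexx _)).
have [g hg] := choice (G_lim hd hq hB hr hdelta A00 oU BU vs hb hJ1 hJ2 t0 te iut hut).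
exists g; split.
- exact: (g_cont hd hr hdelta oU BU vs hg).
- exact: (g_oprod hd hq hB hr hdelta A00 oU BU vs hb hJ1 hJ2 t0 te iut hut hg).
move=> p pd x sx; apply: (le_trans (enorm_nrm1 _)).
have hut2 : L1norm `]0, t[ u <= 2 * eta by apply: (le_trans hut); move: e0; clear; lra.
have sX := sol_of_is hd hr hdelta A00 oU BU vs hb t0 tT te iut hut2 pd sx.
exact: (final_est hd hq hB hr hdelta A00 oU BU vs hb hJ1 hJ2 t0 te iut hut pd (hg p pd) sX).
Qed.
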